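(* Let $k\ge1$, $D=(d_1,\dots,d_{k+1})\in\mathbb Z_{\ge0}^{k+1}$ with $d_1=0$, $d_{k+1}\le1$ and $d_2+\cdots+d_{k+1}\ge2$. Let $2\le l\le k$ with $d_i=0$ for all $i<l$, and let $l_1=\min\{i:i>l,\ d_i\ne0\}$ (when it exists). a) Suppose $d_l\ge2$. Let $D'$ be given by $d'_l=d_l-2$, $d'_i=d_i$ for $i\neq l$, and let $D''$ be given by $d''_{l-1}=d_{l-1}+1$, $d''_l=d_l-2$, $d''_{l+1}=d_{l+1}+1$, $d''_i=d_i$ otherwise, except that if $l=k$ then $d''_{k+1}=(d_{k+1}+1)\bmod 2$. Then $$\mathrm{ch}\,L^D=\mathrm{ch}\,L^{D'}+q^{\frac{p(D'')-p(D)}4+\frac{d_l-1}2}\,\mathrm{ch}\,L^{D''}.$$ Suppose now $d_l=1$, and let $D'$ be obtained from $D$ by decreasing $d_l$ by $1$, decreasing $d_{l_1}$ by $1$ and increasing $d_{l_1-l+1}$ by $1$. b$_1$) If $l_1\ne k+1$, let $D''$ be given by $d''_{l-1}=d_{l-1}+1$, $d''_l=0$, $d''_{l_1}=d_{l_1}-1$, $d''_{l_1+1}=d_{l_1+1}+1$, $d''_i=d_i$ otherwise, except that if $l_1=k$ then $d''_{k+1}=(d_{k+1}+1)\bmod2$. Then $$\mathrm{ch}\,L^D=\mathrm{ch}\,L^{D'}+q^{\frac{p(D'')-p(D)}4+\frac{d_{l_1}}2}\,\mathrm{ch}\,L^{D''}.$$ b$_2$) If $l_1=k+1$, then $\ma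thrm{ch}\,L^D=\mathrm{ch}\,L^{D'}$.
   Context: The fermionic space $F$: let $\psi(i),\phi(i)$, $i\in\mathbb Z$, be mutually anticommuting variables with zero squares. $F$ is the complex vector space with basis the semi-infinite monomials $\dots\psi(N-1)\phi(N-1)\psi(N)\phi(N)\,\psi(i_1)\cdots\psi(i_s)\,\phi(j_1)\cdots\phi(j_t)$, $N<i_1<\dots<i_s$, $N<j_1<\dots<j_t$. $\psi(i),\phi(i)$ act by right multiplication. Put $e_m=\sum_{i+j=m}\psi(i)\phi(j)$; these commute and act on $F^{\otimes k}$ by the coproduct. Put $v(2N)=\dots\psi(N-1)\phi(N-1)\psi(N)$, $v(2N+1)=\dots\psi(N-1)\phi(N-1)\psi(N)\phi(N)$. The grading operators $h_0$ and $d$ act diagonally on monomials of $F$: $h_0v(0)=dv(0)=0$, $[h_0,\psi(i)]=\psi(i)$, $[h_0,\phi(i)]=\phi(i)$, $[d,\psi(i)]=i\psi(i)$, $[d,\phi(i)]=i\phi(i)$; they act on $F^{\otimes k}$ additively (so $[d,e_m]=me_m$, $[h_0,e_m]=2e_m$, and $v(0),v(1)$ have $d$-degree $0$). Definition of $L^D$ for $D\in\mathbb Z_{\ge0}^{k+1}$ with $d_{k+1}\in\{0,1\}$: let $n=d_1+\cdots+d_{k+1}$ and $\beta_i=d_{i+1}+\cdots+d_{k+1}$, $i=1,\dots,k$. For $s\ge1$ put $$w_s=v(-\beta_1-2s)\otimes\cdots\otimes v(-\beta_k-2s),\qquad M_s=\mathbb C[e_{-(n+2s)+1},\dots,e_{-1},e_0]\,w_s\subset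 F^{\otimes k}.$$ These form an increasing chain and $L^D=\bigcup_{s\ge1}M_s$ (an $\widehat{\mathfrak{sl}}_2$-submodule of $F^{\otimes k}$, bigraded by $h_0$ and $d$). Its character is $\mathrm{ch}\,L^D=\mathrm{Tr}_{L^D}\,q^dz^{h_0/2}$. $p(D)$ is the number of $i\in\{1,\dots,k\}$ for which $d_{i+1}+\cdots+d_{k+1}$ is odd. *)

(* Defs.v *)
From HB Require Import structures.
From mathcomp Require Import all_boot all_order all_algebra.
From mathcomp Require Import finmap.
From mathcomp Require Import boolp classical_sets cardinality fsbigop reals.
From mathcomp Require Import complex monalg.

Set Implicit Arguments.
Unset Strict Implicit.
Unset Printing Implicit Defensive.

Import Order.TTheory GRing.Theory Num.Theory.

Local Open Scope fset_scope.
Local Open Scope classical_set_scope.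
Local Open Scope ring_scope.

(* The variables are numbered by int in the order
     ... psi(i), phi(i), psi(i+1), phi(i+1), ...                            *)
Definition psi_idx (i : int) : int := 2 * i.
Definition phi_idx (i : int) : int := 2 * i + 1.

(* A semi-infinite monomial is determined, up to sign, by the set of variables
   that occur in it: all sufficiently small indices and finitely many others.
   It is encoded by the finite symmetric difference of that set with the set
   {j <= 0} of the variables of v(0); every finite set of integers arises
   exactly once.  The sign is fixed by writing the variables in increasing
   order of their indices, so that v(m) is the product of those of index <= m. *)
Definition monomial := {fset int}.

Definition occurs (S : monomial) (j : int) : bool := (j <= 0) (+) (j \in S).

Definition vmon (m : int) : monomial :=
  fset_set [set j : int | (j <= 0) (+) (j <= m)].

Definition insert (S : monomial) (j : int) : monomial :=
  (if j \in S then S `\ j else j |` S)%fset.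

(* The number of transpositions needed to move the variable j, multiplied from
   the right, to its place in the ordered monomial S.                        *)
Definition nb_above (S : monomial) (j : int) : nat :=
  #|` fset_set [set i : int | occurs S i /\ j < i]|.

Section FermionicSpace.
Variable R : realType.
Local Notation C := R[i].

Definition lin_ext (B : choiceType) (V : lmodType C) (f : B -> V)
  (x : {malg C[B]}) : V := \sum_(b <- msupp x) x@_b *: f b.

Definition F := {malg C[monomial]}.

Definition rmul_var (j : int) : F -> F :=
  lin_ext (fun S : monomial =>
    if occurs S j then 0 else << (-1) ^+ nb_above S j *g insert S j >> : F).

Definition psi (i : int) : F -> F := rmul_var (psi_idx i).
Definition phi (i : int) : F -> F := rmul_var (phi_idx i).

(* The operators act by right multiplication, so psi(i) is applied first.  The
   sum is over all i : int; on a given vector only finitely many terms are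
   nonzero. *)
Definition e (m : int) (x : F) : F :=
  \sum_(i \in [set: int]) phi (m - i) (psi i x).

(* The eigenvalues of h_0 and d on a monomial: relative to v(0), the monomial
   has the additional variables j \in S with 0 < j and lacks the variables
   j \in S with j <= 0; the variable j is psi(j %/ 2) or phi(j %/ 2), where
   %/ rounds down. *)
Definition h0_deg (S : monomial) : int :=
  \sum_(j <- S) (if 0 < j then 1 else -1).
Definition d_deg (S : monomial) : int :=
  \sum_(j <- S) (if 0 < j then (j %/ 2)%Z else - (j %/ 2)%Z).

Definition h0 : F -> F :=
  lin_ext (fun S : monomial => << (h0_deg S)%:~R *g S >> : F).
Definition d : F -> F :=
  lin_ext (fun S : monomial => << (d_deg S)%:~R *g S >> : F).

(* The k-th tensor power of F, through its basis of pure tensors of monomials *)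
Definition tmonomial (k : nat) := {ffun 'I_k -> monomial}.
Definition tensF (k : nat) := {malg C[tmonomial k]}.

Definition at_slot k (b : tmonomial k) (p : 'I_k) : F -> tensF k :=
  lin_ext (fun S : monomial =>
    << [ffun r => if r == p then S else b r] : tmonomial k >> : tensF k).

(* \sum_p 1 (x) ... (x) A (x) ... (x) 1, with A in position p; only used for
   A = e m, h0, d, which are even, so that there are no Koszul signs.  *)
Definition coprod k (A : F -> F) : tensF k -> tensF k :=
  lin_ext (fun b : tmonomial k =>
    \sum_(p < k) at_slot b p (A (<< b p >> : F))).

Section LD.
Variable k : nat.

(* Entries of D = (d_1, ..., d_{k+1}) are numbered from 1. *)
Definition ent (D : k.+1.-tuple nat) (i : nat) : nat := nth 0%N D i.-1.
Definition mkD (f : nat -> nat) : k.+1.-tuple nat := [tuple f i.+1 | i < k.+1].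

Definition size_D (D : k.+1.-tuple nat) : nat :=
  (\sum_(1 <= i < k.+2) ent D i)%N.
Definition beta (D : k.+1.-tuple nat) (i : nat) : nat :=
  (\sum_(i.+1 <= j < k.+2) ent D j)%N.
Definition p (D : k.+1.-tuple nat) : nat :=
  (\sum_(1 <= i < k.+1) odd (beta D i))%N.

Definition w (D : k.+1.-tuple nat) (s : nat) : tensF k :=
  << [ffun i : 'I_k => vmon (- (beta D i.+1)%:Z - 2 * s%:Z)] : tmonomial k >>.

(* Linear combinations of products of operators e_m with -(n + 2s) < m <= 0,
   applied to w_s. *)
Definition M (D : k.+1.-tuple nat) (s : nat) : set (tensF k) :=
  [set x | exists c : seq (C * seq int),
    {in c, forall t, {in t.2, forall m : int,
        - (size_D D + 2 * s)%:Z + 1 <= m <= 0}} /\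
    x = \sum_(t <- c)
          t.1 *: foldr (fun m => coprod (e m)) (w D s) t.2].

Definition L (D : k.+1.-tuple nat) : set (tensF k) :=
  \bigcup_(s in [set s : nat | (1 <= s)%N]) M D s.

End LD.

(* The dimension of a finite-dimensional subspace A (0 if there is no finite
   basis).  *)
Definition is_basis (V : lmodType C) (A : set V) n (v : 'I_n -> V) : Prop :=
  [/\ forall i, A (v i),
      forall c : 'I_n -> C, \sum_i c i *: v i = 0 -> forall i, c i = 0
    & forall x, A x -> exists c : 'I_n -> C, x = \sum_i c i *: v i].

Definition dim (V : lmodType C) (A : set V) : nat :=
  xget 0%N [set n | exists v : 'I_n -> V, is_basis A v].

(* f a b is the coefficient of q^a z^b. *)
Definition qzseries := rat -> rat -> nat.

Definition qz_add (f g : qzseries) : qzseries := fun a b => (f a b + g a b)%N.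
Definition q_shift (r : rat) (f : qzseries) : qzseries := fun a b => f (a - r) b.

(* Tr_A q^d z^{h_0 / 2}: the coefficient of q^a z^b is the dimension of the
   joint eigenspace of d and h_0 with eigenvalues a and 2b.  It is finite, as
   only finitely many monomials of F have a given d-degree and d-degrees in F
   are nonnegative. *)
Definition trace_qz k (A : set (tensF k)) : qzseries := fun a b =>
  dim [set x | [/\ A x, coprod d x = ratr a *: x
                  & coprod h0 x = ratr (2 * b) *: x]].

Definition ch k (D : k.+1.-tuple nat) : qzseries := trace_qz (L D).

End FermionicSpace.

Declare Scope qz_scope.
Delimit Scope qz_scope with qz.
Bind Scope qz_scope with qzseries.
Notation "f + g" := (qz_add f g) : qz_scope.
Notation "''q^' r * f" := (q_shift r f)
  (at level 40, r at level 8, f at level 39, format "''q^' r  *  f") : qz_scope.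

(* Main.v *)
(** Let lam_p = beta_p + 2 s be the lengths of the slots of
    w_s = v(- lam_1) (x) ... (x) v(- lam_k), and W(lam) = C[e_m : m <= 0] w_s,
    so that L^D is the increasing union of the W(lam) over s.  Let N be the
    greatest length, i a slot of length N and j a slot of greatest length among
    those of length at most N - 2.  If r slots have length N, then e_(1 - N)^r
    lowers all of them by 2, which gives lam' and W(lam') inside W(lam).  The
    operator X = \sum_a psi_a^(i) psi^*_(a - c)^(j) +- \sum_a psi_a^(j)
    psi^*_(a - c)^(i), with psi_a the multiplication by the variable a and
    c = lam_j + 1 - lam_i, commutes with all e_m; it kills w_(lam') and sends
    w_lam to w_(lam''), where slot i has lost and slot j has gained one unit.
    Hence W(lam') is contained in the kernel of X : W(lam) ->> W(lam'').

    The kernel is not larger, because dim W(lam) is the product D(lam) of the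
    1 + #{p | lam_p > t} over t >= 0, and D(lam) = D(lam') + D(lam'').  The
    inequality dim W(lam) >= D(lam) follows from the above by induction.  For
    the other one, e_m acts on W(lam) through a sum of currents a_p(z) of
    square zero; deformed so as to omit the slots of length at most t, the sum
    is nilpotent of order 1 + #{p | lam_p > t}, and every monomial in the e_m is
    the lowest term of a combination of products of such deformations.

    The character identities are the graded version of the exact sequence; the
    power of q is the difference of the degrees of w_(lam'') and w_lam.  For
    d_l = 1 the lengths given by D' are those of lam' in another order, which
    does not affect the character.  In case b_2 all lengths are N or N - 1, and
    lowering the longest slots of lam' + 2 gives back lam, so that the two
    unions coincide. *)

From HB Require Import structures.
From mathcomp Require Import all_boot all_order all_algebra reals.
From mathcomp Require Import perm finmap ring lra zify.
From mathcomp Require Import boolp classical_sets cardinality fsbigop.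
From mathcomp Require Import complex monalg.
Require Import Defs.

Set Implicit Arguments.
Unset Strict Implicit.
Unset Printing Implicit Defensive.

Import Order.TTheory GRing.Theory Num.Theory.
Local Open Scope ring_scope.

(** * Families of vectors and dimensions *)

(** The induction behind the lower bound for dim W(lam) stops as soon as all lengths are N or N - 1
    with N >= 2, since no slot j is left to exchange with. Slots of length 0 remove this obstacle.
    All e_m with m <= 0 kill them, and they leave D(lam) unchanged. Once there are as many slots as
    units of length, a length of at least 2 forces an empty slot, so the induction runs down to
    lengths at most 1, where only e_0 acts. The dimension is thus settled before exactness on the
    original slots, which is deduced from it.

    Infinite sums are avoided: W(lam) lies in the span of the monomials containing, in every slot p,
    all variables of index at most - lam_p, and there e_m is a finite sum of modes. These modes lie
    in a commutative ring of operators, so nilpotency becomes a matter of polynomial identities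
    modulo a high power of the indeterminate.

    That W(lam) grows with s needs an argument of its own: the lowest coefficient of the k-th power
    of the current formed from the e_m with 1 - N <= m <= 0 is k! times the product of the lowest
    modes of all slots, and this product lowers every length by 2. *)

Section Families.
Variables (K : fieldType) (V : lmodType K).

Definition free_fam n (v : 'I_n -> V) : Prop :=
  forall c : 'I_n -> K, \sum_i c i *: v i = 0 -> forall i, c i = 0.

Definition subspace (A : V -> Prop) : Prop :=
  A 0 /\ forall a x y, A x -> A y -> A (a *: x + y).

Lemma subspace_sum (A : V -> Prop) (I : Type) (r : seq I) (P : pred I) F :
  subspace A -> (forall i, P i -> A (F i)) -> A (\sum_(i <- r | P i) F i).
Proof.
move=> [A0 AD] AF; elim/big_ind: _ => // x y Ax Ay.
by rewrite -[x]scale1r; apply: AD.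
Qed.

Lemma subspaceZ (A : V -> Prop) a x : subspace A -> A x -> A (a *: x).
Proof. by move=> [A0 AD] Ax; rewrite -[_ *: _]addr0; apply: AD. Qed.

Lemma subspace_sum_seq (A : V -> Prop) (I : eqType) (r : seq I) F :
  subspace A -> {in r, forall i, A (F i)} -> A (\sum_(i <- r) F i).
Proof. by move=> sA AF; rewrite big_seq; apply: subspace_sum. Qed.

Lemma subspace_comb (A : V -> Prop) n (v : 'I_n -> V) c :
  subspace A -> (forall i, A (v i)) -> A (\sum_i c i *: v i).
Proof. by move=> sA Av; apply: subspace_sum => // i _; apply: subspaceZ. Qed.

Lemma mx_left_relation m n (M : 'M[K]_(m, n)) :
  (n < m)%N -> exists2 x : 'rV[K]_m, x != 0 & x *m M = 0.
Proof.
move=> nm; have: kermx M != 0.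
  rewrite kermx_eq0 /row_free; apply/negP => /eqP rM.
  by have := rank_leq_col M; rewrite rM leqNgt nm.
move=> /rowV0Pn[x /sub_kermxP xM x0]; by exists x.
Qed.

Lemma free_span_leq m n (u : 'I_m -> V) (v : 'I_n -> V) :
  free_fam u -> (forall i, exists c, u i = \sum_j c j *: v j) -> (m <= n)%N.
Proof.
move=> fu /boolp.choice[c uE]; rewrite leqNgt; apply/negP => nm.
have [x x0 xM] := mx_left_relation (\matrix_(i, j) c i j) nm.
move/eqP: x0; apply; apply/rowP => i; rewrite mxE.
apply: (fu (fun i => x 0 i)).
under eq_bigr do rewrite uE scaler_sumr.
rewrite exchange_big big1 //= => j _.
move/matrixP: xM => /(_ 0 j); rewrite !mxE => xM.
rewrite -[RHS](scale0r (v j)) -xM scaler_suml; apply: eq_bigr => k _.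
by rewrite mxE scalerA.
Qed.

Definition fam_cat m n (u : 'I_m -> V) (v : 'I_n -> V) (i : 'I_(m + n)) : V :=
  match split i with inl j => u j | inr j => v j end.

Lemma sum_fam_cat m n (u : 'I_m -> V) (v : 'I_n -> V) (c : 'I_(m + n) -> K) :
  \sum_i c i *: fam_cat u v i =
  \sum_i c (lshift n i) *: u i + \sum_j c (rshift m j) *: v j.
Proof.
rewrite big_split_ord /=; congr (_ + _); apply: eq_bigr => i _;
  rewrite /fam_cat.
- by rewrite (unsplitK (inl i)).
- by rewrite (unsplitK (inr i)).
Qed.

Lemma fam_cat_all (A : V -> Prop) m n (u : 'I_m -> V) (v : 'I_n -> V) :
  (forall i, A (u i)) -> (forall i, A (v i)) -> forall i, A (fam_cat u v i).
Proof. by move=> Au Av i; rewrite /fam_cat; case: split. Qed.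

Lemma forall_split m n (P : 'I_(m + n) -> Prop) :
  (forall i, P (lshift n i)) -> (forall j, P (rshift m j)) -> forall i, P i.
Proof. by move=> Pl Pr i; rewrite -(splitK i); case: split. Qed.

Lemma free_fam_rcons n (v : 'I_n -> V) (x : V) :
  free_fam v -> ~ (exists c, x = \sum_j c j *: v j) ->
  free_fam (fam_cat v (fun _ : 'I_1 => x)).
Proof.
move=> fv nx c; rewrite sum_fam_cat big_ord1 => E.
have c0 : c (rshift n ord0) = 0.
  apply: contra_notP nx => /eqP cn0.
  exists (fun j => - (c (rshift n ord0))^-1 * c (lshift 1 j)).
  apply: (scalerI cn0); rewrite scaler_sumr.
  under eq_bigr do rewrite scalerA mulrA mulrN divff // mulN1r scaleNr.
  by rewrite sumrN; apply/eqP; rewrite -addr_eq0 addrC E.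
apply: forall_split => [i|j]; last by rewrite ord1.
apply: (fv (fun i => c (lshift 1 i))).
by move: E; rewrite c0 scale0r addr0.
Qed.

(** Otherwise every free family in [A] could be extended by one vector, and the bound [D] would be
    exceeded. This provides finite bases inside the infinite-dimensional tensor powers. *)
Lemma maximal_free_fam (A : V -> Prop) D :
  (forall n (v : 'I_n -> V), (forall i, A (v i)) -> free_fam v -> (n <= D)%N) ->
  exists n (v : 'I_n -> V), [/\ forall i, A (v i), free_fam v &
    forall x, A x -> exists c, x = \sum_j c j *: v j].
Proof.
move=> bD; apply: contrapT => H.
have [n [v [nD Av fv]]] : exists n (v : 'I_n -> V),
    [/\ (D < n)%N, forall i, A (v i) & free_fam v]; last first.
  by move: nD; rewrite ltnNge (bD _ _ Av fv).
suff: forall n, exists v : 'I_n -> V, (forall i, A (v i)) /\ free_fam v.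
  by move=> /(_ D.+1)[v [Av fv]]; exists D.+1, v.
elim=> [|n [v [Av fv]]]; first by exists (fun _ => 0); split=> [[]|c _ []].
have [x [Ax nx]] : exists x, A x /\ ~ (exists c, x = \sum_j c j *: v j).
  apply: contrapT => H2; apply: H; exists n, v; split=> // x Ax.
  by apply: contrapT => H3; apply: H2; exists x.
rewrite -addn1; exists (fam_cat v (fun _ : 'I_1 => x)).
by split; [exact: (@fam_cat_all A) | exact: free_fam_rcons].
Qed.

End Families.

Section LinearMaps.
Variables (K : fieldType) (V U : lmodType K).

Definition lin_map (X : V -> U) : Prop :=
  forall a x y, X (a *: x + y) = a *: X x + X y.

Variable X : V -> U.
Hypothesis linX : lin_map X.

Lemma lin_map0 : X 0 = 0.
Proof.
by have := linX (-1) 0 0; rewrite scaler0 addr0 scaleN1r addNr.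
Qed.

Lemma lin_mapZ a x : X (a *: x) = a *: X x.
Proof. by rewrite -[a *: x]addr0 linX lin_map0 addr0. Qed.

Lemma lin_mapD x y : X (x + y) = X x + X y.
Proof. by rewrite -[x]scale1r linX !scale1r. Qed.

Lemma lin_mapN x : X (- x) = - X x.
Proof. by rewrite -scaleN1r lin_mapZ scaleN1r. Qed.

Lemma lin_mapB x y : X (x - y) = X x - X y.
Proof. by rewrite lin_mapD lin_mapN. Qed.

Lemma lin_map_sum (I : Type) (r : seq I) (P : pred I) F :
  X (\sum_(i <- r | P i) F i) = \sum_(i <- r | P i) X (F i).
Proof. exact: (big_morph X lin_mapD lin_map0). Qed.

Lemma lin_map_comb n (v : 'I_n -> V) c :
  X (\sum_i c i *: v i) = \sum_i c i *: X (v i).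
Proof. by rewrite lin_map_sum; apply: eq_bigr => i _; rewrite lin_mapZ. Qed.

Lemma free_fam_lift m n (u : 'I_m -> V) (v : 'I_n -> V) :
  free_fam u -> (forall i, X (u i) = 0) -> free_fam (X \o v) ->
  free_fam (fam_cat u v).
Proof.
move=> fu Xu fv c E.
have cv : forall j, c (rshift m j) = 0.
  apply: (fv (fun j => c (rshift m j))); rewrite -lin_map_comb.
  have := congr1 X E; rewrite sum_fam_cat lin_mapD lin_map0 (lin_map_comb u).
  by rewrite big1 ?add0r // => i _; rewrite Xu scaler0.
apply: forall_split => // i; apply: (fu (fun i => c (lshift n i))).
move: E; rewrite sum_fam_cat [X in _ + X]big1 ?addr0 // => j _.
by rewrite cv scale0r.
Qed.

(** A vector of [A] outside the span of [u] and [v] would enlarge them to a free family of more than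
    [D] vectors. So x is a combination of both, and [X x = 0] forces the coefficients on [v] to
    vanish. *)
Lemma ker_eq_by_dim (A A' : V -> Prop) D m n (u : 'I_m -> V) (v : 'I_n -> V) :
  (forall r (g : 'I_r -> V), (forall i, A (g i)) -> free_fam g -> (r <= D)%N) ->
  subspace A' -> (forall x, A' x -> A x) -> (forall x, A' x -> X x = 0) ->
  (forall i, A' (u i)) -> free_fam u ->
  (forall i, A (v i)) -> free_fam (X \o v) ->
  (D <= m + n)%N ->
  forall x, A x -> X x = 0 -> A' x.
Proof.
move=> bD sA' A'A XA' A'u fu Av fv Dmn x Ax Xx.
have fc : free_fam (fam_cat u v).
  by apply: free_fam_lift => // i; apply: XA'.
have [c xE] : exists c, x = \sum_j c j *: fam_cat u v j.
  apply: contrapT => nx.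
  have Ag : forall i, A (fam_cat (fam_cat u v) (fun _ : 'I_1 => x) i).
    by apply: (@fam_cat_all _ _ A) => //; apply: (@fam_cat_all _ _ A) => // i; apply: A'A.
  by have := bD _ _ Ag (free_fam_rcons fc nx); rewrite addn1 ltnNge Dmn.
have cv : forall j, c (rshift m j) = 0.
  apply: (fv (fun j => c (rshift m j))); rewrite -lin_map_comb.
  move: Xx; rewrite xE sum_fam_cat lin_mapD (lin_map_comb u).
  by rewrite big1 ?add0r // => i _; rewrite XA' // scaler0.
rewrite xE sum_fam_cat [X in _ + X]big1 ?addr0; last first.
  by move=> j _; rewrite cv scale0r.
exact: subspace_comb.
Qed.

End LinearMaps.

Section Dim.
Variable R : realType.
Local Notation C := R[i].
Variable V : lmodType C.
Implicit Type A : set V.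

Lemma basis_unique A m n (u : 'I_m -> V) (v : 'I_n -> V) :
  is_basis A u -> is_basis A v -> m = n.
Proof.
move=> [Au fu su] [Av fv sv]; apply/eqP; rewrite eqn_leq.
by rewrite (free_span_leq fu (fun i => sv _ (Au i))) (free_span_leq fv (fun i => su _ (Av i))).
Qed.

Lemma dimE A n (v : 'I_n -> V) : is_basis A v -> dim A = n.
Proof.
move=> bv; rewrite /dim; case: xgetP => [m _ [u bu]|]; first exact: basis_unique bu bv.
by move=> /(_ n) []; exists v.
Qed.

Lemma basis_exists A D :
  (forall n (v : 'I_n -> V), (forall i, A (v i)) -> free_fam v -> (n <= D)%N) ->
  exists n (v : 'I_n -> V), is_basis A v.
Proof.
by move=> /maximal_free_fam[n [v [Av fv sv]]]; exists n, v; split.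
Qed.

End Dim.

(** A basis of [A] is assembled from the basis of the kernel and preimages of the basis of [B]. As
    [dim] is 0 when no finite basis exists, these two bases have to be supplied. *)
Lemma rank_nullity (R : realType) (V U : lmodType R[i]) (X : V -> U)
    (A A' : set V) (B : set U) m n (u : 'I_m -> V) (v : 'I_n -> U) :
  lin_map X -> subspace A -> (forall x, A' x <-> A x /\ X x = 0) ->
  (forall x, A x -> B (X x)) -> (forall y, B y -> exists2 x, A x & X x = y) ->
  is_basis A' u -> is_basis B v -> dim A = (dim A' + dim B)%N.
Proof.
move=> linX sA A'E XA XAB bu bv; rewrite (dimE bu) (dimE bv).
case: bu bv => [Au fu su] [Bv fv sv].
have /boolp.choice[z zE] : forall j, exists x, A x /\ X x = v j.
  by move=> j; have [x] := XAB _ (Bv j); exists x.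
have XzE : X \o z = v by apply: funext => j; case: (zE j).
apply: (@dimE _ _ _ _ (fam_cat u z)); split.
- by apply: (@fam_cat_all _ _ A) => j; [have /A'E[] := Au j | case: (zE j)].
- apply: (free_fam_lift linX) => //; last by rewrite XzE.
  by move=> i; have /A'E[] := Au i.
- move=> x Ax; have [c XxE] := sv _ (XA _ Ax).
  have /A'E/su[d xE] : A (x - \sum_j c j *: z j) /\ X (x - \sum_j c j *: z j) = 0.
    split; last first.
      rewrite (lin_mapB linX) (lin_map_comb linX) XxE; apply/eqP; rewrite subr_eq0.
      by apply/eqP/eq_bigr => j _; case: (zE j) => _ ->.
    rewrite addrC -scaleN1r; case: (sA) => _; apply=> //.
    by apply: subspace_comb => // j; case: (zE j).
  exists (fun i => match split i with inl i => d i | inr j => c j end).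
  rewrite sum_fam_cat -[LHS](subrK (\sum_j c j *: z j)) xE.
  congr (_ + _); apply: eq_bigr => i _.
  + by rewrite (unsplitK (inl i)).
  + by rewrite (unsplitK (inr i)).
Qed.

(** * Currents of square zero *)

Section SquareZero.
Variable A : comNzRingType.
Implicit Types x y z : A.

Definition divides y x : Prop := exists h, x = y * h.

Lemma divides_mulr y x z : divides y x -> divides y (x * z).
Proof. by move=> [h ->]; exists (h * z); rewrite mulrA. Qed.

Lemma divides_mull y x z : divides y x -> divides y (z * x).
Proof. by rewrite mulrC; apply: divides_mulr. Qed.

Lemma divides_add y x z : divides y x -> divides y z -> divides y (x + z).
Proof. by move=> [h ->] [g ->]; exists (h + g); rewrite mulrDr. Qed.

Lemma divides0 y : divides y 0.
Proof. by exists 0; rewrite mulr0. Qed.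

Lemma divides_sum y (I : Type) (r : seq I) (P : pred I) (F : I -> A) :
  (forall i, P i -> divides y (F i)) -> divides y (\sum_(i <- r | P i) F i).
Proof.
move=> yF; elim/big_ind: _ => //; [exact: divides0 | exact: divides_add].
Qed.

Lemma exprD_sq y s x m : divides y (x ^+ 2) ->
  divides y ((s + x) ^+ m - (s ^+ m + m%:R * s ^+ m.-1 * x)).
Proof.
move=> [h xE]; elim: m => [|m [g gE]].
  by exists 0; rewrite !expr0 mul0r mul0r addr0 subrr mulr0.
have {}gE : (s + x) ^+ m = (s ^+ m + m%:R * s ^+ m.-1 * x) + y * g.
  by rewrite -gE [RHS]addrC subrK.
rewrite exprSr gE /=; exists (g * (s + x) + m%:R * s ^+ m.-1 * h).
transitivity (y * g * (s + x) + m%:R * s ^+ m.-1 * (y * h)); last by ring.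
rewrite -xE expr2; case: m gE => [|m] _ /=; first by rewrite !expr0; ring.
by rewrite !exprS -[m.+2]addn1 -[m.+1]addn1 !natrD; ring.
Qed.

(** Modulo squares, a power of the sum retains only products of distinct terms, each counted once
    per ordering. Divisibility by y serves both truncation, with y a power of the indeterminate, and
    exact vanishing, with y = 0. *)
Lemma sum_sq_exp y (I : finType) (S : {set I}) (x : I -> A) :
  (forall i, i \in S -> divides y (x i ^+ 2)) ->
  divides y ((\sum_(i in S) x i) ^+ #|S| - (#|S|)`!%:R * \prod_(i in S) x i) /\
  divides y ((\sum_(i in S) x i) ^+ #|S|.+1).
Proof.
have [n] := ubnP #|S|; elim: n S => // n IH S Sn Sx.
have [->|[i iS]] := set_0Vmem S.
  by rewrite cards0 !big_set0 !expr0 mulr1 subrr expr1; split; apply: divides0.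
pose S' := S :\ i.
have cS : #|S| = #|S'|.+1 by rewrite (cardsD1 i S) iS.
have [] := IH S'; [by rewrite -ltnS -cS | by move=> j /setD1P[_ /Sx] |].
rewrite cS (big_setD1 i iS) /= [\prod_(j in S) x j](big_setD1 i iS) /= -/S'.
set s := \sum_(j in S') _; set P := \prod_(j in S') _; set r := #|S'|.
move=> d1 d2; rewrite ![x i + s]addrC; split.
- have := exprD_sq s r.+1 (Sx i iS) => /= d3.
  have := divides_add d3 (divides_add d2 (divides_mull (r.+1%:R * x i) d1)).
  congr (divides _ _); rewrite factS natrM; ring.
- have := exprD_sq s r.+2 (Sx i iS) => /= d3.
  have := divides_add d3 (divides_add (divides_mull s d2) (divides_mull (r.+2%:R * x i) d2)).
  by congr (divides _ _); rewrite !exprS; ring.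
Qed.

Lemma sum_sq0_exp (I : finType) (S : {set I}) (x : I -> A) :
  (forall i, i \in S -> x i ^+ 2 = 0) ->
  (\sum_(i in S) x i) ^+ #|S| = (#|S|)`!%:R * \prod_(i in S) x i.
Proof.
move=> Sx; have [|[h hE] _] := @sum_sq_exp 0 I S x.
  by move=> i /Sx ->; exists 0; rewrite mulr0.
by apply/eqP; rewrite -subr_eq0 hE mul0r.
Qed.

End SquareZero.

Lemma dividesXnP (B : comNzRingType) n (p : {poly B}) :
  divides 'X^n p <-> forall i, (i < n)%N -> p`_i = 0.
Proof.
split=> [[h ->] i ni|H]; first by rewrite coefXnM ni.
exists (drop_poly n p); rewrite mulrC -[LHS](poly_take_drop n p).
rewrite [take_poly n p](_ : _ = 0) ?add0r //.
by apply/polyP => i; rewrite coef_take_poly coef0; case: ifP => // /H.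
Qed.

Lemma dividesXn_leq (B : comNzRingType) m n (p : {poly B}) :
  (m <= n)%N -> divides 'X^n p -> divides 'X^m p.
Proof.
move=> mn /dividesXnP H; apply/dividesXnP => i im.
by apply: H; apply: leq_trans mn.
Qed.

(** * The lowest coefficient of the k-th power of the total current *)

Section Currents.
Variables (B : comNzRingType) (k : nat) (a : 'I_k -> nat -> B).
Hypothesis a_sq : forall p q, \sum_(i < q.+1) a p i * a p (q - i) = 0.
Variables (lam : 'I_k -> nat) (N : nat).
Hypothesis lamN : forall p, (lam p <= N)%N.

Definition gap p := (N - lam p)%N.

(* The modes c_n of the total current P(z) = \sum_p z^(N - lam_p) a_p(z);
   c_n stands for e_(n - N + 1). *)
Definition mode n : B :=
  \sum_p (if (gap p <= n)%N then a p (n - gap p) else 0).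

Lemma trunc_sq T p : divides 'X^T ((\poly_(n < T) a p n) ^+ 2).
Proof.
apply/dividesXnP => q qT; rewrite expr2 coefM -[RHS](a_sq p q).
apply: eq_bigr => i _; rewrite !coef_poly.
by rewrite (leq_ltn_trans _ qT) ?(leq_ltn_trans _ qT) ?leq_subr // -ltnS.
Qed.

Section Lowest.
Hypothesis lam_gt0 : forall p, (0 < lam p)%N.
(** A cut-off beyond every coefficient that is read off below, so that the series a_p(z) may be
    replaced by polynomials. *)
Let T := ((\sum_p gap p).+1 + N)%N.
Let F p : {poly B} := 'X^(gap p) * \poly_(n < T) a p n.

Let F_sq p : divides 'X^T (F p ^+ 2).
Proof. by rewrite /F exprMn; apply/divides_mull/trunc_sq. Qed.

Let gapN p : (gap p < N)%N.
Proof. by have := lam_gt0 p; have := lamN p; rewrite /gap; lia. Qed.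

(** Modulo squares the m-th power is a sum of products of m distinct [F p], whose order is the sum
    of their gaps. Each of the remaining slots is paid for by one factor z^N, and N exceeds its gap
    because its length is positive. *)
Let order_partial (S : {set 'I_k}) m : (m < #|S|)%N ->
  divides 'X^((\sum_(p in S) gap p).+1)%N
    ('X^(N * (#|S| - m)) * (\sum_(p in S) F p) ^+ m).
Proof.
have [n] := ubnP #|S|; elim: n S m => // n IH S m Sn mS.
have /set0Pn[i iS] : S != finset.set0 by rewrite -cards_eq0; lia.
pose S' := S :\ i.
have cS : #|S| = #|S'|.+1 by rewrite (cardsD1 i S) iS.
rewrite (big_setD1 i iS) /= [\sum_(p in S) F p](big_setD1 i iS) /= -/S'.
set g := (\sum_(j in S') _)%N; set s := \sum_(j in S') _.
have gT : (gap i + g < T)%N.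
  rewrite /T ltnS (leq_trans _ (leq_addr _ _)) //.
  rewrite [X in (_ <= X)%N](bigID (mem S)) /= (big_setD1 i iS) /=.
  by rewrite leq_addr.
have IH' : forall m', (m' < #|S'|)%N ->
    divides 'X^(g.+1) ('X^(N * (#|S'| - m')) * s ^+ m').
  by move=> m' m'S; apply: IH => //; rewrite -ltnS -cS.
(* Modulo the square of [F i], the power of [F i + s] has two terms. This is the one free of [F i];
   the other one contains [F i], which contributes the order [gap i] by itself. *)
have first : divides 'X^((gap i + g).+1) ('X^(N * (#|S| - m)) * s ^+ m).
  have [mS'|] := ltnP m #|S'|.
    have -> : (N * (#|S| - m) = N + N * (#|S'| - m))%N by rewrite cS; lia.
    rewrite exprD -mulrA; have [h ->] := IH' _ mS'.
    rewrite mulrA -exprD; apply: dividesXn_leq (divides_mulr _ _); last first.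
      by exists 1; rewrite mulr1.
    by have := gapN i; lia.
  move=> S'm; have -> : m = #|S'| by lia.
  have [[h /eqP hE] _] := sum_sq_exp (fun p (_ : p \in S') => F_sq p).
  move: hE; rewrite subr_eq => /eqP ->; rewrite mulrDr; apply: divides_add.
    apply: dividesXn_leq (divides_mull _ (divides_mulr _ _)); last by exists 1; rewrite mulr1.
    lia.
  rewrite /F big_split /= prodrXr -/g.
  apply: (@dividesXn_leq _ _ (N + g)); first by have := gapN i; lia.
  rewrite cS subSnn muln1; exists ((#|S'|)`!%:R * \prod_(j in S') \poly_(n < T) a j n).
  by rewrite exprD; ring.
case: m mS first => [|m] mS first; first by rewrite !expr0 in first *.
have [h /eqP] := exprD_sq s m.+1 (F_sq i); rewrite subr_eq => /eqP hE.
rewrite addrC hE /= mulrDr mulrDr; apply: divides_add.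
  apply: dividesXn_leq (divides_mull _ (divides_mulr _ _)); last by exists 1; rewrite mulr1.
  lia.
apply: divides_add => //.
have -> : (#|S| - m.+1 = #|S'| - m)%N by lia.
have mS' : (m < #|S'|)%N by lia.
have [h' h'E] := IH' _ mS'.
exists (h' * m.+1%:R * \poly_(n < T) a i n).
have -> : 'X^((gap i + g).+1) = 'X^(gap i) * 'X^(g.+1) :> {poly B}.
  by rewrite -exprD; congr ('X^_); lia.
rewrite /F; transitivity ('X^(N * (#|S'| - m)) * s ^+ m * (m.+1%:R * 'X^(gap i) * \poly_(n < T) a i n)).
  by ring.
by rewrite h'E; ring.
Qed.

(** Only the modes of index n < N, that is the e_m with m <= 0, are available in W(lam), so the
    current has to be truncated. The discarded part is z^N g(z), and by [order_partial] the products
    involving it start above the sum of the gaps. What remains is the power of the full current, k!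
    times the product of its summands. *)
Lemma coef_mode_exp :
  ((\poly_(n < N) mode n) ^+ k)`_(\sum_p gap p)%N = k`!%:R * \prod_p a p 0%N.
Proof.
pose S := \sum_(p in [set: 'I_k]) F p.
have gT : (\sum_p gap p < T)%N by rewrite /T; lia.
have SN n : (n < N)%N -> S`_n = mode n.
  move=> nN; rewrite coef_sum (eq_bigl xpredT) => [|p]; last by rewrite inE.
  apply: eq_bigr => p _; rewrite /F coefXnM coef_poly [(n < gap p)%N]ltnNge.
  case: (leqP (gap p) n) => //= _; rewrite ifT //.
  by apply: (leq_ltn_trans (leq_subr _ _)); apply: (leq_trans nN); rewrite /T; lia.
have -> : \poly_(n < N) mode n = S - 'X^N * drop_poly N S.
  apply/eqP; rewrite eq_sym subr_eq mulrC -{1}(poly_take_drop N S).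
  rewrite (inj_eq (addIr _)); apply/eqP/polyP => i.
  by rewrite coef_take_poly coef_poly; case: ifP => // /SN.
set g := drop_poly N S; rewrite exprBn big_ord_recl /= expr0 subn0 bin0 mulr1n !mul1r mulr1.
rewrite coefD [X in _ + X](_ : _ = 0) ?addr0; last first.
  rewrite coef_sum big1 // => i _.
  have cT : #|[set: 'I_k]| = k by rewrite cardsT card_ord.
  have ik : (k - lift ord0 i < #|[set: 'I_k]|)%N.
    by rewrite cT; have := ltn_ord i; rewrite /= /bump; lia.
  have := order_partial ik; rewrite cT subKn; last first.
    by have := ltn_ord i; rewrite /= /bump; lia.
  rewrite (eq_bigl xpredT) => [dv|p]; last by rewrite inE.
  rewrite coefMn exprMn -exprM.
  set j := nat_of_ord (lift _ _) in dv *.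
  have : divides 'X^((\sum_p gap p).+1)%N ((-1) ^+ j * S ^+ (k - j) * ('X^(N * j) * g ^+ j)).
    have := divides_mulr ((-1) ^+ j * g ^+ j) dv.
    by congr (divides _ _); rewrite -/S; ring.
  by move/dividesXnP => -> //; rewrite mul0rn.
have [+ _] := sum_sq_exp (fun p (_ : p \in [set: 'I_k]) => F_sq p).
rewrite cardsT card_ord -/S => /dividesXnP/(_ _ gT)/eqP.
rewrite coefB subr_eq0 => /eqP ->.
rewrite (eq_bigl xpredT) => [|p]; last by rewrite inE.
rewrite /F big_split /= prodrXr mulrCA coefXnM ltnn subnn.
rewrite -polyC_natr coefCM coef0_prod; congr (_ * _).
by apply: eq_bigr => p _; rewrite coef_poly /T addSn.
Qed.

End Lowest.

End Currents.

Lemma prod_lowest_coef (B : comNzRingType) (Y : nat -> {poly B}) (c : nat -> B)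
    (s : seq nat) :
  {in s, forall m, (forall g, (g < m)%N -> (Y m)`_g = 0) /\ (Y m)`_m = c m} ->
  (forall g, (g < sumn s)%N -> (\prod_(m <- s) Y m)`_g = 0) /\
  (\prod_(m <- s) Y m)`_(sumn s) = \prod_(m <- s) c m.
Proof.
elim: s => [|m s IH] Ys; first by rewrite !big_nil coef1.
have [|IH0 IH1] := IH; first by move=> x xs; apply: Ys; rewrite inE xs orbT.
have [Y0 Y1] := Ys m (mem_head _ _).
rewrite !big_cons /=; split=> [g gs|].
  rewrite coefM big1 // => i _.
  have [im|mi] := ltnP i m; first by rewrite Y0 // mul0r.
  by rewrite IH0 ?mulr0 //; have := ltn_ord i; lia.
rewrite coefM (bigD1 (inord m)) //= inordK ?ltnS ?leq_addr // addKn Y1 IH1.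
rewrite [X in _ + X]big1 ?addr0 // => i im; have [lt|le] := ltnP i m; first by rewrite Y0 // mul0r.
have {}im : (i : nat) != m.
  by apply: contraNneq im => im; apply/eqP/val_inj; rewrite /= inordK // ltnS leq_addr.
by rewrite IH0 ?mulr0 //; have := ltn_ord i; lia.
Qed.

(* The dual basis to the evaluations at 0, 1, ..., N - 1 on polynomials of
   degree less than N. *)
Lemma interpolation (K : numFieldType) N : exists delta : 'I_N -> 'I_N -> K,
  forall (q : {poly K}) (m : 'I_N), (size q <= N)%N ->
    \sum_j delta m j * q.[j%:R] = q`_m.
Proof.
pose a : 'rV[K]_N := \row_j j%:R.
have Vu : Vandermonde N a \in unitmx.
  rewrite unitmxE det_Vandermonde unitfE; apply/prodf_neq0 => i _.
  apply/prodf_neq0 => j ij; rewrite !mxE subr_eq0 eqr_nat.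
  by apply: contraTneq ij => ->; rewrite ltnn.
exists (fun m j => invmx (Vandermonde N a) j m) => q m qN.
under eq_bigr => j _ do rewrite (horner_coef_wide _ qN) mulr_sumr.
rewrite exchange_big /= (bigD1 m) //= [X in _ + X]big1 => [|i im]; last first.
  have /matrixP/(_ i m) := mulmxV Vu; rewrite !mxE (negbTE im) mulr0n => E.
  under eq_bigr do rewrite mulrCA.
  rewrite -mulr_sumr; transitivity (q`_i * \sum_j Vandermonde N a i j * invmx (Vandermonde N a) j m).
    by congr (_ * _); apply: eq_bigr => j _; rewrite !mxE mulrC.
  by rewrite E mulr0.
have /matrixP/(_ m m) := mulmxV Vu; rewrite !mxE eqxx mulr1n => E.
under eq_bigr do rewrite mulrCA.
rewrite addr0 -mulr_sumr -[RHS]mulr1 -[in RHS]E; congr (_ * _).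
by apply: eq_bigr => j _; rewrite !mxE mulrC.
Qed.

(** * The upper bound: words in the modes as lowest terms of deformed words *)

Section UpperBound.
Variables (K : numFieldType) (B : comNzRingType) (iota : {rmorphism K -> B}).
Variables (k : nat) (a : 'I_k -> nat -> B).
Hypothesis a_sq : forall p q, \sum_(i < q.+1) a p i * a p (q - i) = 0.
Variables (lam : 'I_k -> nat) (N : nat).
Hypothesis lamN : forall p, (lam p <= N)%N.

Let rows (j : 'I_N) : {set 'I_k} := [set p | (j < lam p)%N].

Variable T : nat.

Let scalar (x : K) : {poly B} := (iota x)%:P.
Let scalar_is_monoid_morphism : monoid_morphism scalar.
Proof. by split=> [|x y]; rewrite /scalar ?rmorph1 // rmorphM /= polyCM. Qed.
Let scalar_is_zmod_morphism : zmod_morphism scalar.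
Proof. by move=> x y; rewrite /scalar rmorphB /= polyCB. Qed.

(** The indeterminate of [{poly B}] is the deformation parameter t. The factor z^(N - lam_p) becomes
    the product of the z - i t over lam_p <= i < N, whose value at z = j t is t^(N - lam_p) times
    the value of [node p] at j. *)
Let node p : {poly K} := \prod_(lam p <= i < N) ('X - i%:R%:P).

Let size_node p : size (node p) = (gap lam N p).+1.
Proof. by rewrite /node size_prod_XsubC size_iota. Qed.

Let E_slot (j : 'I_N) p : {poly B} :=
  \poly_(n < T) (iota (j%:R ^+ n) * a p n).

(* The total current P(z) deformed so that its p-th summand vanishes at the
   points j t with lam_p <= j < N, and evaluated at z = j t. *)
Let E (j : 'I_N) : {poly B} :=
  \sum_p scalar (node p).[j%:R] * 'X^(gap lam N p) * E_slot j p.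

Let E_slot_sq j p : divides 'X^T (E_slot j p ^+ 2).
Proof.
apply/dividesXnP => q qT; rewrite expr2 coefM.
transitivity (iota (j%:R ^+ q) * \sum_(i < q.+1) a p i * a p (q - i)); last first.
  by rewrite a_sq mulr0.
rewrite mulr_sumr; apply: eq_bigr => i _; rewrite !coef_poly.
have iq : (i <= q)%N by rewrite -ltnS.
rewrite (leq_ltn_trans iq qT) (leq_ltn_trans (leq_subr i q) qT).
have -> : iota (j%:R ^+ q) = iota (j%:R ^+ i) * iota (j%:R ^+ (q - i)).
  by rewrite -rmorphM -exprD subnKC.
by ring.
Qed.

Let E_nilp j : divides 'X^T (E j ^+ #|rows j|.+1).
Proof.
rewrite /E (bigID (mem (rows j))) /= [X in _ + X]big1 ?addr0 => [|p]; last first.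
  rewrite inE -leqNgt => lj; rewrite /node horner_prod.
  rewrite (bigD1_seq (j : nat)) ?iota_uniq //=; last by rewrite mem_index_iota lj /=.
  by rewrite hornerXsubC subrr mul0r /scalar rmorph0 !mul0r.
pose G p := scalar (node p).[j%:R] * 'X^(gap lam N p) * E_slot j p.
have Gsq p : p \in rows j -> divides 'X^T (G p ^+ 2).
  by move=> _; rewrite exprMn; apply/divides_mull/E_slot_sq.
by have [_] := sum_sq_exp Gsq.
Qed.

(** Exponents below the nilpotency orders of the [E j]; the cardinal of [box] is the product D(lam)
    that is to bound the dimension. *)
Let box := {dffun forall j : 'I_N, 'I_(#|rows j|.+1)}.
Let Emon (b : box) : {poly B} := \prod_j E j ^+ (b j).

Let spanned (q : {poly B}) : Prop := exists x : box -> K,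
  divides 'X^T (q - \sum_b scalar (x b) * Emon b).

Let spannedD q r : spanned q -> spanned r -> spanned (q + r).
Proof.
move=> [x xq] [y yr]; exists (fun b => x b + y b).
have := divides_add xq yr; congr (divides _ _).
under [in RHS]eq_bigr do rewrite /scalar raddfD /= polyCD mulrDl.
by rewrite big_split /=; ring.
Qed.

Let spannedZ c q : spanned q -> spanned (scalar c * q).
Proof.
move=> [x xq]; exists (fun b => c * x b).
have := divides_mull (scalar c) xq; congr (divides _ _).
rewrite mulrBr mulr_sumr; congr (_ - _); apply: eq_bigr => b _.
by rewrite /scalar rmorphM /= polyCM mulrA.
Qed.

Let spanned_dv q : divides 'X^T q -> spanned q.
Proof.
move=> dq; exists (fun=> 0); rewrite big1 ?subr0 // => b _.
by rewrite /scalar rmorph0 mul0r.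
Qed.

Let spanned_sum (I : Type) (r : seq I) F :
  (forall i, spanned (F i)) -> spanned (\sum_(i <- r) F i).
Proof.
move=> sF; apply: (big_ind spanned) => //.
by apply: spanned_dv; apply: divides0.
Qed.

Let spanned_Emon b : spanned (Emon b).
Proof.
exists (fun b' => (b' == b)%:R); rewrite (bigD1 b) //= eqxx /scalar rmorph1 mul1r.
rewrite big1 => [|b' /negbTE ->]; first by rewrite addr0 subrr; apply: divides0.
by rewrite rmorph0 mul0r.
Qed.

Let spanned1 : spanned 1.
Proof.
have <- : Emon [ffun j => ord0] = 1.
  by rewrite /Emon big1 // => j _; rewrite ffunE expr0.
exact: spanned_Emon.
Qed.

(** Raising the exponent of [E j] either stays within the box or reaches the power that vanishes
    modulo t^T. *)
Let spanned_E j q : spanned q -> spanned (E j * q).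
Proof.
move=> [x /(divides_mull (E j)) xq].
rewrite -[E j * q](subrK (E j * \sum_b scalar (x b) * Emon b)) -mulrBr.
apply: spannedD; first exact: spanned_dv.
rewrite mulr_sumr; apply: spanned_sum => b; rewrite mulrCA; apply: spannedZ.
have [bj|bj] := ltnP (b j).+1 #|rows j|.+1.
  pose b' : box := [ffun i => inord (b i + (i == j))].
  suff -> : E j * Emon b = Emon b' by apply: spanned_Emon.
  rewrite /Emon (bigD1 j) //= [RHS](bigD1 j) //= ffunE eqxx inordK ?addn1 //.
  rewrite mulrA -exprS; congr (_ * _); apply: eq_bigr => i /negbTE ij.
  by rewrite ffunE ij addn0 inord_val.
apply: spanned_dv; rewrite /Emon (bigD1 j) //= mulrA -exprS.
have -> : (b j).+1 = #|rows j|.+1 by have := ltn_ord (b j); lia.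
exact: divides_mulr.
Qed.

(** The deformed words are combinations of the monomials of the box with coefficients in [K],
    constant in t. More words than monomials therefore satisfy a linear relation modulo t^T, and its
    lowest term in t is a relation between the words themselves. *)
Lemma mode_relation (M : nat) (s : 'I_M -> seq nat) :
  (forall i, all (fun n => n < N)%N (s i)) ->
  (forall i, (sumn (s i) < T)%N) -> (N <= T)%N ->
  (\prod_(j < N) #|rows j|.+1 < M)%N ->
  exists2 x : 'I_M -> K, (exists i, x i != 0) &
    \sum_i iota (x i) * \prod_(n <- s i) mode a lam N n = 0.
Proof.
move=> sN sT NT DM.
have [delta deltaE] := interpolation K N.
(* Interpolation at the points j t isolates the n-th coefficient of the deformed current; the result
   starts with t^n times the mode of index n. *)
pose Y n : {poly B} :=
  if insub n is Some m then \sum_j scalar (delta m j) * E j else 0.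
have Ylow n : (n < N)%N ->
    (forall g, (g < n)%N -> (Y n)`_g = 0) /\ (Y n)`_n = mode a lam N n.
  move=> nN; pose m : 'I_N := Ordinal nN.
  (* The polynomial [node p * 'X^(g - gap lam N p)] is monic of degree g, so its coefficient of
     index n is 0 for g < n and 1 for g = n. The condition g < N keeps its degree within the range
     of the interpolation. *)
  have Yg g : (g < N)%N -> (Y n)`_g = \sum_p (if (gap lam N p <= g)%N then
      iota ((node p * 'X^(g - gap lam N p))`_n) * a p (g - gap lam N p) else 0).
    move=> gN; rewrite /Y insubT coef_sum.
    under eq_bigr => j _ do rewrite coefCM coef_sum mulr_sumr.
    rewrite exchange_big; apply: eq_bigr => p _ /=.
    case: leqP => [pg|gp]; last first.
      rewrite big1 // => j _.
      by rewrite -mulrA coefCM coefXnM gp !mulr0.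
    have sz : (size (node p * 'X^(g - gap lam N p))%R <= N)%N.
      rewrite size_Mmonic ?monicXn // -?size_poly_eq0 ?size_node // size_polyXn.
      by rewrite addnS /=; lia.
    rewrite -[n]/(val m) -(deltaE _ m sz) rmorph_sum mulr_suml.
    apply: eq_bigr => j _; rewrite -mulrA coefCM coefXnM ltnNge pg /= coef_poly.
    rewrite (leq_ltn_trans (leq_subr _ _)) ?(leq_trans gN) //.
    by rewrite hornerM hornerXn !rmorphM /=; ring.
  split=> [g gn|].
    rewrite Yg ?(ltn_trans gn) // big1 // => p _; case: leqP => // pg.
    rewrite nth_default ?rmorph0 ?mul0r //.
    rewrite size_Mmonic ?monicXn // -?size_poly_eq0 ?size_node // size_polyXn.
    by rewrite addnS /=; lia.
  rewrite Yg // /mode; apply: eq_bigr => p _; case: leqP => // pn.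
  rewrite coefMXn ltnNge leq_subr /= subKn //.
  have -> : gap lam N p = (size (node p)).-1 by rewrite size_node.
  by rewrite -/(lead_coef _) (monicP (monic_prod_XsubC _ _ _)) rmorph1 mul1r.
have spY i : spanned (\prod_(n <- s i) Y n).
  elim: (s i) (sN i) => [|n r IH] /=; first by rewrite big_nil.
  move=> /andP[nN /IH sr]; rewrite big_cons /Y insubT mulr_suml.
  by apply: spanned_sum => j; rewrite -mulrA; apply/spannedZ/spanned_E.
have [y yE] := boolp.choice spY.
have cardB : #|{: box}| = (\prod_(j < N) #|rows j|.+1)%N.
  rewrite card_dep_ffun foldrE big_map big_enum /=.
  by apply: eq_big => [j|j _]; rewrite ?card_ord.
pose mx : 'M[K]_(M, #|{: box}|) := \matrix_(i, c) y i (enum_val c).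
have [|x x0 xmx] := mx_left_relation mx; first by rewrite cardB.
have [i0 xi0] : exists i, x 0 i != 0 by apply/rV0Pn.
have rel : divides 'X^T (\sum_i scalar (x 0 i) * \prod_(n <- s i) Y n).
  have Z : \sum_i scalar (x 0 i) * (\sum_b scalar (y i b) * Emon b) = 0.
    under eq_bigr do rewrite mulr_sumr.
    rewrite exchange_big big1 //= => b _.
    under eq_bigr do rewrite mulrA /scalar -polyCM -rmorphM.
    rewrite -mulr_suml -rmorph_sum -rmorph_sum.
    move/matrixP: xmx => /(_ 0 (enum_rank b)); rewrite !mxE => xb.
    suff -> : \sum_i x 0 i * y i b = 0 by rewrite rmorph0 mul0r.
    by rewrite -[RHS]xb; apply: eq_bigr => i _; rewrite mxE enum_rankK.
  rewrite -[X in divides _ X]subr0 -[X in divides _ (_ - X)]Z.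
  rewrite -sumrB; apply: divides_sum => i _; rewrite -mulrBr.
  exact: divides_mull.
(* Among the words with nonzero coefficient, those of least total index g make up the coefficient of
   t^g; all others start at a higher power. *)
case: (@arg_minnP _ i0 (fun i => x 0 i != 0) (fun i => sumn (s i)) xi0) => i1 xi1 min_i1.
pose g := sumn (s i1).
exists (fun i => if sumn (s i) == g then x 0 i else 0).
  by exists i1; rewrite eqxx.
move/dividesXnP: rel => /(_ g (sT i1)); rewrite coef_sum => relg.
rewrite -[RHS]relg; apply: eq_bigr => i _; rewrite coefCM.
have [|low0 low1] := @prod_lowest_coef _ Y (mode a lam N) (s i).
  by move=> n ns; apply: Ylow; move/allP: (sN i); apply.
case: eqP => [<-|/eqP ig]; first by rewrite low1.
rewrite rmorph0 mul0r; have [lt|le] := ltnP g (sumn (s i)).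
  by rewrite low0 // mulr0.
rewrite (_ : x 0 i = 0) ?rmorph0 ?mul0r //; apply: contraNeq ig => xi.
by rewrite eqn_leq le; apply: min_i1.
Qed.

End UpperBound.

(** * The bicommutant of a commuting family *)

(** The nonzero vector ensures that 1 differs from 0 in the ring built from the family. *)
Record commuting_family (K : fieldType) (V : lmodType K) := CommutingFamily {
  family_mem : (V -> V) -> Prop;
  family_lin : forall f, family_mem f -> lin_map f;
  family_comm : forall f g, family_mem f -> family_mem g ->
    forall x, f (g x) = g (f x);
  family_point : V;
  family_point_neq0 : family_point != 0
}.

Section Bicommutant.
Variables (K : fieldType) (V : lmodType K) (S : commuting_family V).

Definition commutes_with_family (g : V -> V) : Prop :=
  lin_map g /\ forall f, family_mem S f -> forall x, g (f x) = f (g x).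

(* A commutative ring containing the family, in which polynomial identities
   between the operators can be computed. *)
Record bicommutant := Bicommutant {
  bico_fun :> V -> V;
  bico_lin : lin_map bico_fun;
  bico_comm : forall g, commutes_with_family g ->
    forall x, bico_fun (g x) = g (bico_fun x)
}.

Lemma bico_eq (f g : bicommutant) : (forall x, f x = g x) -> f = g.
Proof.
case: f g => [f fl fc] [g gl gc] /= fg.
have {}fg : f = g by apply: funext.
by case: g / fg gl gc => gl gc; congr Bicommutant; apply: Prop_irrelevance.
Qed.

(** A commuting family lies in its own commutant, hence so does its bicommutant. This is the source
    of the commutativity of the ring. *)
Lemma bico_commutes (f : bicommutant) : commutes_with_family f.
Proof.
split=> [|g Sg x]; first exact: bico_lin.
apply: bico_comm; split; first exact: family_lin Sg.
by move=> h Sh y; apply: family_comm Sg Sh y.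
Qed.

HB.instance Definition _ := gen_eqMixin bicommutant.
HB.instance Definition _ := gen_choiceMixin bicommutant.

Lemma bico_zero_subproof : lin_map (fun _ : V => 0 : V) /\
  forall g, commutes_with_family g -> forall x : V, 0 = g 0.
Proof.
split=> [c x y|g [gl _] _]; first by rewrite scaler0 addr0.
by rewrite (lin_map0 gl).
Qed.

Definition bico_zero := Bicommutant bico_zero_subproof.1 bico_zero_subproof.2.

Lemma bico_opp_subproof (f : bicommutant) : lin_map (fun x => - f x) /\
  forall g, commutes_with_family g -> forall x, - f (g x) = g (- f x).
Proof.
split=> [c x y|g gC x]; first by rewrite (bico_lin f) opprD scalerN.
by rewrite (bico_comm f gC) (lin_mapN gC.1).
Qed.

Definition bico_opp f :=
  Bicommutant (bico_opp_subproof f).1 (bico_opp_subproof f).2.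

Lemma bico_add_subproof (f h : bicommutant) : lin_map (fun x => f x + h x) /\
  forall g, commutes_with_family g -> forall x, f (g x) + h (g x) = g (f x + h x).
Proof.
split=> [c x y|g gC x].
  by rewrite (bico_lin f) (bico_lin h) scalerDr addrACA.
by rewrite (bico_comm f gC) (bico_comm h gC) (lin_mapD gC.1).
Qed.

Definition bico_add f h :=
  Bicommutant (bico_add_subproof f h).1 (bico_add_subproof f h).2.

Lemma bico_one_subproof : lin_map (fun x : V => x) /\
  forall g, commutes_with_family g -> forall x, g x = g x.
Proof. by []. Qed.

Definition bico_one := Bicommutant bico_one_subproof.1 bico_one_subproof.2.

Lemma bico_mul_subproof (f h : bicommutant) : lin_map (fun x => f (h x)) /\
  forall g, commutes_with_family g -> forall x, f (h (g x)) = g (f (h x)).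
Proof.
split=> [c x y|g gC x]; first by rewrite (bico_lin h) (bico_lin f).
by rewrite (bico_comm h gC) (bico_comm f gC).
Qed.

Definition bico_mul f h :=
  Bicommutant (bico_mul_subproof f h).1 (bico_mul_subproof f h).2.

Lemma bico_addA : associative bico_add.
Proof. by move=> f g h; apply: bico_eq => x /=; rewrite addrA. Qed.
Lemma bico_addC : commutative bico_add.
Proof. by move=> f g; apply: bico_eq => x /=; rewrite addrC. Qed.
Lemma bico_add0 : left_id bico_zero bico_add.
Proof. by move=> f; apply: bico_eq => x /=; rewrite add0r. Qed.
Lemma bico_addN : left_inverse bico_zero bico_opp bico_add.
Proof. by move=> f; apply: bico_eq => x /=; rewrite addNr. Qed.

HB.instance Definition _ :=
  GRing.isZmodule.Build bicommutant bico_addA bico_addC bico_add0 bico_addN.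

Lemma bico_mulA : associative bico_mul.
Proof. by move=> f g h; apply: bico_eq. Qed.
Lemma bico_mulC : commutative bico_mul.
Proof.
by move=> f g; apply: bico_eq => x /=; apply: (bico_comm f (bico_commutes g)).
Qed.
Lemma bico_mul1 : left_id bico_one bico_mul.
Proof. by move=> f; apply: bico_eq. Qed.
Lemma bico_mulDl : left_distributive bico_mul bico_add.
Proof. by move=> f g h; apply: bico_eq. Qed.
Lemma bico_one_neq0 : bico_one != 0 :> bicommutant.
Proof.
apply/eqP => /(congr1 (fun f : bicommutant => f (family_point S))) /= E.
by have := family_point_neq0 S; rewrite E eqxx.
Qed.

HB.instance Definition _ := GRing.Zmodule_isComNzRing.Build bicommutant
  bico_mulA bico_mulC bico_mul1 bico_mulDl bico_one_neq0.

Lemma bico_scalar_subproof (c : K) : lin_map (fun x : V => c *: x) /\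
  forall g, commutes_with_family g -> forall x, c *: g x = g (c *: x).
Proof.
split=> [b x y|g [gl _] x]; last by rewrite (lin_mapZ gl).
by rewrite scalerDr !scalerA mulrC.
Qed.

Definition bico_scalar c : bicommutant :=
  Bicommutant (bico_scalar_subproof c).1 (bico_scalar_subproof c).2.

Lemma bico_scalar_zmod : zmod_morphism bico_scalar.
Proof. by move=> b c; apply: bico_eq => x /=; rewrite scalerBl. Qed.
Lemma bico_scalar_monoid : monoid_morphism bico_scalar.
Proof.
by split=> [|b c]; apply: bico_eq => x /=; rewrite ?scale1r // scalerA.
Qed.

HB.instance Definition _ :=
  GRing.isZmodMorphism.Build K bicommutant bico_scalar bico_scalar_zmod.
HB.instance Definition _ :=
  GRing.isMonoidMorphism.Build K bicommutant bico_scalar bico_scalar_monoid.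

Lemma bico_mem_subproof f : family_mem S f -> lin_map f /\
  forall g, commutes_with_family g -> forall x, f (g x) = g (f x).
Proof. by move=> Sf; split=> [|g [_ gC] x]; [exact: family_lin Sf | rewrite gC]. Qed.

Definition bico_mem f (Sf : family_mem S f) : bicommutant :=
  Bicommutant (bico_mem_subproof Sf).1 (bico_mem_subproof Sf).2.

Lemma bico_addE (f g : bicommutant) x : (f + g) x = f x + g x.
Proof. by []. Qed.
Lemma bico_mulE (f g : bicommutant) x : (f * g) x = f (g x).
Proof. by []. Qed.
Lemma bico_0E x : (0 : bicommutant) x = 0.
Proof. by []. Qed.
Lemma bico_sumE (I : Type) (r : seq I) (P : pred I) (F : I -> bicommutant) x :
  (\sum_(i <- r | P i) F i) x = \sum_(i <- r | P i) F i x.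
Proof. exact: (big_morph (fun f : bicommutant => f x) (fun f g => bico_addE f g x)). Qed.
Lemma bico_natE n x : (n%:R : bicommutant) x = n%:R *: x.
Proof.
have -> : n%:R = bico_scalar n%:R by rewrite rmorph_nat.
by [].
Qed.

End Bicommutant.

(** * One slot *)

Section Monomials.
Implicit Types (S : monomial) (x y j : int).

Lemma in_insert S x y : (y \in insert S x) = (y \in S) (+) (y == x).
Proof.
rewrite /insert; case: ifPn => xS; rewrite !inE; last first.
  by case: eqP => [->|]; rewrite ?(negbTE xS) // addbF.
by case: eqP => [->|]; rewrite ?xS ?addbF.
Qed.

Lemma occurs_insert S x y : occurs (insert S x) y = occurs S y (+) (y == x).
Proof. by rewrite /occurs in_insert addbA. Qed.

Lemma insertC S x y : insert (insert S x) y = insert (insert S y) x.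
Proof. by apply/fsetP => z; rewrite !in_insert addbAC. Qed.

Lemma insertK S x : insert (insert S x) x = S.
Proof. by apply/fsetP => z; rewrite !in_insert addbK. Qed.

Definition int_range (lo : int) (n : nat) : seq int :=
  [seq lo + i%:Z | i <- iota 0 n].

Lemma mem_int_range lo n j : (j \in int_range lo n) = (lo <= j < lo + n%:Z).
Proof.
apply/mapP/idP => [[t]|H]; first by rewrite mem_iota => t_n ->; lia.
by exists `|j - lo|%N; rewrite ?mem_iota; lia.
Qed.

Lemma int_range_uniq lo n : uniq (int_range lo n).
Proof. by rewrite map_inj_uniq ?iota_uniq // => i j; lia. Qed.

Lemma finite_int_bounded (A : set int) (K : nat) :
  (forall j, A j -> `|j| < K%:Z) -> finite_set A.
Proof.
move=> AK; apply: (@sub_finite_set _ _ [set` int_range (- K%:Z) (2 * K)]).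
  by move=> j /AK /=; rewrite mem_int_range; lia.
exact: finite_seq.
Qed.

Lemma monomial_bound S : exists K : nat, forall j, j \in S -> `|j| < K%:Z.
Proof.
exists (\max_(j <- S) `|j|%N).+1 => j jS.
by rewrite -abszE ltz_nat ltnS; apply: (@leq_bigmax_seq _ (enum_fset S) xpredT (fun i : int => `|i|%N)).
Qed.

Lemma finite_occurs_above S j : finite_set [set i : int | occurs S i /\ j < i].
Proof.
have [K SK] := monomial_bound S.
apply: (@finite_int_bounded _ (K + `|j|%N).+1) => i [+ ji].
by rewrite /occurs; have := SK i; case: (i \in S) => //; lia.
Qed.

Lemma mem_occurs_above S j i :
  (i \in fset_set [set i : int | occurs S i /\ j < i]) = occurs S i && (j < i).
Proof.
rewrite in_fset_set; last exact: finite_occurs_above.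
by apply/idP/andP; rewrite inE.
Qed.

(** [insert] toggles the presence of x, so whether x is added or removed, the count above y changes
    by one exactly when y < x. Only its parity enters the signs. *)
Lemma nb_above_insert S x y :
  odd (nb_above (insert S x) y) = odd (nb_above S y) (+) (y < x).
Proof.
rewrite /nb_above.
set A := fset_set [set i : int | occurs (insert S x) i /\ y < i].
set A0 := fset_set [set i : int | occurs S i /\ y < i].
have AE i : (i \in A) = (i \in A0) (+) ((i == x) && (y < i)).
  rewrite !mem_occurs_above occurs_insert.
  by case: (y < i); rewrite ?andbT ?andbF.
case yx: (y < x); last first.
  rewrite addbF; congr (odd #|` _ |); apply/fsetP => i; rewrite AE.
  by case: eqP => [->|]; rewrite ?yx ?addbF.
rewrite addbT; have [xA|xA] := boolP (x \in A0).
  have -> : A = (A0 `\ x)%fset.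
    apply/fsetP => i; rewrite AE !inE; case: eqP => [->|_]; last by rewrite addbF.
    by rewrite xA yx.
  by rewrite [in RHS](cardfsD1 x A0) xA /= negbK.
have -> : A = (x |` A0)%fset.
  apply/fsetP => i; rewrite AE !inE; case: eqP => [->|_]; last by rewrite addbF.
  by rewrite (negbTE xA) yx.
by rewrite cardfsU1 xA.
Qed.

Lemma in_vmon m j : (j \in vmon m) = (j <= 0) (+) (j <= m).
Proof.
rewrite /vmon in_fset_set; first by apply/idP/idP; rewrite inE.
by apply: (@finite_int_bounded _ `|m|%N.+1) => i /=; lia.
Qed.

Lemma occurs_vmon m j : occurs (vmon m) j = (j <= m).
Proof. by rewrite /occurs in_vmon addbA addbb. Qed.

Lemma occurs_inj S S' : occurs S =1 occurs S' -> S = S'.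
Proof.
by move=> E; apply/fsetP => j; have := E j; rewrite /occurs => /addbI.
Qed.

Lemma insert_vmon m : insert (vmon m) (m + 1) = vmon (m + 1).
Proof.
by apply: occurs_inj => j; rewrite occurs_insert !occurs_vmon; lia.
Qed.

Lemma insert_vmon_top m : insert (vmon m) m = vmon (m - 1).
Proof.
by apply: occurs_inj => j; rewrite occurs_insert !occurs_vmon; lia.
Qed.

Lemma nb_above_vmon (m j : int) : m <= j -> nb_above (vmon m) j = 0%N.
Proof.
move=> mj; rewrite /nb_above (_ : [set i | _]%classic = set0%classic).
  by rewrite fset_set0.
apply/classical_sets.seteqP; split => i //= []; rewrite occurs_vmon; lia.
Qed.

Lemma d_deg_insert S j : ~~ occurs S j ->
  d_deg (insert S j) = d_deg S + (j %/ 2)%Z.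
Proof.
rewrite /occurs /d_deg /insert; case: ifPn => jS.
  rewrite addbT negbK => j0; rewrite [in RHS](big_fsetD1 j) //=.
  by rewrite ltNge j0 /=; ring.
by rewrite addbF => j0; rewrite big_fsetU1 //= ltNge j0 addrC.
Qed.

Lemma h0_deg_insert S j : ~~ occurs S j -> h0_deg (insert S j) = h0_deg S + 1.
Proof.
rewrite /occurs /h0_deg /insert; case: ifPn => jS.
  rewrite addbT negbK => j0; rewrite [in RHS](big_fsetD1 j) //=.
  by rewrite ltNge j0 /=; ring.
by rewrite addbF => j0; rewrite big_fsetU1 //= ltNge j0 addrC.
Qed.

End Monomials.

Lemma malgU_scale (K : fieldType) (B : choiceType) (c : K) (b : B) :
  << c *g b >> = c *: << b >> :> {malg K[B]}.
Proof. by apply/malgP => b'; rewrite mcoeffZ !mcoeffU mulr_natr. Qed.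

Section LinExt.
Variable R : realType.
Local Notation C := R[i].

Section Basis.
Variables (B : choiceType) (V : lmodType C).
Implicit Types (f g : B -> V) (x y : {malg C[B]}).

Lemma lin_ext_wide f x (D : {fset B}) :
  (msupp x `<=` D)%fset -> lin_ext f x = \sum_(b <- D) x@_b *: f b.
Proof.
move=> xD; rewrite /lin_ext (big_fset_incl _ xD) //= => b _ bx.
by rewrite mcoeff_outdom // scale0r.
Qed.

Lemma lin_ext_lin f : lin_map (lin_ext f).
Proof.
move=> c x y; pose D := (msupp x `|` msupp y `|` msupp (c *: x + y))%fset.
have xD : (msupp x `<=` D)%fset by rewrite /D -fsetUA fsubsetUl.
have yD : (msupp y `<=` D)%fset.
  by rewrite /D (fsetUC (msupp x)) -fsetUA fsubsetUl.
rewrite (lin_ext_wide _ xD) (lin_ext_wide _ yD) (@lin_ext_wide _ _ D); last first.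
  exact: fsubsetUr.
rewrite scaler_sumr -big_split /=; apply: eq_bigr => b _.
by rewrite mcoeffD mcoeffZ scalerDl scalerA.
Qed.

Lemma lin_extU f b : lin_ext f << b >> = f b.
Proof. by rewrite /lin_ext msuppU oner_eq0 big_seq_fset1 mcoeffUU scale1r. Qed.

Lemma lin_map_supp (X Y : {malg C[B]} -> V) x :
  lin_map X -> lin_map Y -> {in msupp x, forall b, X << b >> = Y << b >>} ->
  X x = Y x.
Proof.
move=> lX lY XY; rewrite (monalgE x) (lin_map_sum lX) (lin_map_sum lY).
rewrite big_seq [RHS]big_seq; apply: eq_bigr => b bx.
by rewrite malgU_scale (lin_mapZ lX) (lin_mapZ lY) XY.
Qed.

Lemma lin_map_eq (X Y : {malg C[B]} -> V) :
  lin_map X -> lin_map Y -> (forall b, X << b >> = Y << b >>) -> X =1 Y.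
Proof. by move=> lX lY XY x; apply: lin_map_supp => // b _. Qed.

End Basis.

Section Combinators.
Variables (V U W : lmodType C).

Lemma lin_map_id : lin_map (fun x : V => x).
Proof. by []. Qed.

Lemma lin_map_comp (X : U -> W) (Y : V -> U) :
  lin_map X -> lin_map Y -> lin_map (fun x => X (Y x)).
Proof. by move=> lX lY c x y; rewrite lY lX. Qed.

Lemma lin_map_add (X Y : V -> W) :
  lin_map X -> lin_map Y -> lin_map (fun x => X x + Y x).
Proof. by move=> lX lY c x y; rewrite lY lX scalerDr addrACA. Qed.

Lemma lin_map_scale (X : V -> W) a :
  lin_map X -> lin_map (fun x => a *: X x).
Proof. by move=> lX c x y; rewrite lX scalerDr !scalerA mulrC. Qed.

Lemma lin_map_opp (X : V -> W) : lin_map X -> lin_map (fun x => - X x).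
Proof. by move=> lX c x y; rewrite lX opprD scalerN. Qed.

Lemma lin_map_zero : lin_map (fun _ : V => 0 : W).
Proof. by move=> c x y; rewrite scaler0 addr0. Qed.

Lemma lin_map_bigsum (I : Type) (r : seq I) (P : pred I) (X : I -> V -> W) :
  (forall i, P i -> lin_map (X i)) ->
  lin_map (fun x => \sum_(i <- r | P i) X i x).
Proof.
move=> lX c x y; rewrite scaler_sumr -big_split; apply: eq_bigr => i Pi.
by rewrite lX.
Qed.

End Combinators.

End LinExt.

(** * Formal consequences of the anticommutation relations *)

Section AntiCommuting.
Variables (V : zmodType) (u d : int -> V -> V).
Hypothesis u_additive : forall j x y, u j (x - y) = u j x - u j y.
Hypothesis u_anti : forall a b x, u a (u b x) = - u b (u a x).
Hypothesis d_u : forall a b x,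
  d a (u b x) = (if a == b then x else 0) - u b (d a x).

Let u0 j : u j 0 = 0. Proof. by have := u_additive j 0 0; rewrite !subrr. Qed.
Let uN j x : u j (- x) = - u j x.
Proof. by rewrite -sub0r u_additive u0 sub0r. Qed.

Lemma anti_pair a b j x : u b (u a (u j x)) = u j (u b (u a x)).
Proof. by rewrite (u_anti a j) uN (u_anti b j) opprK. Qed.

Lemma anti_pair_del a b j x : u b (u a (d j x)) = d j (u b (u a x)) +
  ((if j == a then u b x else 0) - (if j == b then u a x else 0)).
Proof.
rewrite (d_u j b) (d_u j a) u_additive.
have -> : u b (if j == a then x else 0) = if j == a then u b x else 0.
  by case: ifP => // _; rewrite u0.
by rewrite [RHS]addrC opprB addrA subrK addrC subrK.
Qed.

Lemma anti_pair_pair a b a' b' x :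
  u b (u a (u b' (u a' x))) = u b' (u a' (u b (u a x))).
Proof. by rewrite !(anti_pair a b). Qed.

Lemma anti_pair_swap a b a' b' x :
  u b (u a (u b' (u a' x))) = - u b (u a' (u b' (u a x))).
Proof.
by rewrite (u_anti a b') (u_anti a a') (u_anti a' b') !uN !opprK.
Qed.

End AntiCommuting.

Section OneSlot.
Variable R : realType.
Local Notation C := R[i].
Local Notation F := (F R).
Implicit Types (x y : F) (S : monomial) (j : int).

Definition sgn S j : C := (-1) ^+ nb_above S j.

Lemma sgn_insert S a b :
  sgn (insert S a) b = sgn S b * (-1) ^+ (b < a)%R.
Proof.
rewrite /sgn -signr_odd nb_above_insert signr_addb.
by rewrite (signr_odd C (nb_above S b)).
Qed.

Lemma sgn_sq S j : sgn S j * sgn S j = 1.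
Proof. by rewrite /sgn -expr2 sqrr_sign. Qed.

(** The operator psi^*_j of the overview. The variables above j are counted as in [rmul_var], which
    makes the canonical anticommutation relations hold. *)
Definition del_var j : F -> F :=
  lin_ext (fun S : monomial =>
    if occurs S j then << sgn S j *g insert S j >> else 0 : F).

Lemma rmul_var_lin j : lin_map (@rmul_var R j).
Proof. exact: lin_ext_lin. Qed.

Lemma del_var_lin j : lin_map (del_var j).
Proof. exact: lin_ext_lin. Qed.

Lemma rmul_varU j S : rmul_var j (<< S >> : F) =
  if occurs S j then 0 else sgn S j *: << insert S j >>.
Proof. by rewrite /rmul_var lin_extU -malgU_scale. Qed.

Lemma del_varU j S : del_var j (<< S >> : F) =
  if occurs S j then sgn S j *: << insert S j >> else 0.
Proof. by rewrite /del_var lin_extU -malgU_scale. Qed.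

Lemma rmul_var_anti a b x :
  rmul_var a (rmul_var b x) = - rmul_var b (rmul_var a x).
Proof.
have la := rmul_var_lin a; have lb := rmul_var_lin b.
apply: (lin_map_eq (X := fun x => rmul_var a (rmul_var b x))
  (Y := fun x => - rmul_var b (rmul_var a x))).
- exact: (lin_map_comp la lb).
- exact: (lin_map_opp (lin_map_comp lb la)).
move=> S; rewrite !rmul_varU.
have [->|ab] := eqVneq a b.
  case: ifP => Sb; first by rewrite (lin_map0 lb) oppr0.
  by rewrite (lin_mapZ lb) rmul_varU occurs_insert Sb eqxx /= scaler0 oppr0.
case Sa: (occurs S a); case Sb: (occurs S b);
  rewrite ?(lin_map0 la) ?(lin_map0 lb) ?(lin_mapZ la) ?(lin_mapZ lb) ?rmul_varU
   ?occurs_insert ?Sa ?Sb ?(negbTE ab) 1?eq_sym ?(negbTE ab) /= ?scaler0 ?oppr0 //.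
rewrite !scalerA (insertC S b a) -scaleNr; congr (_ *: _).
rewrite !sgn_insert.
(* Exactly one of the two orders of insertion makes one variable cross the other; this is the minus
   sign. *)
case: (ltgtP a b) ab => // _ _; rewrite expr0 expr1; ring.
Qed.

Lemma del_rmul_var a b x :
  del_var a (rmul_var b x) = (if a == b then x else 0) - rmul_var b (del_var a x).
Proof.
have la := del_var_lin a; have lb := rmul_var_lin b.
apply: (lin_map_eq (X := fun x => del_var a (rmul_var b x))
  (Y := fun x => (if a == b then x else 0) - rmul_var b (del_var a x))).
- exact: (lin_map_comp la lb).
- apply: lin_map_add (lin_map_opp (lin_map_comp lb la)).
  by case: (a == b); [exact: lin_map_id | exact: lin_map_zero].
move=> S; rewrite rmul_varU del_varU; have [<-|ab] := eqVneq a b.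
  case: ifP => Sa.
    rewrite (lin_map0 la) (lin_mapZ (rmul_var_lin _)) rmul_varU occurs_insert Sa eqxx /=.
    by rewrite scalerA insertK sgn_insert ltxx expr0 mulr1 sgn_sq scale1r subrr.
  rewrite (lin_map0 (rmul_var_lin _)) subr0 (lin_mapZ la) del_varU occurs_insert Sa eqxx /=.
  by rewrite scalerA insertK sgn_insert ltxx expr0 mulr1 sgn_sq scale1r.
case Sa: (occurs S a); case Sb: (occurs S b);
  rewrite ?(lin_map0 la) ?(lin_map0 lb) ?(lin_mapZ la) ?(lin_mapZ lb) ?rmul_varU
   ?del_varU ?occurs_insert ?Sa ?Sb ?(negbTE ab) 1?eq_sym ?(negbTE ab) /=
   ?scaler0 ?subr0 //.
rewrite !scalerA (insertC S b a) sub0r -scaleNr; congr (_ *: _).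
rewrite !sgn_insert.
case: (ltgtP a b) ab => // _ _; rewrite expr0 expr1; ring.
Qed.

(* Keeps unification from unfolding the operators. *)
Opaque rmul_var del_var.

Definition bounded (K : nat) x : Prop :=
  {in msupp x, forall S, {in S, forall j : int, `|j| < K%:Z}}.

Lemma bounded_exists x : exists K, bounded K x.
Proof.
have /boolp.choice[K KE] := monomial_bound.
exists (\max_(S <- msupp x) K S)%N => S Sx j /KE jS.
apply: lt_le_trans jS _.
rewrite lez_nat.
exact: (@leq_bigmax_seq _ (enum_fset (msupp x)) xpredT K S).
Qed.

Lemma bounded_leq K L x : (K <= L)%N -> bounded K x -> bounded L x.
Proof.
move=> KL xK S Sx j jS; apply: lt_le_trans (xK S Sx j jS) _.
by rewrite lez_nat.
Qed.

Lemma rmul_var_low K x j : bounded K x -> j <= - K%:Z -> rmul_var j x = 0.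
Proof.
move=> xK jK.
apply: (lin_map_supp (rmul_var_lin j) (@lin_map_zero _ _ _)) => S /xK SK.
by rewrite rmul_varU ifT // /occurs; case: (boolP (j \in S)) => [/SK|]; lia.
Qed.

(** K > 0 excludes j = 0, a variable that occurs in v(0). *)
Lemma del_var_high K x j : bounded K x -> K%:Z <= j -> (0 < K)%N -> del_var j x = 0.
Proof.
move=> xK jK K0.
apply: (lin_map_supp (del_var_lin j) (@lin_map_zero _ _ _)) => S /xK SK.
by rewrite del_varU ifF // /occurs; case: (boolP (j \in S)) => [/SK|]; lia.
Qed.

Definition e_term (m i : int) x : F := phi (m - i) (psi i x).

Lemma e_term_lin m i : lin_map (e_term m i).
Proof. exact: (lin_map_comp (rmul_var_lin _) (rmul_var_lin _)). Qed.

Lemma e_term_out K x m i : bounded K x ->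
  ~~ (- K%:Z <= i <= m + K%:Z) -> e_term m i x = 0.
Proof.
move=> xK iK; rewrite /e_term /phi /psi.
have [iK'|iK'] := ltP i (- K%:Z).
  rewrite (rmul_var_low xK) ?(lin_map0 (rmul_var_lin _)) //; rewrite /psi_idx; lia.
(* Here phi(m - i) is the variable that is already present, so it is moved to act first. *)
rewrite rmul_var_anti (rmul_var_low xK) ?(lin_map0 (rmul_var_lin _)) ?oppr0 //.
by rewrite /phi_idx; lia.
Qed.

Lemma e_seqE m x (s : seq int) : uniq s ->
  (forall i, i \notin s -> e_term m i x = 0) -> e m x = \sum_(i <- s) e_term m i x.
Proof.
move=> us sx; rewrite /e [RHS](fsbig_seq _ _ us).
by apply/esym/fsbig_widen => // i /= [_ /= /negP/sx].
Qed.

Lemma eE K x m (n : nat) : bounded K x -> m + 2 * K%:Z + 1 <= n%:Z ->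
  e m x = \sum_(i <- int_range (- K%:Z) n) e_term m i x.
Proof.
move=> xK mn; apply: e_seqE; first exact: int_range_uniq.
move=> i; rewrite mem_int_range => iK; apply: (e_term_out xK); lia.
Qed.

Lemma e_lin m : lin_map (@e R m).
Proof.
move=> c x y; have [K1 K1x] := bounded_exists x.
have [K2 K2y] := bounded_exists y; have [K3 K3z] := bounded_exists (c *: x + y).
(* The effective range of the sum depends on the vector; a range common to all three turns [e m]
   into one finite sum of linear maps. *)
pose K := maxn (maxn K1 K2) K3; pose n := absz (m + 2 * K%:Z + 1).
have mn : m + 2 * K%:Z + 1 <= n%:Z by rewrite /n; lia.
rewrite (@eE K (c *: x + y) m n) //; last by apply: bounded_leq K3z; lia.
rewrite (@eE K x m n) //; last by apply: bounded_leq K1x; lia.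
rewrite (@eE K y m n) //; last by apply: bounded_leq K2y; lia.
rewrite scaler_sumr -big_split; apply: eq_bigr => i _; exact: e_term_lin.
Qed.

Lemma rmul_varB j x y : rmul_var j (x - y) = rmul_var j x - rmul_var j y.
Proof. exact: (lin_mapB (rmul_var_lin j)). Qed.

Lemma rmul_var_e_term m i j x :
  e_term m i (rmul_var j x) = rmul_var j (e_term m i x).
Proof. exact: (anti_pair rmul_varB rmul_var_anti). Qed.

Lemma del_var_e_term m i j x :
  e_term m i (del_var j x) = del_var j (e_term m i x) +
    ((if j == psi_idx i then rmul_var (phi_idx (m - i)) x else 0)
     - (if j == phi_idx (m - i) then rmul_var (psi_idx i) x else 0)).
Proof. exact: (anti_pair_del rmul_varB del_rmul_var). Qed.

Lemma e_termC m i m' i' x :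
  e_term m i (e_term m' i' x) = e_term m' i' (e_term m i x).
Proof. exact: (anti_pair_pair rmul_varB rmul_var_anti). Qed.

End OneSlot.

Section AntiCommutingSquare.
Variables (V : zmodType) (u : int -> V -> V).
Hypothesis V_2free : forall z : V, z = - z -> z = 0.
Hypothesis u_additive : forall j x y, u j (x - y) = u j x - u j y.
Hypothesis u_anti : forall a b x, u a (u b x) = - u b (u a x).
Variables (a b : nat -> int).

Let mode n x := \sum_(s < n.+1) u (b (n - s)%N) (u (a s) x).

Let u0 j : u j 0 = 0. Proof. by have := u_additive j 0 0; rewrite !subrr. Qed.
Let uN j x : u j (- x) = - u j x.
Proof. by rewrite -sub0r u_additive u0 sub0r. Qed.
Let uD j x y : u j (x + y) = u j x + u j y.
Proof. by rewrite -[y in LHS]opprK u_additive uN opprK. Qed.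

(* The modes of the current b(z) a(z), whose square vanishes since a(z)^2 does. *)
Lemma anti_mode_sq q x : \sum_(n < q.+1) mode n (mode (q - n) x) = 0.
Proof.
pose g s t s' t' := u (b t) (u (a s) (u (b t') (u (a s') x))).
have gN s t s' t' : g s t s' t' = - g s' t s t' by exact: anti_pair_swap.
have modeE n y : (n <= q)%N -> mode n y = \sum_(s < q.+1) \sum_(t < q.+1)
      if (s + t == n)%N then u (b t) (u (a s) y) else 0.
  move=> nq; rewrite /mode (big_ord_widen q.+1 (fun s => u (b (n - s)%N) (u (a s) y))) //.
  rewrite big_mkcond /=; apply: eq_bigr => s _; case: ltnP => sn; last first.
    by rewrite big1 // => t _; case: eqP => // E; move: sn; lia.
  have ns : (n - s < q.+1)%N by lia.
  rewrite (bigD1 (Ordinal ns)) //= subnKC // eqxx big1 ?addr0 // => t ts.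
  by case: eqP => // E; case/negP: ts; apply/eqP/val_inj; rewrite /= -E addKn.
pose Z := \sum_(s < q.+1) \sum_(s' < q.+1) \sum_(t < q.+1) \sum_(t' < q.+1)
  if (s + t + (s' + t') == q)%N then g s t s' t' else 0.
transitivity Z; last first.
  (* Exchanging s and s' preserves the total index and changes the sign, so Z = - Z. *)
  apply: V_2free; rewrite {1}/Z exchange_big /= -sumrN; apply: eq_bigr => s _.
  rewrite -sumrN; apply: eq_bigr => s' _; rewrite -sumrN; apply: eq_bigr => t _.
  rewrite -sumrN; apply: eq_bigr => t' _.
  rewrite (_ : (s' + t + (s + t') = s + t + (s' + t'))%N); last by lia.
  by case: ifP => _; rewrite ?oppr0 // gN.
transitivity (\sum_(n < q.+1) \sum_(s < q.+1) \sum_(t < q.+1)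
    \sum_(s' < q.+1) \sum_(t' < q.+1)
    if (s + t == n)%N && (s' + t' == q - n)%N then g s t s' t' else 0).
  apply: eq_bigr => n _; rewrite modeE; last by rewrite -ltnS.
  apply: eq_bigr => s _; apply: eq_bigr => t _.
  case: eqP => stn /=; last by rewrite big1 // => s' _; rewrite big1.
  rewrite modeE ?leq_subr // (big_morph _ (uD _) (u0 _)) (big_morph _ (uD _) (u0 _)).
  apply: eq_bigr => s' _.
  rewrite (big_morph _ (uD _) (u0 _)) (big_morph _ (uD _) (u0 _)).
  by apply: eq_bigr => t' _; case: ifP => // _; rewrite !u0.
rewrite exchange_big /=; apply: eq_bigr => s _.
rewrite exchange_big /= [RHS]exchange_big /=; apply: eq_bigr => t _.
rewrite exchange_big /=; apply: eq_bigr => s' _.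
rewrite exchange_big /=; apply: eq_bigr => t' _.
case: eqP => E.
  have sq : (s + t < q.+1)%N by lia.
  rewrite (bigD1 (Ordinal sq)) //= eqxx /= ifT; last by apply/eqP; lia.
  rewrite big1 ?addr0 // => n ns; case: eqP => //= stn.
  by case/negP: ns; apply/eqP/val_inj; rewrite /= stn.
rewrite big1 // => n _; case: eqP => //= stn; case: eqP => // s't'.
by case: E; have := ltn_ord n; lia.
Qed.

End AntiCommutingSquare.

Section OneSlotCurrent.
Variable R : realType.
Local Notation C := R[i].
Local Notation F := (F R).
Implicit Types (x y : F) (S : monomial) (j m i lam : int).

(** +1 on the indices of the psi(i) and -1 on those of the phi(i): the commutators of e_m with the
    deletions of the two kinds of variables have opposite signs. *)
Definition alt j : C := (-1) ^+ (absz j).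

Lemma altD a b : alt (a + b) = alt a * alt b.
Proof.
rewrite /alt -[LHS]signr_odd -[in RHS](signr_odd _ (absz a)).
rewrite -[in RHS](signr_odd _ (absz b)) -signr_addb; congr (_ ^+ _).
lia.
Qed.

(** Every term of e_m multiplies by two variables whose indices add up to 2 m + 1. Exactly one term
    contains the variable j, and the commutator is multiplication by its partner. *)
Lemma del_var_e m j x : e m (del_var j x) =
  del_var j (e m x) + alt j *: rmul_var (2 * m + 1 - j) x.
Proof.
have [K1 K1x] := bounded_exists x.
have [K2 K2x] := bounded_exists (del_var j x).
pose K := (K1 + K2 + absz j + absz m)%N; pose n := absz (m + 2 * K%:Z + 1).
have mn : m + 2 * K%:Z + 1 <= n%:Z by rewrite /n; lia.
rewrite (@eE _ K (del_var j x) m n) //; last by apply: bounded_leq K2x; lia.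
rewrite (@eE _ K x m n) //; last by apply: bounded_leq K1x; lia.
pose T i := (if j == psi_idx i then rmul_var (phi_idx (m - i)) x else 0)
     - (if j == phi_idx (m - i) then rmul_var (psi_idx i) x else 0) : F.
transitivity (\sum_(i <- int_range (- K%:Z) n) (del_var j (e_term m i x) + T i)).
  by apply: eq_bigr => i _; exact: del_var_e_term.
rewrite big_split /= (lin_map_sum (del_var_lin j)); congr (_ + _).
have [i0 [i0s i0E]] : exists i0, i0 \in int_range (- K%:Z) n /\
    ((alt j = 1 /\ j = psi_idx i0) \/ (alt j = -1 /\ j = phi_idx (m - i0))).
  have [o|o] := boolP (odd (absz j)).
    exists (m - ((j - 1)%R %/ 2)%Z); rewrite mem_int_range; split; first lia.
    by right; rewrite /alt -signr_odd o /phi_idx; split=> //; lia.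
  exists (j %/ 2)%Z; rewrite mem_int_range; split; first lia.
  by left; rewrite /alt -signr_odd (negbTE o) /psi_idx; split=> //; lia.
rewrite (bigD1_seq i0) ?int_range_uniq //= big1 ?addr0 => [|i' ii0]; last first.
  have [E1 E2] : (j == psi_idx i') = false /\ (j == phi_idx (m - i')) = false.
    case: i0E => -[_ jE]; split; apply/negbTE; move: jE ii0;
      rewrite /psi_idx /phi_idx; lia.
  by rewrite /T E1 E2 subrr.
case: i0E => -[-> jE].
  have E1 : j == psi_idx i0 by apply/eqP.
  have E2 : (j == phi_idx (m - i0)) = false.
    by apply/negbTE; move: jE; rewrite /psi_idx /phi_idx; lia.
  have E3 : phi_idx (m - i0) = 2 * m + 1 - j.
    by move: jE; rewrite /psi_idx /phi_idx; lia.
  by rewrite /T E1 E2 subr0 scale1r E3.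
have E1 : (j == psi_idx i0) = false.
  by apply/negbTE; move: jE; rewrite /psi_idx /phi_idx; lia.
have E2 : j == phi_idx (m - i0) by apply/eqP.
have E3 : psi_idx i0 = 2 * m + 1 - j.
  by move: jE; rewrite /psi_idx /phi_idx; lia.
by rewrite /T E1 E2 sub0r scaleN1r E3.
Qed.

(** The least i for which psi(i) has index greater than - lam, that is, does not occur in v(-
    lam). *)
Definition first_psi lam : int := (- lam %/ 2)%Z + 1.

(* On the monomials containing all variables of index <= - lam this is the
   operator e_(n - lam + 1); unlike e it is a finite sum. *)
Definition slot_mode lam (n : nat) x : F :=
  \sum_(s < n.+1) e_term (n%:Z - lam + 1) (first_psi lam + s%:Z) x.

Lemma slot_mode_lin lam n : lin_map (@slot_mode lam n).
Proof. by apply: lin_map_bigsum => s _; exact: e_term_lin. Qed.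

Lemma slot_modeC lam n n' x :
  slot_mode lam n (slot_mode lam n' x) = slot_mode lam n' (slot_mode lam n x).
Proof.
have sumE (m m' : nat) y : slot_mode lam m (slot_mode lam m' y) =
    \sum_(s < m.+1) \sum_(t < m'.+1)
      e_term (m%:Z - lam + 1) (first_psi lam + s%:Z)
        (e_term (m'%:Z - lam + 1) (first_psi lam + t%:Z) y).
  by apply: eq_bigr => s _; rewrite (lin_map_sum (@e_term_lin R _ _)).
rewrite !sumE exchange_big; apply: eq_bigr => s _; apply: eq_bigr => t _.
exact: e_termC.
Qed.

Lemma e_slot_mode lam m S : (forall j, j <= - lam -> occurs S j) ->
  e m (<< S >> : F) =
    if 0 <= m + lam - 1 then slot_mode lam (absz (m + lam - 1)%R) << S >> else 0.
Proof.
move=> occ.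
have zero j : j <= - lam -> rmul_var j (<< S >> : F) = 0.
  by move=> jl; rewrite rmul_varU occ.
(* Below this range psi(i) is already present, above it phi(m - i) is. The range has m + lam
   elements, which explains the mode index m + lam - 1. *)
have out i : ~~ (first_psi lam <= i < m + lam + first_psi lam) ->
    e_term m i (<< S >> : F) = 0.
  rewrite /first_psi /e_term /phi /psi => iout.
  have [il|li] := leP (psi_idx i) (- lam).
    by rewrite zero // (lin_map0 (rmul_var_lin _)).
  rewrite rmul_var_anti zero ?(lin_map0 (rmul_var_lin _)) ?oppr0 //.
  by move: iout li; rewrite /phi_idx /psi_idx; lia.
case: ifP => ml; last first.
  rewrite (@e_seqE _ m _ [::]) ?big_nil // => i _; apply: out; lia.
set n := absz _; have mE : m = n%:Z - lam + 1 by rewrite /n; lia.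
rewrite (@e_seqE _ m _ (int_range (first_psi lam) n.+1)) ?int_range_uniq //.
  transitivity (\sum_(0 <= s < n.+1) e_term m (first_psi lam + s%:Z) (<< S >> : F)).
    by rewrite big_map /index_iota subn0.
  by rewrite big_mkord /slot_mode -mE.
by move=> i; rewrite mem_int_range => iout; apply: out; lia.
Qed.

Lemma opp_eq_self (V : lmodType C) (z : V) : z = - z -> z = 0.
Proof.
move/eqP; rewrite -addr_eq0 -mulr2n -scaler_nat scaler_eq0 pnatr_eq0 /=.
by move/eqP.
Qed.

Lemma slot_mode_sq lam q x :
  \sum_(n < q.+1) slot_mode lam n (slot_mode lam (q - n) x) = 0.
Proof.
pose a (s : nat) := psi_idx (first_psi lam + s%:Z).
pose b (t : nat) := phi_idx (1 - lam - first_psi lam + t%:Z).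
have modeE n y : slot_mode lam n y = \sum_(s < n.+1) rmul_var (b (n - s)%N) (rmul_var (a s) y).
  apply: eq_bigr => s _.
  have E : n%:Z - lam + 1 - (first_psi lam + s%:Z) =
      1 - lam - first_psi lam + (n - s)%N%:Z by have := ltn_ord s; lia.
  by rewrite /e_term E.
rewrite -[RHS](anti_mode_sq (@opp_eq_self _) (@rmul_varB R) (@rmul_var_anti R) a b q x).
by apply: eq_bigr => n _; rewrite !modeE.
Qed.

Lemma rmul_var_vmon m : rmul_var (m + 1) (<< vmon m >> : F) = << vmon (m + 1) >>.
Proof.
rewrite rmul_varU occurs_vmon ifF; last by apply/negbTE; lia.
by rewrite insert_vmon /sgn nb_above_vmon ?expr0 ?scale1r //; lia.
Qed.

Lemma slot_mode_lowest lam : exists2 c : C, c != 0 &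
  slot_mode lam 0 (<< vmon (- lam) >> : F) = c *: << vmon (- lam + 2) >>.
Proof.
have step S j m : j = m + 1 -> S = vmon m ->
    rmul_var j (<< S >> : F) = << vmon (m + 1) >>.
  by move=> -> ->; exact: rmul_var_vmon.
have step2 j j' : j = - lam + 1 -> j' = - lam + 2 ->
    rmul_var j' (rmul_var j (<< vmon (- lam) >> : F)) = << vmon (- lam + 2) >>.
  move=> jE j'E; rewrite (step _ _ _ jE erefl) (step _ j' (- lam + 1)) //; last by lia.
  by congr (<< vmon _ >>); lia.
rewrite /slot_mode big_ord1 /e_term /=.
have [o|o] := boolP (odd (absz lam)).
  exists 1; first exact: oner_neq0.
  by rewrite scale1r; apply: step2; rewrite /psi_idx /phi_idx /first_psi; lia.
exists (-1); first by rewrite oppr_eq0 oner_neq0.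
rewrite scaleN1r /phi /psi rmul_var_anti; congr (- _); apply: step2;
  rewrite /psi_idx /phi_idx /first_psi; lia.
Qed.

Lemma del_var_vmon m : del_var m (<< vmon m >> : F) = << vmon (m - 1) >>.
Proof.
rewrite del_varU occurs_vmon lexx insert_vmon_top /sgn nb_above_vmon //.
by rewrite expr0 scale1r.
Qed.

Lemma msupp_sum (B : choiceType) (I : Type) (r : seq I) (G : I -> {malg C[B]}) b :
  b \in msupp (\sum_(t <- r) G t) -> exists t, b \in msupp (G t).
Proof.
rewrite -mcoeff_neq0 (raddf_sum (mcoeff b)) => nz.
apply: contrapT => H; case/eqP: nz; rewrite big1 // => t _.
by apply: mcoeff_outdom; apply/negP => bt; apply: H; exists t.
Qed.

Lemma msupp_scaleU (B : choiceType) (c : C) (b b' : B) :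
  b' \in msupp (c *: << b >> : {malg C[B]}) -> b' = b.
Proof.
by rewrite -malgU_scale => /(fsubsetP msuppU_le); rewrite inE => /eqP.
Qed.

Lemma msupp_lin_ext (B B' : choiceType) (f : B -> {malg C[B']})
    (v : {malg C[B]}) b' :
  b' \in msupp (lin_ext f v) -> exists2 b, b \in msupp v & b' \in msupp (f b).
Proof.
rewrite /lin_ext big_seq -mcoeff_neq0 (raddf_sum (mcoeff b')) => nz.
apply: contrapT => H2; case/eqP: nz; rewrite big1 // => b bx /=.
rewrite mcoeffZ (_ : (f b)@_b' = 0) ?mulr0 //; apply: mcoeff_outdom.
by apply/negP => bf; apply: H2; exists b.
Qed.

Definition raises m S S' : Prop := [/\ d_deg S' = d_deg S + m,
  h0_deg S' = h0_deg S + 2 & forall j, occurs S j -> occurs S' j].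

Lemma e_term_supp m i S S' :
  S' \in msupp (e_term m i (<< S >> : F)) -> raises m S S'.
Proof.
rewrite /e_term /phi /psi rmul_varU; case: ifP => Si.
  by rewrite (lin_map0 (rmul_var_lin _)) msupp0 inE.
rewrite (lin_mapZ (rmul_var_lin _)) rmul_varU; case: ifP => Sj.
  by rewrite scaler0 msupp0 inE.
rewrite scalerA => /msupp_scaleU ->; split.
- by rewrite !d_deg_insert ?Si ?Sj // /psi_idx /phi_idx; lia.
- by rewrite !h0_deg_insert ?Si ?Sj //; lia.
- move=> j Oj; move: Sj; rewrite !occurs_insert Oj.
  have [jphi|_] := eqVneq j (phi_idx (m - i)).
    by rewrite -jphi Oj => /negbFE ->.
  by have [jpsi|] := eqVneq j (psi_idx i); first by move: Oj; rewrite jpsi Si.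
Qed.

Lemma e_supp m S S' : S' \in msupp (e m (<< S >> : F)) -> raises m S S'.
Proof.
have [K Kx] := bounded_exists (<< S >> : F).
rewrite (@eE _ K _ _ (absz (m + 2 * K%:Z + 1))) //; last by lia.
by move=> /msupp_sum[t] /e_term_supp.
Qed.

End OneSlotCurrent.

(** * Tensor powers and cyclic subspaces *)

Section Diagonal.
Variables (K : fieldType) (B : choiceType).
Implicit Type x : {malg K[B]}.

Lemma diag_eigen (c : B -> K) (X : {malg K[B]} -> {malg K[B]}) x (a : K) :
  lin_map X -> (forall b, X << b >> = c b *: << b >>) ->
  X x = a *: x <-> forall b, b \in msupp x -> c b = a.
Proof.
move=> lX Xb.
have XE : X x = \sum_(b <- msupp x) << c b * x@_b *g b >>.
  rewrite [in LHS](monalgE x) (lin_map_sum lX); apply: eq_bigr => b _.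
  by rewrite malgU_scale (lin_mapZ lX) Xb scalerA mulrC -malgU_scale.
have Xc b : (X x)@_b = c b * x@_b.
  rewrite XE (raddf_sum (mcoeff b)) /=.
  case: msuppP => [bx|bx]; last first.
    rewrite mulr0 big_seq big1 // => b' b'x; rewrite mcoeffU.
    by case: eqP => // E; move: bx; rewrite -E b'x.
  rewrite (big_fsetD1 b) //= mcoeffU eqxx mulr1n big_seq big1 ?addr0 // => b'.
  by rewrite !inE => /andP[/negbTE b'b _]; rewrite mcoeffU b'b.
split=> [E b bx|H].
  have := Xc b; rewrite E mcoeffZ => /mulIf -> //; by rewrite mcoeff_neq0.
apply/malgP => b; rewrite Xc mcoeffZ; case: msuppP => [/H -> //|_].
by rewrite !mulr0.
Qed.

End Diagonal.

Section Tensor.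
Variables (R : realType) (k : nat).
Local Notation C := R[i].
Local Notation F := (F R).
Local Notation T := (tensF R k).
Implicit Types (b : tmonomial k) (p q : 'I_k) (S : monomial) (A B : F -> F).

Definition upd b p S : tmonomial k := [ffun r => if r == p then S else b r].

Lemma upd_same b p S : upd b p S p = S.
Proof. by rewrite ffunE eqxx. Qed.

Lemma upd_other b p q S : q != p -> upd b p S q = b q.
Proof. by rewrite ffunE => /negbTE ->. Qed.

Lemma upd_id b p : upd b p (b p) = b.
Proof. by apply/ffunP => r; rewrite ffunE; case: eqP => [->|]. Qed.

Lemma upd_upd b p S S' : upd (upd b p S) p S' = upd b p S'.
Proof. by apply/ffunP => r; rewrite !ffunE; case: eqP. Qed.

Lemma updC b p q S S' : p != q ->
  upd (upd b p S) q S' = upd (upd b q S') p S.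
Proof.
move=> pq; apply/ffunP => r; rewrite !ffunE.
by have [->|//] := eqVneq r q; rewrite eq_sym (negbTE pq).
Qed.

Lemma at_slot_lin b p : lin_map (@at_slot R k b p).
Proof. exact: lin_ext_lin. Qed.

Lemma at_slotU b p S : at_slot b p (<< S >> : F) = << upd b p S >>.
Proof. exact: lin_extU. Qed.

Lemma at_slot_upd b p S (y : F) : at_slot (upd b p S) p y = at_slot b p y.
Proof.
apply: (lin_map_eq (at_slot_lin _ _) (at_slot_lin _ _)) => S'.
by rewrite !at_slotU upd_upd.
Qed.

Definition lift p A : T -> T := lin_ext (fun b => at_slot b p (A << b p >>)).

Lemma lift_lin p A : lin_map (lift p A).
Proof. exact: lin_ext_lin. Qed.

Lemma liftU p A b : lift p A << b >> = at_slot b p (A << b p >>).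
Proof. exact: lin_extU. Qed.

Lemma coprodE A (x : T) : coprod A x = \sum_p lift p A x.
Proof.
rewrite /coprod /lin_ext /lift /lin_ext [RHS]exchange_big /=.
by apply: eq_bigr => b _; rewrite scaler_sumr.
Qed.

Lemma coprod_lin A : lin_map (@coprod R k A).
Proof. exact: lin_ext_lin. Qed.

Lemma lift_at_slot p A b (y : F) : lin_map A ->
  lift p A (at_slot b p y) = at_slot b p (A y).
Proof.
move=> lA; apply: (lin_map_eq (X := fun y => lift p A (at_slot b p y))
  (Y := fun y => at_slot b p (A y))).
- exact: (lin_map_comp (lift_lin p A) (at_slot_lin b p)).
- exact: (lin_map_comp (at_slot_lin b p) lA).
- by move=> S; rewrite at_slotU liftU at_slot_upd upd_same.
Qed.

Lemma lift_comp p A B (x : T) : lin_map A ->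
  lift p A (lift p B x) = lift p (fun y => A (B y)) x.
Proof.
move=> lA; apply: (lin_map_eq (X := fun x => lift p A (lift p B x))).
- exact: (lin_map_comp (lift_lin p A) (lift_lin p B)).
- exact: lift_lin.
- by move=> b; rewrite !liftU lift_at_slot.
Qed.

Lemma lift_ext p A B (x : T) : A =1 B -> lift p A x = lift p B x.
Proof. by move=> AB; congr (lift p _ x); apply: funext. Qed.

Lemma lift_add p A B (x : T) : lift p (fun y => A y + B y) x = lift p A x + lift p B x.
Proof.
apply: (lin_map_eq (lift_lin _ _) (lin_map_add (lift_lin _ _) (lift_lin _ _))).
by move=> b; rewrite !liftU (lin_mapD (at_slot_lin _ _)).
Qed.

Lemma lift_scale p A c (x : T) : lift p (fun y => c *: A y) x = c *: lift p A x.
Proof.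
apply: (lin_map_eq (lift_lin _ _) (lin_map_scale c (lift_lin _ _))).
by move=> b; rewrite !liftU (lin_mapZ (at_slot_lin _ _)).
Qed.

Lemma lift_zero p (x : T) : lift p (fun=> 0) x = 0.
Proof.
apply: (lin_map_eq (lift_lin _ _) (@lin_map_zero _ _ _)) => b.
by rewrite !liftU (lin_map0 (at_slot_lin _ _)).
Qed.

Lemma lift_sum p (I : Type) (r : seq I) (A : I -> F -> F) (x : T) :
  lift p (fun y => \sum_(t <- r) A t y) x = \sum_(t <- r) lift p (A t) x.
Proof.
elim: r => [|t r IH].
  by rewrite big_nil -[RHS](lift_zero p x); apply: lift_ext => y; rewrite big_nil.
rewrite big_cons -IH -lift_add; apply: lift_ext => y; exact: big_cons.
Qed.

Let pair_ext (f : monomial -> monomial -> T) (y z : F) : T :=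
  lin_ext (fun S => lin_ext (fun S' => f S S') z) y.

Let pair_extC f y z : pair_ext f y z = pair_ext (fun S S' => f S' S) z y.
Proof.
have swapE g u v : pair_ext g u v = \sum_(S <- msupp u) \sum_(S' <- msupp v)
    (u@_S * v@_S') *: g S S'.
  apply: eq_bigr => S _; rewrite scaler_sumr; apply: eq_bigr => S' _.
  exact: scalerA.
rewrite !swapE exchange_big; apply: eq_bigr => S _; apply: eq_bigr => S' _.
by rewrite mulrC.
Qed.

Let lift_lift p q A B b : p != q -> lift p A (lift q B << b >>) =
  pair_ext (fun S S' => << upd (upd b q S) p S' >>) (B << b q >>) (A << b p >>).
Proof.
move=> pq; rewrite liftU; apply: (lin_map_eq (X := fun z => lift p A (at_slot b q z))).
- exact: (lin_map_comp (lift_lin p A) (at_slot_lin b q)).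
- exact: lin_ext_lin.
- by move=> S; rewrite at_slotU liftU lin_extU upd_other.
Qed.

(** No Koszul sign is introduced, even for odd operators: multiplications in different slots
    commute. The sign in the exchange operator is adapted to this convention. *)
Lemma lift_comm p q A B (x : T) : p != q ->
  lift p A (lift q B x) = lift q B (lift p A x).
Proof.
move=> pq; apply: (lin_map_eq (X := fun x => lift p A (lift q B x))
    (Y := fun x => lift q B (lift p A x))).
- exact: (lin_map_comp (lift_lin p A) (lift_lin q B)).
- exact: (lin_map_comp (lift_lin q B) (lift_lin p A)).
have qp : q != p by rewrite eq_sym.
move=> b; rewrite (lift_lift A B b pq) (lift_lift B A b qp) [LHS]pair_extC.
have fE : (fun S S' => << upd (upd b q S') p S >> : T) =
    (fun S S' => << upd (upd b p S) q S' >>).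
  by apply: funext => S; apply: funext => S'; rewrite updC.
by rewrite fE.
Qed.

Lemma lift_commutes p A B (x : T) : lin_map A -> lin_map B ->
  (forall y, A (B y) = B (A y)) -> lift p A (lift p B x) = lift p B (lift p A x).
Proof. by move=> lA lB AB; rewrite (lift_comp p B x lA) (lift_comp p A x lB); exact: lift_ext. Qed.

(* The vector v(- lam_1) (x) ... (x) v(- lam_k). *)
Definition tmon (lam : 'I_k -> int) : T := << [ffun p => vmon (- lam p)] : tmonomial k >>.

Lemma lift_tmon p A (lam : 'I_k -> int) c m :
  A << vmon (- lam p) >> = c *: << vmon (- m) >> ->
  lift p A (tmon lam) = c *: tmon (fun q => if q == p then m else lam q).
Proof.
move=> AE; rewrite liftU ffunE AE (lin_mapZ (at_slot_lin _ _)) at_slotU.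
congr (_ *: << _ >>); apply/ffunP => q; rewrite !ffunE.
by case: eqP.
Qed.

Section Above.
Variable lam : 'I_k -> int.

(** On combinations of these monomials e_m is a finite sum of modes. The e_m only add variables, so
    the property is inherited from the cyclic vector by all of W(lam). *)
Definition above_mon b : Prop := forall p j, j <= - lam p -> occurs (b p) j.
Definition above (x : T) : Prop := forall b, b \in msupp x -> above_mon b.

Definition tmode p n : T -> T := lift p (slot_mode (lam p) n).

Lemma tmode_lin p n : lin_map (tmode p n).
Proof. exact: lift_lin. Qed.

Lemma tmodeC p n q n' (x : T) : tmode p n (tmode q n' x) = tmode q n' (tmode p n x).
Proof.
have [<-|pq] := eqVneq p q; last exact: lift_comm.
apply: lift_commutes; [exact: slot_mode_lin | exact: slot_mode_lin |].
exact: slot_modeC.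
Qed.

Lemma tmode_sq p (q : nat) (x : T) : \sum_(n < q.+1) tmode p n (tmode p (q - n)%N x) = 0.
Proof.
transitivity (lift p (fun y => \sum_(n < q.+1)
    slot_mode (lam p) n (slot_mode (lam p) (q - n) y)) x).
  rewrite lift_sum; apply: eq_bigr => n _; apply: lift_comp; exact: slot_mode_lin.
rewrite -[RHS](lift_zero p x); apply: lift_ext => y; exact: slot_mode_sq.
Qed.

Lemma coprod_e_above m (x : T) : above x -> coprod (e m) x =
  \sum_p if 0 <= m + lam p - 1 then tmode p (absz (m + lam p - 1)%R) x else 0.
Proof.
move=> ab; rewrite coprodE; apply: eq_bigr => p _.
apply: (lin_map_supp (X := lift p (e m)) (Y := fun x =>
  if 0 <= m + lam p - 1 then tmode p (absz (m + lam p - 1)%R) x else 0)).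
- exact: lift_lin.
- by case: (0 <= _); [exact: lift_lin | exact: lin_map_zero].
move=> b /ab ab_b; rewrite liftU (e_slot_mode _ m (ab_b p)).
by case: ifP => _; [rewrite /tmode liftU | exact: lin_map0 (at_slot_lin _ _)].
Qed.

Lemma above_tmon : above (tmon lam).
Proof.
move=> b; rewrite msuppU oner_eq0 inE => /eqP -> p j jl.
by rewrite ffunE occurs_vmon.
Qed.

End Above.

Definition t_deg b : int := \sum_p d_deg (b p).
Definition t_charge b : int := \sum_p h0_deg (b p).

Lemma coprod_e_supp m (x : T) b' : b' \in msupp (coprod (e m) x) ->
  exists2 b, b \in msupp x & [/\ t_deg b' = t_deg b + m,
    t_charge b' = t_charge b + 2 & forall p j, occurs (b p) j -> occurs (b' p) j].
Proof.
move=> /msupp_lin_ext[b bx] /msupp_sum[p] /msupp_lin_ext[S' /e_supp[d1 h1 o1]].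
rewrite -[<< _ >>]scale1r => /msupp_scaleU ->; exists b => //; split.
- rewrite /t_deg (bigD1 p) //= upd_same d1 (bigD1 p (F := fun p => d_deg (b p))) //=.
  rewrite addrAC; congr (_ + _ + _); apply: eq_bigr => q /upd_other ->.
  by [].
- rewrite /t_charge (bigD1 p) //= upd_same h1 (bigD1 p (F := fun p => h0_deg (b p))) //=.
  rewrite addrAC; congr (_ + _ + _); apply: eq_bigr => q /upd_other ->.
  by [].
- move=> q j; have [->|qp] := eqVneq q p; first by rewrite upd_same; apply: o1.
  by rewrite upd_other.
Qed.

Lemma above_coprod_e lam m (x : T) : above lam x -> above lam (coprod (e m) x).
Proof.
move=> ab b' /coprod_e_supp[b /ab ab_b [_ _ occ]] p j jl.
by apply: occ; apply: ab_b.
Qed.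

Lemma above_comb lam c (x y : T) : above lam x -> above lam y -> above lam (c *: x + y).
Proof.
move=> ax ay b /(fsubsetP (msuppD_le _ _)); rewrite in_fsetU => /orP[|/ay //].
by move=> /(fsubsetP (msuppZ_le _ _)) /ax.
Qed.

Lemma lift_d p (A : monomial -> C) b :
  lift p (lin_ext (fun S => << A S *g S >>)) << b >> = A (b p) *: << b >>.
Proof.
rewrite liftU lin_extU malgU_scale (lin_mapZ (at_slot_lin _ _)) at_slotU.
by rewrite upd_id.
Qed.

Lemma coprod_diagU (f : monomial -> int) b :
  coprod (lin_ext (fun S => << (f S)%:~R *g S >> : F)) << b >> =
  (\sum_p f (b p))%:~R *: (<< b >> : T).
Proof.
rewrite coprodE rmorph_sum scaler_suml; apply: eq_bigr => p _.
exact: lift_d.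
Qed.

Lemma coprod_diag_eigen (f : monomial -> int) (x : T) (c : C) :
  coprod (lin_ext (fun S => << (f S)%:~R *g S >> : F)) x = c *: x <->
  forall b, b \in msupp x -> (\sum_p f (b p))%:~R = c.
Proof.
exact: (diag_eigen x c (@coprod_lin _) (coprod_diagU f)).
Qed.

End Tensor.

Lemma sum_comb_cat (K : fieldType) (V : lmodType K) (I : Type) (f : I -> V)
    (a : K) (c d : seq (K * I)) :
  \sum_(t <- [seq (a * t.1, t.2) | t <- c] ++ d) t.1 *: f t.2 =
  a *: (\sum_(t <- c) t.1 *: f t.2) + \sum_(t <- d) t.1 *: f t.2.
Proof.
rewrite big_cat big_map scaler_sumr; congr (_ + _).
by apply: eq_bigr => t _; rewrite scalerA.
Qed.

Section Cyclic.
Variables (R : realType) (k : nat).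
Local Notation C := R[i].
Local Notation T := (tensF R k).
Implicit Types (w x y : T) (m : int).

Definition e_word (t : seq int) w : T := foldr (fun m => coprod (e m)) w t.

(** In contrast to [M], no lower bound is imposed on the indices; [e_word_out] shows that on the
    vectors in question the smaller ones act by 0. *)
Definition nonpos_word (t : seq int) : Prop := {in t, forall m : int, m <= 0}.

Definition cyc w (x : T) : Prop := exists c : seq (C * seq int),
  {in c, forall t, nonpos_word t.2} /\ x = \sum_(t <- c) t.1 *: e_word t.2 w.

Lemma cyc_word w t : nonpos_word t -> cyc w (e_word t w).
Proof.
move=> nt; exists [:: (1, t)]; rewrite big_seq1 scale1r; split=> // u.
by rewrite inE => /eqP ->.
Qed.

Lemma cyc_self w : cyc w w.
Proof. by apply: (@cyc_word w [::]). Qed.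

Lemma cyc_subspace w : subspace (cyc w).
Proof.
split=> [|a x y [c [cn xE]] [d [dn yE]]]; first by exists [::]; rewrite big_nil.
exists ([seq (a * t.1, t.2) | t <- c] ++ d); split.
  move=> t; rewrite mem_cat => /orP[/mapP[u uc ->]|]; last exact: dn.
  exact: cn uc.
by rewrite xE yE; exact/esym/sum_comb_cat.
Qed.

Lemma cyc_e w m x : m <= 0 -> cyc w x -> cyc w (coprod (e m) x).
Proof.
move=> m0 [c [cn xE]]; rewrite xE (lin_map_sum (@coprod_lin _ _ _)).
apply: (subspace_sum_seq (cyc_subspace w)) => t tc /=.
rewrite (lin_mapZ (@coprod_lin _ _ _)); apply: (subspaceZ _ (cyc_subspace w)).
apply: (@cyc_word w (m :: t.2)) => n; rewrite inE => /orP[/eqP -> //|].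
exact: cn.
Qed.

Lemma cyc_min w (P : T -> Prop) : subspace P ->
  (forall m x, m <= 0 -> P x -> P (coprod (e m) x)) -> P w ->
  forall x, cyc w x -> P x.
Proof.
move=> sP Pe Pw x [c [cn ->]]; apply: (subspace_sum_seq sP) => t /cn.
case: t => [z t] /= nt; apply: (subspaceZ _ sP).
elim: t nt => //= m t IH nt; apply: Pe; first by apply: nt; rewrite inE eqxx.
by apply: IH => n nin; apply: nt; rewrite inE nin orbT.
Qed.

Lemma cyc_sub w w' : cyc w w' -> forall x, cyc w' x -> cyc w x.
Proof.
move=> ww'; apply: cyc_min => //; first exact: cyc_subspace.
by move=> m x; apply: cyc_e.
Qed.

End Cyclic.

(** * The modes acting on the cyclic subspaces W(lam) *)

Section Modes.
Variables (R : realType) (k : nat) (lam : 'I_k -> int).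
Local Notation C := R[i].
Local Notation T := (tensF R k).
Local Notation w := (tmon R lam).

Definition W (x : T) : Prop := cyc w x.

Lemma W_above x : W x -> above lam x.
Proof.
apply: cyc_min.
- split=> [b|c x1 y]; first by rewrite msupp0 inE.
  exact: above_comb.
- by move=> m y _; apply: above_coprod_e.
- exact: above_tmon.
Qed.

Definition is_tmode (f : T -> T) : Prop := exists p n, f = tmode lam p n.

Lemma is_tmode_lin f : is_tmode f -> lin_map f.
Proof. by move=> [p [n ->]]; exact: tmode_lin. Qed.

Lemma is_tmode_comm f g : is_tmode f -> is_tmode g -> forall x, f (g x) = g (f x).
Proof. by move=> [p [n ->]] [p' [n' ->]] x; exact: tmodeC. Qed.

Lemma tmon_neq0 : w != 0.
Proof. by rewrite monalgU_eq0 oner_neq0. Qed.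

Definition tmode_family : commuting_family T :=
  CommutingFamily is_tmode_lin is_tmode_comm tmon_neq0.

Local Notation B := (bicommutant tmode_family).

Fact is_tmode_tmode p n : is_tmode (tmode lam p n).
Proof. by exists p, n. Qed.

Definition cur p n : B := bico_mem (S := tmode_family) (is_tmode_tmode p n).

Lemma curE p n x : cur p n x = tmode lam p n x.
Proof. by []. Qed.

Lemma cur_sq p q : \sum_(i < q.+1) cur p i * cur p (q - i) = 0.
Proof.
apply: bico_eq => x; rewrite bico_sumE -[RHS](tmode_sq lam p q x).
by apply: eq_bigr.
Qed.

Lemma cur0_sq p : cur p 0 ^+ 2 = 0.
Proof. by have := cur_sq p 0; rewrite big_ord1. Qed.

Lemma prod_cur0 (r : seq 'I_k) : uniq r -> exists2 c : C, c != 0 &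
  (\prod_(p <- r) cur p 0) w =
    c *: tmon R (fun q => if q \in r then lam q - 2 else lam q).
Proof.
elim: r => [|p r IH] /=.
  by move=> _; exists 1; rewrite ?oner_neq0 // big_nil scale1r.
move=> /andP[pr /IH[c c0 cE]].
have [d d0 dE] := slot_mode_lowest R (lam p).
exists (c * d); first by rewrite mulf_neq0.
rewrite big_cons bico_mulE cE curE (lin_mapZ (tmode_lin lam p 0)).
rewrite /tmode (@lift_tmon _ _ p _ _ d (lam p - 2)).
  rewrite scalerA; congr (_ *: tmon R _); apply: funext => q; rewrite inE.
  by case: eqP => [->|].
by rewrite (negbTE pr) dE; congr (_ *: << vmon _ >>); lia.
Qed.

Definition top_slots (N : int) : {set 'I_k} := [set p | lam p == N].
Definition top_sum (N : int) : B := \sum_(p in top_slots N) cur p 0.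

(** A slot of length lam_p responds to e_m only for m >= 1 - lam_p. At m = 1 - N only the longest
    slots respond, each through its lowest mode. *)
Lemma coprod_top (N : int) x : (forall p, lam p <= N) -> above lam x ->
  coprod (e (1 - N)) x = top_sum N x.
Proof.
move=> lamN /coprod_e_above ->; rewrite bico_sumE [RHS]big_mkcond.
apply: eq_bigr => p _; rewrite inE.
have [lN|lN] := eqVneq (lam p) N.
  rewrite curE ifT; last by lia.
  by have -> : absz (1 - N + lam p - 1)%R = 0%N by lia.
by rewrite ifF //; apply/negbTE; have := lamN p; lia.
Qed.

Lemma top_sum_exp N : exists2 c : C, c != 0 & (top_sum N ^+ #|top_slots N|) w =
  c *: tmon R (fun q => if lam q == N then lam q - 2 else lam q).
Proof.
rewrite sum_sq0_exp => [|p _]; last exact: cur0_sq.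
rewrite bico_mulE bico_natE -big_enum.
have [c c0 ->] := prod_cur0 (enum_uniq (top_slots N)).
exists ((#|top_slots N|)`!%:R * c).
  by rewrite mulf_neq0 // pnatr_eq0 -lt0n fact_gt0.
rewrite scalerA; congr (_ *: tmon R _); apply: funext => q.
by rewrite mem_enum inE.
Qed.

Lemma top_sum_nilp N : top_sum N ^+ #|top_slots N|.+1 = 0.
Proof.
have [|_ [h ->]] := @sum_sq_exp _ 0 _ (top_slots N) (cur^~ 0%N).
  by move=> p _; rewrite cur0_sq; exists 0; rewrite mulr0.
by rewrite mul0r.
Qed.

Lemma W_top_sum (N : int) r : 1 <= N -> (forall p, lam p <= N) ->
  W ((top_sum N ^+ r) w).
Proof.
move=> N1 lamN; elim: r => [|r IH]; first by rewrite expr0; apply: cyc_self.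
rewrite exprS bico_mulE -coprod_top //; last exact: W_above.
by apply: cyc_e => //; lia.
Qed.

Lemma lower_top (N : int) : 1 <= N -> (forall p, lam p <= N) ->
  W (tmon R (fun q => if lam q == N then lam q - 2 else lam q)).
Proof.
move=> N1 lamN; have := W_top_sum #|top_slots N| N1 lamN.
have [c c0 ->] := top_sum_exp N.
move=> /(subspaceZ c^-1 (cyc_subspace w)).
by rewrite scalerA mulVf // scale1r.
Qed.

End Modes.

Section NatModes.
Variables (R : realType) (k : nat) (lam : 'I_k -> nat) (N : nat).
Hypothesis lamN : forall p, (lam p <= N)%N.
Local Notation C := R[i].
Local Notation T := (tensF R k).
Let lamz p : int := (lam p)%:Z.
Local Notation w := (tmon R lamz).
Local Notation B := (bicommutant (tmode_family R lamz)).
Let c n : B := mode (cur R lamz) lam N n.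

Lemma mode_coprod m x : above lamz x -> m <= 0 ->
  coprod (e m) x = if 0 <= m + N%:Z - 1 then c (absz (m + N%:Z - 1)%R) x else 0.
Proof.
move=> ab m0; rewrite (coprod_e_above m ab); case: ifP => mN; last first.
  rewrite big1 // => p _; rewrite ifF //.
  by have := lamN p; rewrite /lamz; lia.
rewrite /c /mode bico_sumE; apply: eq_bigr => p _; have := lamN p.
rewrite /lamz /gap => lp.
case: (leqP (N - lam p) _) => gm; last by rewrite ifF //; lia.
rewrite ifT; last by lia.
have -> : absz (m + (lam p)%:Z - 1)%R = (absz (m + N%:Z - 1)%R - (N - lam p))%N.
  by lia.
by [].
Qed.

Definition mode_word (x : T) : Prop := exists s : seq nat,
  all (fun n => n < N)%N s /\ x = (\prod_(n <- s) c n) w.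

Lemma e_word_mode t : nonpos_word t -> e_word t w = 0 \/ mode_word (e_word t w).
Proof.
elim: t => [|m t IH] nt; first by right; exists [::]; rewrite big_nil.
have nt' : nonpos_word t by move=> n nin; apply: nt; rewrite inE nin orbT.
have m0 : m <= 0 by apply: nt; rewrite inE eqxx.
have ab : above lamz (e_word t w) by apply: W_above; apply: cyc_word.
rewrite /= -/(e_word t w) mode_coprod //; case: ifP => mN; last by left.
have [->|[s [sN ->]]] := IH nt'; first by left; exact: (lin_map0 (bico_lin _)).
right; exists (absz (m + N%:Z - 1)%R :: s); split=> /=.
  by rewrite sN andbT; lia.
by rewrite big_cons bico_mulE.
Qed.

Lemma mode_word_free_bound n (v : 'I_n -> T) :
  (forall i, mode_word (v i)) -> free_fam v ->
  (n <= \prod_(j < N) #|[set p | (j < lam p)%N]|.+1)%N.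
Proof.
move=> /boolp.choice[s sE] fv; rewrite leqNgt; apply/negP => Dn.
pose bound := ((\sum_(i < n) sumn (s i)).+1 + N)%N.
have [|t|||x [t0 xt0] xE] := @mode_relation _ B (@bico_scalar _ _ _) k _
   (@cur_sq R k lamz) lam N bound n s.
- by move=> t; case: (sE t).
- rewrite /bound (bigD1 t) //=; lia.
- rewrite /bound; lia.
- exact: Dn.
have /fv/(_ t0)/eqP : \sum_t x t *: v t = 0.
  have := congr1 (fun f : B => f w) xE; rewrite bico_sumE bico_0E => E.
  by rewrite -[RHS]E; apply: eq_bigr => t _; case: (sE t) => _ ->.
by rewrite (negbTE xt0).
Qed.

(** [mode_relation] bounds free families of words only. Words span W(lam), so a maximal free family
    of words spans it too and bounds every other free family. *)
Lemma W_free_bound n (v : 'I_n -> T) :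
  (forall i, W lamz (v i)) -> free_fam v ->
  (n <= \prod_(j < N) #|[set p | (j < lam p)%N]|.+1)%N.
Proof.
move=> Wv fv; have [r [u [uA fu su]]] := maximal_free_fam mode_word_free_bound.
apply: leq_trans (mode_word_free_bound uA fu).
pose P x := exists c : 'I_r -> C, x = \sum_j c j *: u j.
have sP : subspace P.
  split=> [|a x y [c1 ->] [c2 ->]].
    by exists (fun=> 0); rewrite big1 // => j _; rewrite scale0r.
  exists (fun j => a * c1 j + c2 j); rewrite scaler_sumr -big_split.
  by apply: eq_bigr => j _; rewrite scalerDl scalerA.
apply: (free_span_leq fv (v := u)) => t.
have [d [dn ->]] := Wv t; apply: (subspace_sum_seq sP) => z /dn nz.
apply: (subspaceZ _ sP); have [->|/su //] := e_word_mode nz.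
exact: sP.1.
Qed.

(** The coefficient of [coef_mode_exp] applied to w lowers every slot by 2, up to a nonzero factor.
    This makes the M_s an increasing chain. *)
Lemma lower_all : (forall p, (0 < lam p)%N) ->
  W lamz (tmon R (fun p => lamz p - 2)).
Proof.
move=> lam0.
have WE n x : (n < N)%N -> W lamz x -> W lamz (c n x).
  move=> nN Wx; have := @mode_coprod (n%:Z - N%:Z + 1) x (W_above Wx).
  rewrite ifT; last by lia.
  have -> : absz (n%:Z - N%:Z + 1 + N%:Z - 1)%R = n by lia.
  by move=> <-; [apply: cyc_e => //; lia | lia].
have WC j q x : W lamz x -> W lamz (((\poly_(n < N) c n) ^+ j)`_q x).
  elim: j q x => [|j IH] q x Wx.
    rewrite expr0 coef1; case: eqP => _ //; rewrite bico_0E.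
    exact: (cyc_subspace w).1.
  rewrite exprS coefM bico_sumE; apply: (subspace_sum (A := W lamz)) => [|t _]; first exact: cyc_subspace.
  rewrite bico_mulE coef_poly; case: ifP => tN; last first.
    by rewrite bico_0E; exact: (cyc_subspace w).1.
  exact/WE/IH.
have := WC k (\sum_p gap lam N p)%N w (cyc_self w).
rewrite (coef_mode_exp (@cur_sq R k lamz) lamN lam0) bico_mulE bico_natE.
have -> : \prod_p cur R lamz p 0 = \prod_(p <- enum 'I_k) cur R lamz p 0.
  by rewrite big_enum.
have [d d0 ->] := prod_cur0 R lamz (enum_uniq 'I_k).
move=> /(subspaceZ (d * k`!%:R)^-1 (cyc_subspace w)).
rewrite !scalerA (mulrC d) -[_^-1 * _ * d]mulrA mulVf ?scale1r; last first.
  by rewrite mulf_neq0 // pnatr_eq0 -lt0n fact_gt0.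
congr (W _ (tmon R _)); apply: funext => q; by rewrite mem_enum.
Qed.

End NatModes.

(** * The exchange operator *)

Lemma sum_perturb (V : zmodType) (I : finType) (p : I) (f g : I -> V) (z : V) :
  f p = g p + z -> (forall q, q != p -> f q = g q) ->
  \sum_q f q = \sum_q g q + z.
Proof.
move=> fp fq; rewrite (bigD1 p) //= fp [in RHS](bigD1 p) //= addrAC.
by congr (_ + _); rewrite (eq_bigr _ fq).
Qed.

Section ReflectedSum.
Variables (K : fieldType) (V : lmodType K).

(** The range of summation, from - M to s + M, is stable under the reflection a -> s - a. *)
Lemma reflected_sum0 (g : int -> V) (s : int) (M : nat) : 0 <= s + 2 * M%:Z ->
  \sum_(a <- int_range (- M%:Z) (absz (s + 2 * M%:Z + 1)%R)) (g a - g (s - a)) = 0.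
Proof.
move=> sM; set r := int_range _ _; rewrite sumrB.
apply/eqP; rewrite subr_eq0 -(big_map (fun a => s - a) xpredT g); apply/eqP.
apply: perm_big; apply: uniq_perm.
- exact: int_range_uniq.
- by rewrite map_inj_uniq ?int_range_uniq // => a b; lia.
move=> a; rewrite mem_int_range; apply/idP/mapP => [H|[b]].
  by exists (s - a); [rewrite mem_int_range; lia | lia].
by rewrite mem_int_range => H ->; lia.
Qed.

Lemma reflected_sum (f g : int -> V) (c : K) (s : int) (M : nat) :
  0 <= s + 2 * M%:Z ->
  \sum_(a <- int_range (- M%:Z) (absz (s + 2 * M%:Z + 1)%R))
    (f a + c *: (g a - g (s - a))) =
  \sum_(a <- int_range (- M%:Z) (absz (s + 2 * M%:Z + 1)%R)) f a.
Proof.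
by move=> sM; rewrite big_split /= -scaler_sumr reflected_sum0 // scaler0 addr0.
Qed.

Lemma add_scale0 (c : K) (x y : V) : x = 0 -> y = 0 -> x + c *: y = 0.
Proof. by move=> -> ->; rewrite scaler0 addr0. Qed.

Lemma add_scale0r (c : K) (x y : V) : y = 0 -> x + c *: y = x.
Proof. by move=> ->; rewrite scaler0 addr0. Qed.

Lemma exchange_signs (D : V -> V) (rho al al_a al_c : K) (x y z t u v : V) :
  lin_map D -> D u = x + al *: z -> D v = y + al *: t ->
  rho * rho = 1 -> al = al_a * rho -> al_c = - (rho * al_a) ->
  D (u + rho *: v) = (x + rho *: y) + rho *: (al_a *: z - al_c *: t).
Proof.
move=> lD Du Dv rho2 alE ->.
rewrite (lin_mapD lD) (lin_mapZ lD) Du Dv alE.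
rewrite scaleNr opprK !scalerDr addrACA !scalerA.
have -> : rho * (al_a * rho) = al_a by rewrite mulrCA rho2 mulr1.
have -> : rho * (rho * al_a) = al_a by rewrite mulrA rho2 mul1r.
by rewrite (mulrC al_a).
Qed.

End ReflectedSum.

Opaque lift rmul_var del_var e at_slot.

Section Exchange.
Variables (R : realType) (k : nat).
Local Notation C := R[i].
Local Notation F := (F R).
Local Notation T := (tensF R k).
Variables (i j : 'I_k) (ij : i != j) (r : int).

Lemma rmul_var_e m a (y : F) : e m (rmul_var a y) = rmul_var a (e m y).
Proof.
have [K1 K1y] := bounded_exists y.
have [K2 K2y] := bounded_exists (rmul_var a y).
pose K := (K1 + K2)%N; pose n := absz (m + 2 * K%:Z + 1).
have mn : m + 2 * K%:Z + 1 <= n%:Z by rewrite /n; lia.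
rewrite (@eE _ K (rmul_var a y) m n) //; last by apply: bounded_leq K2y; lia.
rewrite (@eE _ K y m n) //; last by apply: bounded_leq K1y; lia.
rewrite (lin_map_sum (rmul_var_lin a)); apply: eq_bigr => t _.
exact: rmul_var_e_term.
Qed.

Lemma coprod_lift m p (A Ad : F -> F) (x : T) : lin_map A ->
  (forall y, e m (A y) = A (e m y) + Ad y) ->
  coprod (e m) (lift p A x) = lift p A (coprod (e m) x) + lift p Ad x.
Proof.
move=> lA AE; rewrite !coprodE (lin_map_sum (lift_lin p A)).
apply: (sum_perturb (p := p)) => [|q qp].
  rewrite (lift_comp p A x (@e_lin R m)) (lift_comp p (e m) x lA) -lift_add.
  exact: lift_ext.
exact: lift_comm.
Qed.

Lemma coprod_lift_rmul m p a (x : T) :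
  coprod (e m) (lift p (rmul_var a) x) = lift p (rmul_var a) (coprod (e m) x).
Proof.
rewrite (@coprod_lift m p _ (fun=> 0) x (rmul_var_lin a)) ?lift_zero ?addr0 //.
by move=> y; rewrite addr0; exact: rmul_var_e.
Qed.

Lemma coprod_lift_del m p a (x : T) :
  coprod (e m) (lift p (del_var a) x) = lift p (del_var a) (coprod (e m) x) +
    alt R a *: lift p (rmul_var (2 * m + 1 - a)) x.
Proof.
rewrite (@coprod_lift m p _ (fun y => alt R a *: rmul_var (2 * m + 1 - a) y) x (del_var_lin a)).
  by rewrite lift_scale.
by move=> y; exact: del_var_e.
Qed.

(* With a summed over all integers, the coproduct commutes with this operator:
   the commutator of e_m with the term of index a is antisymmetric under
   a -> 2 m + 1 + r - a. *)
Definition exch_term (a : int) (x : T) : T :=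
  lift i (rmul_var a) (lift j (del_var (a - r)) x) +
  alt R r *: lift j (rmul_var a) (lift i (del_var (a - r)) x).

Lemma exch_term_lin a : lin_map (exch_term a).
Proof.
apply: lin_map_add; first exact: (lin_map_comp (lift_lin _ _) (lift_lin _ _)).
apply: lin_map_scale; exact: (lin_map_comp (lift_lin _ _) (lift_lin _ _)).
Qed.

Definition exchange : T -> T :=
  lin_ext (fun b => \sum_(a \in [set: int]) exch_term a << b >>).

Lemma exchange_lin : lin_map exchange.
Proof. exact: lin_ext_lin. Qed.

Definition tbounded (K : nat) (x : T) : Prop := forall b, b \in msupp x ->
  forall p a, a \in b p -> `|a| < K%:Z.

Lemma tbounded_exists x : exists K, tbounded K x.
Proof.
have bE (b : tmonomial k) : exists K : nat, forall p a, a \in b p -> `|a| < K%:Z.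
  have /boolp.choice[K KE] := fun p => monomial_bound (b p).
  exists (\max_p K p)%N => p a /KE aK; apply: lt_le_trans aK _.
  by rewrite lez_nat; exact: leq_bigmax.
have /boolp.choice[K KE] := bE.
exists (\max_(b <- msupp x) K b)%N => b bx p a /KE aK; apply: lt_le_trans aK _.
by rewrite lez_nat; exact: (@leq_bigmax_seq _ (enum_fset (msupp x)) xpredT K b).
Qed.

Lemma tbounded_leq K L x : (K <= L)%N -> tbounded K x -> tbounded L x.
Proof.
move=> KL xK b bx p a ab; apply: lt_le_trans (xK b bx p a ab) _.
by rewrite lez_nat.
Qed.

Lemma lift_rmul_low K x p a : tbounded K x -> a <= - K%:Z ->
  lift p (rmul_var a) x = 0.
Proof.
move=> xK aK.
apply: (lin_map_supp (lift_lin p (rmul_var a)) (@lin_map_zero _ _ _)) => b /xK bK.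
rewrite liftU (@rmul_var_low _ K) ?(lin_map0 (at_slot_lin _ _)) //.
by move=> S; rewrite msuppU oner_eq0 inE => /eqP -> t; apply: bK.
Qed.

Lemma lift_del_high K x p a : tbounded K x -> K%:Z <= a -> (0 < K)%N ->
  lift p (del_var a) x = 0.
Proof.
move=> xK aK K0.
apply: (lin_map_supp (lift_lin p (del_var a)) (@lin_map_zero _ _ _)) => b /xK bK.
rewrite liftU (@del_var_high _ K) ?(lin_map0 (at_slot_lin _ _)) //.
by move=> S; rewrite msuppU oner_eq0 inE => /eqP -> t; apply: bK.
Qed.

Let liftC (A B : F -> F) (x : T) : lift i A (lift j B x) = lift j B (lift i A x).
Proof. exact: lift_comm. Qed.

Lemma exch_term_out K x a : tbounded K x -> (0 < K)%N ->
  ~~ (- K%:Z < a < K%:Z + r) -> exch_term a x = 0.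
Proof.
move=> xK K0 aK; rewrite /exch_term.
have [al|al] := leP a (- K%:Z).
  apply: add_scale0.
    by rewrite liftC (lift_rmul_low i xK al); exact: lin_map0 (lift_lin j _).
  by rewrite -liftC (lift_rmul_low j xK al); exact: lin_map0 (lift_lin i _).
have ah : K%:Z <= a - r by lia.
apply: add_scale0.
  by rewrite (lift_del_high j xK ah K0); exact: lin_map0 (lift_lin i _).
by rewrite (lift_del_high i xK ah K0); exact: lin_map0 (lift_lin j _).
Qed.

Lemma exchange_seqE K x (s : seq int) : tbounded K x -> (0 < K)%N -> uniq s ->
  (forall a, - K%:Z < a < K%:Z + r -> a \in s) ->
  exchange x = \sum_(a <- s) exch_term a x.
Proof.
move=> xK K0 us sK.
apply: (lin_map_supp (Y := fun x => \sum_(a <- s) exch_term a x) exchange_lin).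
  by apply: lin_map_bigsum => a _; exact: exch_term_lin.
move=> b bx; rewrite /exchange lin_extU [RHS](fsbig_seq _ _ us).
apply/esym/fsbig_widen => // a /= [_ /= aS].
have bK : tbounded K (<< b >> : T).
  by move=> b'; rewrite msuppU oner_eq0 inE => /eqP ->; apply: xK.
apply: (exch_term_out bK K0); apply/negP => /sK; exact: aS.
Qed.

Let pair_term (m : int) (x : T) (a : int) : T :=
  alt R a *: lift i (rmul_var a) (lift j (rmul_var (2 * m + 1 + r - a)) x).

Lemma coprod_lift_pair m p q a c (x : T) :
  coprod (e m) (lift p (rmul_var a) (lift q (del_var c) x)) =
  lift p (rmul_var a) (lift q (del_var c) (coprod (e m) x)) +
  alt R c *: lift p (rmul_var a) (lift q (rmul_var (2 * m + 1 - c)) x).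
Proof.
etransitivity; first exact: coprod_lift_rmul.
etransitivity; first exact: (congr1 (lift p (rmul_var a)) (coprod_lift_del m q c x)).
etransitivity; first exact: (lin_mapD (lift_lin p (rmul_var a))).
exact: (congr1 (+%R _) (lin_mapZ (lift_lin p (rmul_var a)) _ _)).
Qed.

Lemma coprod_exch_term m a (x : T) :
  coprod (e m) (exch_term a x) = exch_term a (coprod (e m) x) +
    alt R r *: (pair_term m x a - pair_term m x (2 * m + 1 + r - a)).
Proof.
have altN z : alt R (- z) = alt R z by rewrite /alt abszN.
have alt_sq z : alt R z * alt R z = 1.
  by rewrite /alt -exprMn mulrNN mulr1 expr1n.
(* The odd summand 1 yields the minus sign, hence the antisymmetry. The factor [alt R r] in the
   exchange operator is chosen so that its two halves match here. *)
have alt_r : alt R (2 * m + 1 + r - a) = - (alt R r * alt R a).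
  rewrite !altD altN (_ : 2 * m = m + m); last by ring.
  by rewrite altD alt_sq {1}/alt expr1 mul1r mulN1r mulNr.
pose c := 2 * m + 1 + r - a.
have cE : 2 * m + 1 - (a - r) = c by rewrite /c; ring.
have E1 := coprod_lift_pair m i j a (a - r) x.
have E2 := coprod_lift_pair m j i a (a - r) x.
rewrite cE in E1 E2.
have -> : pair_term m x c = alt R c *: lift i (rmul_var c) (lift j (rmul_var a) x).
  by rewrite /pair_term subKr.
have E3 : coprod (e m) (lift j (rmul_var a) (lift i (del_var (a - r)) x)) =
    lift j (rmul_var a) (lift i (del_var (a - r)) (coprod (e m) x)) +
    alt R (a - r) *: lift i (rmul_var c) (lift j (rmul_var a) x).
  have E4 := esym (liftC (rmul_var c) (rmul_var a) x).
  exact: (etrans E2 (congr1 (fun u => lift j (rmul_var a)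
    (lift i (del_var (a - r)) (coprod (e m) x)) + alt R (a - r) *: u) E4)).
have altE : alt R (a - r) = alt R a * alt R r by rewrite altD altN.
exact: (exchange_signs (@coprod_lin R k (e m)) E1 E3 (alt_sq r) altE alt_r).
Qed.

Lemma exchange_coprod m (x : T) :
  exchange (coprod (e m) x) = coprod (e m) (exchange x).
Proof.
have [K1 xK1] := tbounded_exists x.
have [K2 xK2] := tbounded_exists (coprod (e m) x).
(* M is large enough for the interval from - M to s + M, which is stable under a -> s - a, to
   contain all a whose term is nonzero on either vector. *)
pose K := (K1 + K2).+1; pose M := (K + absz (2 * m + 1 + r)%R + absz r)%N.
pose s := 2 * m + 1 + r.
pose l := int_range (- M%:Z) (absz (s + 2 * M%:Z + 1)%R).
have lK a : - K%:Z < a < K%:Z + r -> a \in l.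
  by rewrite mem_int_range /s /M; lia.
rewrite (@exchange_seqE K _ l) ?int_range_uniq //; last by apply: tbounded_leq xK2; rewrite /K; lia.
rewrite (@exchange_seqE K x l) ?int_range_uniq //; last by apply: tbounded_leq xK1; rewrite /K; lia.
rewrite (lin_map_sum (@coprod_lin R k (e m))).
transitivity (\sum_(a <- l) (exch_term a (coprod (e m) x) +
    alt R r *: (pair_term m x a - pair_term m x (s - a)))); last first.
  by apply: eq_bigr => a _; rewrite coprod_exch_term.
by apply/esym/reflected_sum; rewrite /s /M; lia.
Qed.

Lemma lift_tmon0 p (A : F -> F) (lam : 'I_k -> int) :
  A << vmon (- lam p) >> = 0 -> lift p A (tmon R lam) = 0.
Proof.
by move=> AE; rewrite liftU ffunE AE (lin_map0 (at_slot_lin _ _)).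
Qed.

Lemma lift_tmon1 p (A : F -> F) (lam : 'I_k -> int) m :
  A << vmon (- lam p) >> = << vmon (- m) >> ->
  lift p A (tmon R lam) = tmon R (fun q => if q == p then m else lam q).
Proof.
move=> AE; rewrite -[RHS]scale1r; apply: lift_tmon.
by rewrite AE scale1r.
Qed.

(** Adding a in slot i requires a > - lam_i, and deleting a - r in slot j requires a <= 1 - lam_i,
    which leaves a = 1 - lam_i. With i and j interchanged the two requirements are contradictory, as
    lam_j < lam_i. *)
Lemma exchange_tmon (lam : 'I_k -> int) :
  r = lam j + 1 - lam i -> lam j < lam i ->
  exchange (tmon R lam) =
    tmon R (fun q => if q == i then lam i - 1 else if q == j then lam j + 1 else lam q).
Proof.
move=> rE ltji; rewrite {1}/tmon /exchange lin_extU -/(tmon R lam).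
have delE q a : - lam q < a -> lift q (del_var a) (tmon R lam) = 0.
  move=> qa; apply: lift_tmon0; rewrite del_varU occurs_vmon ifF //.
  by apply/negbTE; lia.
have rmulE q a : a <= - lam q -> lift q (rmul_var a) (tmon R lam) = 0.
  by move=> qa; apply: lift_tmon0; rewrite rmul_varU occurs_vmon qa.
have second a : lift j (rmul_var a) (lift i (del_var (a - r)) (tmon R lam)) = 0.
  have [aj|ja] := leP a (- lam j).
    by rewrite -liftC rmulE // (lin_map0 (lift_lin _ _)).
  by rewrite delE ?(lin_map0 (lift_lin _ _)) //; lia.
have termE a : exch_term a (tmon R lam) =
    lift i (rmul_var a) (lift j (del_var (a - r)) (tmon R lam)).
  exact: (add_scale0r _ _ (second a)).
transitivity (exch_term (1 - lam i) (tmon R lam)).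
  transitivity (\sum_(a <- [:: 1 - lam i]) exch_term a (tmon R lam)); last exact: big_seq1.
  rewrite [RHS](fsbig_seq _ _ (erefl : uniq [:: 1 - lam i])).
  apply/esym/fsbig_widen => // a /= [_ /= /negP].
  rewrite inE => ai; rewrite termE.
  have [al|al] := leP a (- lam i).
    apply: etrans (liftC _ _ _) _; rewrite (rmulE i a al).
    exact: lin_map0 (lift_lin j _).
  rewrite (delE j (a - r)); last by lia.
  exact: lin_map0 (lift_lin i _).
rewrite termE.
have -> : 1 - lam i - r = - lam j by lia.
rewrite (@lift_tmon1 j (del_var (- lam j)) lam (lam j + 1)); last first.
  by rewrite del_var_vmon -opprB opprK addrC.
rewrite (@lift_tmon1 i _ _ (lam i - 1)).
  by congr (tmon R _); apply: funext => q; case: eqP.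
rewrite (negbTE ij) addrC rmul_var_vmon.
by rewrite opprB addrC.
Qed.

(** Now each half asks for an a in an empty interval: for the first, - lam_i < a <= r - lam_j. *)
Lemma exchange_tmon0 (lam : 'I_k -> int) :
  r <= lam j - lam i -> r <= lam i - lam j -> exchange (tmon R lam) = 0.
Proof.
move=> r1 r2; rewrite {1}/tmon /exchange lin_extU -/(tmon R lam).
rewrite fsbig1 // => a _; apply: add_scale0.
  have [al|al] := leP a (- lam i).
    apply: etrans (liftC _ _ _) _.
    rewrite (lift_tmon0 (p := i)) ?rmul_varU ?occurs_vmon ?al //.
    exact: lin_map0 (lift_lin j _).
  rewrite (lift_tmon0 (p := j)).
    exact: lin_map0 (lift_lin i _).
  by rewrite del_varU occurs_vmon ifF //; apply/negbTE; lia.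
have [al|al] := leP a (- lam j).
  apply: etrans (esym (liftC _ _ _)) _.
  rewrite (lift_tmon0 (p := j)) ?rmul_varU ?occurs_vmon ?al //.
  exact: lin_map0 (lift_lin i _).
rewrite (lift_tmon0 (p := i)).
  exact: lin_map0 (lift_lin j _).
by rewrite del_varU occurs_vmon ifF //; apply/negbTE; lia.
Qed.

End Exchange.

(** * Counting boxes *)

Section Counting.
Local Open Scope nat_scope.
Variable k : nat.
Implicit Types (lam : 'I_k -> nat) (N K : nat) (i j : 'I_k).

Definition row lam (t : nat) : nat := #|[set p | t < lam p]|.
Definition box_size lam K : nat := \prod_(t < K) (row lam t).+1.

Definition splittable lam N i j : Prop :=
  [/\ lam i = N, forall p, lam p <= N, lam j + 2 <= N &
      forall p, lam p + 2 <= N -> lam p <= lam j].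

(* The lengths of lam' and lam''. *)
Definition drop_top lam N p := if lam p == N then N - 2 else lam p.
Definition balance lam N i j p :=
  if p == i then N.-1 else if p == j then (lam j).+1 else lam p.

Lemma box_sizeE lam K : box_size lam K = \prod_(0 <= t < K) (row lam t).+1.
Proof. by rewrite big_mkord. Qed.

(** Let r and A be the numbers of slots longer than N - 1 and N - 2. No length lies strictly between
    lam_j and N - 1, so A slots are longer than lam_j. Lowering turns (r, A) in rows N - 1 and N - 2
    into (0, A - r); balancing turns r into r - 1 and, in row lam_j, A into A + 1. The claim reduces
    to (r + 1)(A + 1) = (A - r + 1) + r (A + 2). *)
Lemma box_size_split lam N i j K : splittable lam N i j -> N <= K ->
  box_size lam K = box_size (drop_top lam N) K + box_size (balance lam N i j) K.
Proof.
move=> [iN lamN jN jmax] NK.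
have ij : i != j by apply: contra_eqN iN => /eqP ->; lia.
have N2 : 2 <= N by lia.
set lam1 := drop_top lam N; set lam2 := balance lam N i j.
pose r := row lam N.-1; pose A := row lam (N - 2).
have row_b : row lam (lam j) = A.
  apply: eq_card => p; rewrite !inE; have := jmax p; have := lamN p; lia.
have r_gt0 : 0 < r by rewrite /r /row card_gt0; apply/set0Pn; exists i; rewrite inE; lia.
have rA : r <= A by apply: subset_leq_card; apply/fintype.subsetP => p; rewrite !inE; lia.
have lam1_top : row lam1 N.-1 = 0.
  apply/eqP; rewrite cards_eq0; apply/eqP/setP => p; rewrite !inE /lam1 /drop_top.
  by have := lamN p; case: eqP; lia.
have lam1_next : row lam1 (N - 2) = A - r.
  have -> : A - r = #|[set p | N - 2 < lam p] :\: [set p | N.-1 < lam p]|.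
    rewrite cardsD (finset.setIidPr _) //; apply/fintype.subsetP => p; rewrite !inE; lia.
  apply: eq_card => p; rewrite !inE /lam1 /drop_top; have := lamN p; case: eqP; lia.
have lam1_other t : t != N.-1 -> t != N - 2 -> row lam1 t = row lam t.
  move=> t1 t2; apply: eq_card => p; rewrite !inE /lam1 /drop_top.
  by case: eqP => [->|//]; lia.
have lam2_top : row lam2 N.-1 = r.-1.
  have -> : r.-1 = #|[set p | N.-1 < lam p] :\ i|.
    by rewrite /r /row (cardsD1 i [set p | _]) inE iN; have -> : N.-1 < N by lia.
  apply: eq_card => p; rewrite !inE /lam2 /balance; have := lamN p.
  by case: eqP => [->|_]; [lia | case: eqP => [->|_]; lia].
have lam2_b : row lam2 (lam j) = A.+1.
  rewrite -row_b /row; have -> : #|[set p | lam j < lam p]|.+1 = #|j |: [set p | lam j < lam p]|.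
    by rewrite cardsU1 inE ltnn.
  apply: eq_card => p; rewrite !inE /lam2 /balance.
  have [->|pi] := eqVneq p i; first by rewrite (negbTE ij); lia.
  by have [->|pj] := eqVneq p j; rewrite ?ltnSn.
have lam2_other t : t != N.-1 -> t != lam j -> row lam2 t = row lam t.
  move=> t1 t2; apply: eq_card => p; rewrite !inE /lam2 /balance.
  by case: eqP => [->|_]; [lia | case: eqP => [->|_ //]; lia].
have split1 l : box_size l K = (row l N.-1).+1 * (row l (N - 2)).+1 *
    \prod_(t < K | (t != N.-1 :> nat) && (t != N - 2 :> nat)) (row l t).+1.
  have K1 : N.-1 < K by lia. have K2 : N - 2 < K by lia.
  rewrite /box_size (bigD1 (Ordinal K1)) //= (bigD1 (Ordinal K2)) /=; last first.
    by apply/eqP => /(congr1 val) /=; lia.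
  rewrite mulnA; congr (_ * _); exact: eq_bigl.
rewrite !split1 lam1_top lam1_next lam2_top -/r -/A prednK //.
(* For lam_j = N - 2 the rows N - 2 and lam_j coincide, and one factor fewer has to be split off. *)
have [bN|bN] := eqVneq (lam j) (N - 2).
  have -> : row lam2 (N - 2) = A.+1 by rewrite -bN.
  set P := \prod_(t < K | _) (row lam t).+1.
  have -> : \prod_(t < K | (t != N.-1 :> nat) && (t != N - 2 :> nat)) (row lam1 t).+1 = P.
    by apply: eq_bigr => t /andP[t1 t2]; rewrite lam1_other.
  have -> : \prod_(t < K | (t != N.-1 :> nat) && (t != N - 2 :> nat)) (row lam2 t).+1 = P.
    by apply: eq_bigr => t /andP[t1 t2]; rewrite lam2_other // bN.
  by rewrite mul1n -mulnDl; congr (_ * _); nia.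
have -> : row lam2 (N - 2) = A by rewrite lam2_other //; lia.
have bK : lam j < K by lia.
have split2 l : \prod_(t < K | (t != N.-1 :> nat) && (t != N - 2 :> nat)) (row l t).+1 =
    (row l (lam j)).+1 * \prod_(t < K | [&& t != N.-1 :> nat, t != N - 2 :> nat
      & t != lam j :> nat]) (row l t).+1.
  rewrite (bigD1 (Ordinal bK)) /=; last by lia.
  congr (_ * _); by apply: eq_bigl => t; rewrite andbA.
rewrite !split2 row_b lam2_b lam1_other ?row_b //; last by lia.
set P := \prod_(t < K | _) (row lam t).+1.
have -> : \prod_(t < K | [&& t != N.-1 :> nat, t != N - 2 :> nat
      & t != lam j :> nat]) (row lam1 t).+1 = P.
  by apply: eq_bigr => t /and3P[t1 t2 _]; rewrite lam1_other.
have -> : \prod_(t < K | [&& t != N.-1 :> nat, t != N - 2 :> nat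
      & t != lam j :> nat]) (row lam2 t).+1 = P.
  by apply: eq_bigr => t /and3P[t1 _ t3]; rewrite lam2_other.
rewrite mul1n !mulnA -mulnDl; congr (_ * _).
have -> : A = r + (A - r) by rewrite subnKC.
by rewrite addKn; nia.
Qed.

(** Balancing preserves the sum of the lengths, so the induction needs a strictly convex measure. *)
Definition energy lam : nat := \sum_p 2 ^ (lam p).

Lemma energy_drop_top lam N i j : splittable lam N i j ->
  energy (drop_top lam N) < energy lam.
Proof.
move=> [iN lamN jN _]; rewrite /energy (bigD1 i) //= [X in _ < X](bigD1 i) //=.
rewrite {1}/drop_top iN eqxx -addSn leq_add //; first by rewrite ltn_exp2l //; lia.
by apply: leq_sum => p _; rewrite leq_exp2l // /drop_top; case: eqP; lia.
Qed.

Lemma energy_balance lam N i j : splittable lam N i j ->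
  energy (balance lam N i j) < energy lam.
Proof.
move=> [iN lamN jN _]; have ij : j != i by apply: contra_eqN iN => /eqP <-; lia.
rewrite /energy (bigD1 i) //= (bigD1 j) //= [X in _ < X](bigD1 i) //=.
rewrite [X in _ < _ + X](bigD1 j) //= !addnA /balance eqxx (negbTE ij) eqxx iN.
rewrite -addSn leq_add //; last first.
  by apply: leq_sum => p /andP[/negbTE -> /negbTE ->].
have : 2 ^ (lam j).+1 <= 2 ^ N.-1 by rewrite leq_exp2l //; lia.
have : 2 ^ N = 2 * 2 ^ N.-1 by rewrite -expnS; congr (2 ^ _); lia.
have : 0 < 2 ^ lam j by rewrite expn_gt0.
rewrite expnS; lia.
Qed.

Lemma sum_drop_top lam N : \sum_p drop_top lam N p <= \sum_p lam p.
Proof. by apply: leq_sum => p _; rewrite /drop_top; case: eqP; lia. Qed.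

Lemma sum_balance lam N i j : splittable lam N i j ->
  \sum_p balance lam N i j p = \sum_p lam p.
Proof.
move=> [iN lamN jN _]; have ij : j != i by apply: contra_eqN iN => /eqP <-; lia.
rewrite (bigD1 i) //= (bigD1 j) //= [RHS](bigD1 i) //= [X in _ = _ + X](bigD1 j) //=.
rewrite !addnA /balance eqxx (negbTE ij) eqxx iN; congr (_ + _); first by lia.
by apply: eq_bigr => p /andP[/negbTE -> /negbTE ->].
Qed.

Lemma splittable_exists lam : \sum_p lam p <= k -> (exists p, 2 <= lam p) ->
  exists N i j, splittable lam N i j.
Proof.
move=> sk [p0 p0_2].
case: (@arg_maxnP _ p0 xpredT lam isT) => i _ imax.
pose N := lam i; have lamN p : lam p <= N by apply: imax.
have N2 : 2 <= N by apply: leq_trans p0_2 (lamN p0).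
have [q qN] : exists q, lam q + 2 <= N.
  apply/existsP; rewrite -[X in is_true X]negbK; apply/negP => /existsPn H.
  have : \sum_(p : 'I_k) 1 < \sum_p lam p.
    rewrite (bigD1 i) //= [X in _ < X](bigD1 i) //= -addSn leq_add //.
    by apply: leq_sum => p _; have := H p; lia.
  by rewrite sum1_card card_ord ltnNge sk.
case: (@arg_maxnP _ q (fun p => lam p + 2 <= N) lam qN) => j jN jmax.
by exists N, i, j; split.
Qed.

End Counting.

(** * Exactness *)

Lemma nilpotent_free (K : fieldType) (V : lmodType K) (f : V -> V) r x :
  lin_map f -> iter r f x != 0 -> iter r.+1 f x = 0 ->
  free_fam (fun t : 'I_r.+1 => iter t f x).
Proof.
move=> lf fr fr1 c E.
have lin_iter s : lin_map (iter s f).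
  by elim: s => [//|s IH] a y z; rewrite /= IH lf.
have big0 s : (r < s)%N -> iter s f x = 0.
  move=> rs; rewrite -(subnK rs) iterD fr1; exact: lin_map0.
suff H n (t : 'I_r.+1) : (t < n)%N -> c t = 0 by move=> t; apply: (H t.+1).
elim: n t => // n IH t; rewrite ltnS => tn.
have := congr1 (iter (r - t) f) E.
rewrite (lin_map0 (lin_iter _)) (lin_map_comb (lin_iter _)) (bigD1 t) //= big1.
  rewrite -iterD subnK; last by rewrite -ltnS.
  by rewrite addr0 => /eqP; rewrite scaler_eq0 (negbTE fr) orbF => /eqP.
move=> s st; have [lt|gt|eq] := ltngtP s t.
- by rewrite IH ?scale0r //; apply: leq_trans lt tn.
- by rewrite -iterD big0 ?scaler0 //; have := ltn_ord t; lia.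
- by case/eqP: st; apply: val_inj.
Qed.

Section CyclicImage.
Variables (R : realType) (k k' : nat).
Local Notation T := (tensF R k).
Local Notation T' := (tensF R k').
Variables (X : T -> T') (w : T) (w' : T').
Hypothesis linX : lin_map X.
Hypothesis X_e : forall m x, m <= 0 -> X (coprod (e m) x) = coprod (e m) (X x).
Hypothesis Xw : X w = w'.

Lemma cyc_map x : cyc w x -> cyc w' (X x).
Proof.
apply: (cyc_min (P := fun x => cyc w' (X x))).
- split=> [|a y z Wy Wz]; first by rewrite (lin_map0 linX); exact: (cyc_subspace w').1.
  by rewrite linX; apply: (cyc_subspace w').2.
- by move=> m y m0 Wy; rewrite X_e //; apply: cyc_e.
- by rewrite Xw; apply: cyc_self.
Qed.

Lemma cyc_surj y : cyc w' y -> exists2 x, cyc w x & X x = y.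
Proof.
apply: (cyc_min (P := fun y => exists2 x, cyc w x & X x = y)).
- split; first by exists 0; [exact: (cyc_subspace w).1 | exact: lin_map0].
  move=> a _ _ [x1 W1 <-] [x2 W2 <-]; exists (a *: x1 + x2); last exact: linX.
  exact: (cyc_subspace w).2.
- by move=> m _ m0 [x Wx <-]; exists (coprod (e m) x); [exact: cyc_e | exact: X_e].
- by exists w => //; exact: cyc_self.
Qed.

End CyclicImage.

(** * Padding by empty slots and permuting slots *)

Section Reindex.
Variables (R : realType) (k k' : nat) (sigma : 'I_k -> 'I_k').
Hypothesis sigma_inj : injective sigma.
Local Notation T := (tensF R k).
Local Notation T' := (tensF R k').

(* The slots outside the image of sigma have length 0, so e_m with m <= 0
   vanishes there. *)
Definition along (A : Type) (b : 'I_k -> A) (a0 : A) (r : 'I_k') : A :=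
  if [pick p | sigma p == r] is Some p then b p else a0.

Lemma along_in (A : Type) (b : 'I_k -> A) a0 p : along b a0 (sigma p) = b p.
Proof.
rewrite /along; case: pickP => [q /eqP/sigma_inj -> //|/(_ p)].
by rewrite eqxx.
Qed.

Lemma along_out (A : Type) (b : 'I_k -> A) a0 r :
  r \notin codom sigma -> along b a0 r = a0.
Proof.
rewrite /along; case: pickP => // p /eqP <-.
by rewrite codom_f.
Qed.

Lemma along_map (A A' : Type) (f : A -> A') (b : 'I_k -> A) a0 r :
  f (along b a0 r) = along (f \o b) (f a0) r.
Proof. by rewrite /along; case: pickP. Qed.

Definition mon_along (b : tmonomial k) : tmonomial k' :=
  [ffun r => along b (vmon 0) r].

Definition reindex : T -> T' := lin_ext (fun b => << mon_along b >>).

Lemma reindex_lin : lin_map reindex.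
Proof. exact: lin_ext_lin. Qed.

Lemma reindexU b : reindex << b >> = << mon_along b >>.
Proof. exact: lin_extU. Qed.

Lemma sum_along (V : zmodType) (G : 'I_k' -> V) :
  (forall r, r \notin codom sigma -> G r = 0) -> \sum_r G r = \sum_p G (sigma p).
Proof.
move=> G0; rewrite (bigID (mem (codom sigma))) /= [X in _ + X]big1 // addr0.
rewrite -(big_map sigma xpredT) /= [RHS]big_uniq /=; last first.
  by rewrite map_inj_uniq // /index_enum -enumT enum_uniq.
apply: eq_bigl => r; rewrite codomE; congr (_ \in map _ _).
by rewrite enumT.
Qed.

(** On v(0) the operator e_m would have mode index m - 1, which is negative for m <= 0; hence the
    added slots contribute nothing. *)
Lemma reindex_e m (x : T) : m <= 0 ->
  reindex (coprod (e m) x) = coprod (e m) (reindex x).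
Proof.
move=> m0; apply: (lin_map_eq (X := fun x => reindex (coprod (e m) x))
  (Y := fun x => coprod (e m) (reindex x))).
- exact: (lin_map_comp reindex_lin (@coprod_lin R k (e m))).
- exact: (lin_map_comp (@coprod_lin R k' (e m)) reindex_lin).
move=> b; rewrite reindexU !coprodE (lin_map_sum reindex_lin).
rewrite [RHS]sum_along => [|r rs]; last first.
  rewrite liftU ffunE along_out // (@e_slot_mode R 0 m (vmon 0)); last first.
    by move=> j; rewrite oppr0 occurs_vmon.
  rewrite ifF; last by lia.
  exact: lin_map0 (at_slot_lin _ _).
apply: eq_bigr => p _; rewrite !liftU ffunE along_in.
apply: (lin_map_eq (X := fun y => reindex (at_slot b p y))).
- exact: (lin_map_comp reindex_lin (@at_slot_lin R k b p)).
- exact: at_slot_lin.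
move=> S; rewrite !at_slotU reindexU; congr (<< _ >>); apply/ffunP => r.
rewrite !ffunE; have [->|rp] := eqVneq r (sigma p).
  by rewrite along_in ffunE eqxx.
rewrite /along; case: pickP => // q /eqP qr; rewrite ffunE ifF //.
by apply/negbTE; apply: contraNneq rp => <-; rewrite qr.
Qed.

Lemma reindex_tmon (lam : 'I_k -> int) :
  reindex (tmon R lam) = tmon R (along lam 0).
Proof.
rewrite reindexU; congr (<< _ >>); apply/ffunP => r; rewrite !ffunE.
rewrite (along_map (fun t => vmon (- t))) /along.
by case: pickP => [p _|_]; rewrite ?ffunE // oppr0.
Qed.

Lemma row_along (lam : 'I_k -> nat) t : row (along lam 0%N) t = row lam t.
Proof.
rewrite /row -(card_imset _ sigma_inj); apply: eq_card => r; rewrite !inE.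
apply/idP/imsetP => [|[p]]; last by rewrite inE => tp ->; rewrite along_in.
rewrite /along; case: pickP => // p /eqP <- tp.
by exists p; rewrite ?inE.
Qed.

End Reindex.

Section Exactness.
Variable R : realType.
Local Notation C := R[i].

Definition intf k (lam : 'I_k -> nat) (p : 'I_k) : int := (lam p)%:Z.
Definition Wn k (lam : 'I_k -> nat) : tensF R k -> Prop := W (intf lam).

Lemma Wn_drop_top k (lam : 'I_k -> nat) N x : (2 <= N)%N ->
  (forall p, lam p <= N)%N -> Wn (drop_top lam N) x -> Wn lam x.
Proof.
move=> N2 lamN; apply: cyc_sub; have := @lower_top R k (intf lam) N%:Z; rewrite /W.
have -> : tmon R (fun q => if intf lam q == N%:Z then intf lam q - 2 else intf lam q) =
    tmon R (intf (drop_top lam N)).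
  congr (tmon R _); apply: funext => q; rewrite /intf /drop_top.
  by rewrite eqz_nat; case: eqP => // ->; lia.
by apply; [lia | move=> p; rewrite lez_nat].
Qed.

Section Step.
Variables (k : nat) (lam : 'I_k -> nat) (N : nat) (i j : 'I_k).
Hypothesis H : splittable lam N i j.
Let X : tensF R k -> tensF R k := exchange i j ((lam j)%:Z + 1 - (lam i)%:Z).

Let linX : lin_map X. Proof. exact: exchange_lin. Qed.
Let X_e m x : X (coprod (e m) x) = coprod (e m) (X x).
Proof. by apply: exchange_coprod; case: H => iN _ jN _; apply: contra_eqN iN => /eqP ->; lia. Qed.

Let ij : i != j.
Proof. by case: H => iN _ jN _; apply: contra_eqN iN => /eqP ->; lia. Qed.

Lemma Wn_drop_top_split x : Wn (drop_top lam N) x -> Wn lam x.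
Proof. by case: H => iN lamN jN _; apply: Wn_drop_top => //; lia. Qed.

Lemma exchange_drop_top x : Wn (drop_top lam N) x -> X x = 0.
Proof.
case: H => iN lamN jN _.
apply: (cyc_min (P := fun x => X x = 0)).
- split=> [|a y z Xy Xz]; first exact: lin_map0.
  by rewrite linX Xy Xz scaler0 addr0.
- move=> m y _ Xy; rewrite X_e Xy.
  exact: lin_map0 (@coprod_lin R k (e m)).
- have jN' : (lam j == N) = false by apply/negbTE; lia.
  by apply: exchange_tmon0 => //; rewrite /intf /drop_top jN' iN eqxx; lia.
Qed.

Lemma exchange_tmon_balance : X (tmon R (intf lam)) = tmon R (intf (balance lam N i j)).
Proof.
case: H => iN lamN jN _; rewrite /X exchange_tmon //; last by rewrite /intf; lia.
congr (tmon R _); apply: funext => q; rewrite /intf /balance.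
by do 2?[case: eqP => // _]; lia.
Qed.

Lemma exchange_surj y : Wn (balance lam N i j) y -> exists2 x, Wn lam x & X x = y.
Proof.
exact: (cyc_surj linX (fun m y _ => X_e m y) exchange_tmon_balance).
Qed.

Lemma exchange_lift n (v : 'I_n -> tensF R k) :
  (forall t, Wn (balance lam N i j) (v t)) ->
  exists v' : 'I_n -> tensF R k, (forall t, Wn lam (v' t)) /\ X \o v' = v.
Proof.
move=> Wv.
have /boolp.choice[v' v'E] : forall t, exists x, Wn lam x /\ X x = v t.
  by move=> t; have [x] := exchange_surj (Wv t); exists x.
exists v'; split=> [t|]; first by case: (v'E t).
by apply: funext => t; case: (v'E t).
Qed.

End Step.

Lemma row0_le1 k (lam : 'I_k -> nat) K : (forall p, lam p <= 1)%N ->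
  (forall p, lam p <= K)%N -> box_size lam K = (row lam 0).+1.
Proof.
move=> lam1 lamK; rewrite box_sizeE; case: K lamK => [|K] lamK.
  rewrite big_nil /row; congr _.+1; apply/esym/eqP; rewrite cards_eq0.
  by apply/eqP/setP => p; rewrite !inE; have := lamK p; lia.
rewrite big_nat_recl // big1_seq ?muln1 // => t _; congr _.+1.
by apply/eqP; rewrite cards_eq0; apply/eqP/setP => p; rewrite !inE; have := lam1 p; lia.
Qed.

(** Here [f] is e_0 restricted to the r slots of length 1. Its r-th power does not kill w and the
    next one does, so w, f w, ..., f^r w are independent. *)
Lemma Wn_lower_base k (lam : 'I_k -> nat) : (forall p, lam p <= 1)%N ->
  exists v : 'I_(row lam 0).+1 -> tensF R k, (forall t, Wn lam (v t)) /\ free_fam v.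
Proof.
move=> lam1; pose f := top_sum R (intf lam) 1.
pose w := tmon R (intf lam).
have iterE s : iter s f w = (top_sum R (intf lam) 1 ^+ s) w.
  by elim: s => [|s IH]; rewrite ?expr0 // exprS bico_mulE -IH.
have rE : #|top_slots (intf lam) 1| = row lam 0.
  by apply: eq_card => p; rewrite !inE /intf; have := lam1 p; lia.
exists (fun t => iter t f w); split=> [t|].
  by rewrite iterE; apply: W_top_sum => // p; rewrite /intf; have := lam1 p; lia.
apply: nilpotent_free; first exact: bico_lin.
  rewrite iterE -rE; have [c c0 ->] := top_sum_exp R (intf lam) 1.
  by rewrite scaler_eq0 negb_or c0 tmon_neq0.
by rewrite iterE -rE top_sum_nilp.
Qed.

(* If the lengths add up to at most k and one of them is at least 2, then some
   slot has length 0; hence lam is splittable. *)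
Lemma Wn_lower_wide k (lam : 'I_k -> nat) K : (\sum_p lam p <= k)%N ->
  (forall p, lam p <= K)%N ->
  exists v : 'I_(box_size lam K) -> tensF R k, (forall t, Wn lam (v t)) /\ free_fam v.
Proof.
have [n] := ubnP (energy lam); elim: n lam => // n IH lam En sk lamK.
have [[p0 p02]|lam1] := pselect (exists p, 2 <= lam p)%N; last first.
  have {}lam1 p : (lam p <= 1)%N.
    by rewrite leqNgt; apply/negP => p2; apply: lam1; exists p.
  rewrite row0_le1 //; exact: Wn_lower_base.
have [N [i [j H]]] := splittable_exists sk (ex_intro _ p0 p02).
have NK : (N <= K)%N by case: H => <- _ _ _.
have [||p|u [Wu fu]] := IH (drop_top lam N).
- by apply: leq_trans (energy_drop_top H) _; rewrite -ltnS.
- exact: leq_trans (sum_drop_top _ _) sk.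
- by rewrite /drop_top; case: eqP => _; have := lamK p; lia.
have [||p|v [Wv fv]] := IH (balance lam N i j).
- by apply: leq_trans (energy_balance H) _; rewrite -ltnS.
- by rewrite (sum_balance H).
- case: H => iN lamN jN _; rewrite /balance; case: eqP => _; first lia.
  by case: eqP => _; have := lamK p; lia.
have [v' [Wv' Xv']] := exchange_lift H Wv.
rewrite (box_size_split H NK); exists (fam_cat u v'); split.
  exact: (@fam_cat_all _ _ (Wn lam) _ _ u v' (fun t => Wn_drop_top_split H (Wu t)) Wv').
have fv' : free_fam (exchange i j ((lam j)%:Z + 1 - (lam i)%:Z) \o v') by rewrite Xv'.
exact: (free_fam_lift (@exchange_lin R k i j _) fu
  (fun t => exchange_drop_top H (Wu t)) fv').
Qed.

(** As many empty slots are added as there are units of length, so that [Wn_lower_wide] applies. Its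
    free family is pulled back along the surjection from W(lam) to the padded space, and empty slots
    do not change the box. *)
Lemma Wn_lower_bound k (lam : 'I_k -> nat) K : (forall p, lam p <= K)%N ->
  exists v : 'I_(box_size lam K) -> tensF R k, (forall t, Wn lam (v t)) /\ free_fam v.
Proof.
move=> lamK; pose q := (\sum_p lam p)%N.
pose sigma : 'I_k -> 'I_(k + q) := lshift q.
have sigma_inj : injective sigma by exact: lshift_inj.
pose lam' := along sigma lam 0%N.
have sk : (\sum_p lam' p <= k + q)%N.
  rewrite big_split_ord /= [X in (_ + X)%N]big1 ?addn0 => [|t _]; last first.
    rewrite /lam' along_out //; apply/codomP => -[p /(congr1 val) /=].
    by have := ltn_ord p; lia.
  rewrite (eq_bigr lam) => [|t _]; first by rewrite -/q leq_addl.
  exact: along_in.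
have lam'K p : (lam' p <= K)%N by rewrite /lam' /along; case: pickP.
have [v [Wv fv]] := Wn_lower_wide sk lam'K.
have boxE : box_size lam' K = box_size lam K.
  by apply: eq_bigr => t _; rewrite row_along.
have X_tmon : reindex sigma (tmon R (intf lam)) = tmon R (intf lam').
  rewrite reindex_tmon; congr (tmon R _); apply: funext => r.
  by rewrite /intf /lam' /along; case: pickP.
have /boolp.choice[v' v'E] : forall t, exists x, Wn lam x /\ reindex sigma x = v t.
  move=> t; have [x Wx Xx] := cyc_surj (reindex_lin _)
    (fun m x => @reindex_e R _ _ sigma sigma_inj m x) X_tmon (Wv t).
  by exists x.
rewrite -boxE; exists v'; split=> [t|c E]; first by case: (v'E t).
apply: fv; have := congr1 (reindex sigma) E.
rewrite (lin_map0 (reindex_lin sigma)) (lin_map_comb (reindex_lin sigma)) => E'.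
by rewrite -[RHS]E'; apply: eq_bigr => t _; case: (v'E t) => _ ->.
Qed.

(** The lower bounds for lam' and lam'' add up to the upper bound for lam, which leaves no room for
    a larger kernel. *)
Lemma exchange_ker k (lam : 'I_k -> nat) N i j (x : tensF R k) :
  splittable lam N i j -> Wn lam x ->
  exchange i j ((lam j)%:Z + 1 - (lam i)%:Z) x = 0 -> Wn (drop_top lam N) x.
Proof.
move=> H; have [iN lamN jN _] := H.
have [u [Wu fu]] := @Wn_lower_bound k (drop_top lam N) N
  (fun p => ltac:(rewrite /drop_top; case: eqP => _; have := lamN p; lia)).
have [v [Wv fv]] := @Wn_lower_bound k (balance lam N i j) N
  (fun p => ltac:(rewrite /balance; case: eqP => _; [lia | case: eqP => _; have := lamN p; lia])).
have [v' [Wv' Xv']] := exchange_lift H Wv.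
have fv' : free_fam (exchange i j ((lam j)%:Z + 1 - (lam i)%:Z) \o v') by rewrite Xv'.
have Dmn : (box_size lam N <= box_size (drop_top lam N) N + box_size (balance lam N i j) N)%N.
  by rewrite (box_size_split H (leqnn N)).
have bD r g := @W_free_bound R k lam N lamN r g.
exact: (ker_eq_by_dim (@exchange_lin R k i j _) bD
  (cyc_subspace _) (Wn_drop_top_split H) (exchange_drop_top H) Wu fu Wv' fv' Dmn).
Qed.

End Exactness.

(** * Graded pieces *)

Section VacuumDegrees.

(** The parity term is the origin of p(D)/4 in the exponent of q, the square that of the
    half-integral part. *)
Lemma d_deg_vmon (n : nat) :
  4 * d_deg (vmon (- n%:Z)) = (n * n)%N%:Z - (odd n)%:Z.
Proof.
elim: n => [|n IH].
  rewrite /d_deg (_ : vmon (- 0%N%:Z) = fset0) ?big_seq_fset0 //.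
  by apply/fsetP => j; rewrite in_vmon inE oppr0 addbb.
have := @d_deg_insert (vmon (- n.+1%:Z)) (- n%:Z).
rewrite occurs_vmon (_ : insert _ _ = vmon (- n%:Z)); last first.
  have -> : - n%:Z = - n.+1%:Z + 1 by lia.
  by rewrite insert_vmon.
move=> /(_ _) E; have {}E := E ltac:(lia); rewrite /= ; lia.
Qed.

Lemma h0_deg_vmon (n : nat) : h0_deg (vmon (- n%:Z)) = - n%:Z.
Proof.
elim: n => [|n IH].
  rewrite /h0_deg (_ : vmon (- 0%N%:Z) = fset0) ?big_seq_fset0 //.
  by apply/fsetP => j; rewrite in_vmon inE oppr0 addbb.
have := @h0_deg_insert (vmon (- n.+1%:Z)) (- n%:Z).
rewrite occurs_vmon (_ : insert _ _ = vmon (- n%:Z)); last first.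
  have -> : - n%:Z = - n.+1%:Z + 1 by lia.
  by rewrite insert_vmon.
move=> /(_ _) E; have {}E := E ltac:(lia); lia.
Qed.

Lemma d_deg_bound (S : monomial) (j : int) : j \in S ->
  0 <= d_deg S /\ `|j| <= 2 * d_deg S + 2.
Proof.
move=> jS; rewrite /d_deg (big_fsetD1 j) //=.
have ge0 (S' : monomial) :
    0 <= \sum_(i <- S') (if 0 < i then (i %/ 2)%Z else - (i %/ 2)%Z).
  by apply: sumr_ge0 => t _; case: ifP; lia.
have := ge0 (S `\ j)%fset; set s := \sum_(_ <- _) _.
by case: ifP => j0 s0; split; lia.
Qed.

Lemma d_deg_ge0 (S : monomial) : 0 <= d_deg S.
Proof. by apply: sumr_ge0 => t _; case: ifP; lia. Qed.

End VacuumDegrees.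

Lemma comb_commute (K : fieldType) (V U V' U' : lmodType K) (I : Type)
    (X : V -> U) (P : V -> V') (X' : V' -> U') (P' : U -> U') (E : I -> V)
    (s : seq (K * I)) :
  lin_map X -> lin_map P -> lin_map X' -> lin_map P' ->
  (forall t, X' (P (E t)) = P' (X (E t))) ->
  X' (P (\sum_(z <- s) z.1 *: E z.2)) = P' (X (\sum_(z <- s) z.1 *: E z.2)).
Proof.
move=> lX lP lX' lP' H.
rewrite (lin_map_sum lP) (lin_map_sum lX) (lin_map_sum lX') (lin_map_sum lP').
apply: eq_bigr => z _.
by rewrite (lin_mapZ lP) (lin_mapZ lX) (lin_mapZ lX') (lin_mapZ lP') H.
Qed.

Section Graded.
Variables (R : realType) (k : nat).
Local Notation C := R[i].
Local Notation T := (tensF R k).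

Lemma finite_degree (a : rat) : exists l : seq (tmonomial k),
  forall b : tmonomial k, (t_deg b)%:~R = a -> b \in l.
Proof.
have [[b0 b0a]|H] := pselect (exists b : tmonomial k, (t_deg b)%:~R = a); last first.
  by exists [::] => b ba; case: H; exists b.
pose n := t_deg b0.
(* The indices of absolute value at most 2 |n| + 2, as allowed by [d_deg_bound]. *)
pose J : {fset int} := [fset j in int_range (- (2 * absz n + 2)%N%:Z) (4 * absz n + 5)]%fset.
pose P := fpowerset J.
exists [seq [ffun p => val (g p)] | g : {ffun 'I_k -> P}] => b.
rewrite -b0a => /intr_inj bn; have bP p : b p \in P.
  rewrite fpowersetE; apply/fsubsetP => j jb.
  have [_ jd] := d_deg_bound jb.
  have : d_deg (b p) <= n.
    rewrite /n -bn /t_deg (bigD1 p) //= lerDl sumr_ge0 // => q _; exact: d_deg_ge0.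
  by rewrite !inE /= mem_int_range; have := d_deg_ge0 (b p); lia.
apply/mapP; exists [ffun p => [` bP p]%fset]; first by rewrite mem_enum.
by apply/ffunP => p; rewrite !ffunE.
Qed.

Lemma free_supp_bound (l : seq (tmonomial k)) n (v : 'I_n -> T) :
  (forall t, {subset msupp (v t) <= l}) -> free_fam v -> (n <= #|` [fset b in l]%fset|)%N.
Proof.
move=> vl fv; set D := [fset b in l]%fset.
have [n0|npos] := posnP n; first by rewrite n0.
have t0 : 'I_n := Ordinal npos.
pose b0 : tmonomial k := [ffun=> vmon 0].
apply: (free_span_leq fv (v := fun t : 'I_#|` D| => << nth b0 D t >> : T)) => t.
exists (fun s : 'I_#|` D| => (v t)@_(nth b0 D s)).
rewrite {1}(@monalgEw _ _ (v t) D); last first.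
  by apply/fsubsetP => b /vl bl; rewrite !inE.
rewrite (big_nth b0) big_mkord; apply: eq_bigr => s _; exact: malgU_scale.
Qed.

Definition mproj (P : pred (tmonomial k)) : T -> T :=
  lin_ext (fun b => if P b then << b >> else 0).

Lemma mproj_lin P : lin_map (mproj P).
Proof. exact: lin_ext_lin. Qed.

Lemma mproj_id (P : pred (tmonomial k)) (x : T) : {in msupp x, forall b, P b} -> mproj P x = x.
Proof.
move=> xP; apply: (lin_map_supp (mproj_lin P) (@lin_map_id _ _)) => b /xP Pb.
by rewrite /mproj lin_extU Pb.
Qed.

Lemma mproj_0 (P : pred (tmonomial k)) (x : T) : {in msupp x, forall b, ~~ P b} -> mproj P x = 0.
Proof.
move=> xP; apply: (lin_map_supp (mproj_lin P) (@lin_map_zero _ _ _)) => b /xP Pb.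
by rewrite /mproj lin_extU (negbTE Pb).
Qed.

Lemma mproj_supp (P : pred (tmonomial k)) (x : T) b : b \in msupp (mproj P x) -> P b.
Proof.
move=> /msupp_lin_ext[b' _]; case: ifP => Pb'; last by rewrite msupp0 inE.
by rewrite msuppU oner_eq0 inE => /eqP ->.
Qed.

Definition bideg (a c : rat) : pred (tmonomial k) :=
  fun b => ((t_deg b)%:~R == a) && ((t_charge b)%:~R == c).

Definition piece (A : T -> Prop) (a c : rat) (x : T) : Prop :=
  A x /\ {in msupp x, forall b, bideg a c b}.

Definition vac_mon (lam : 'I_k -> int) : tmonomial k := [ffun p => vmon (- lam p)].

Lemma e_word_supp lam t b : b \in msupp (e_word t (tmon R lam)) ->
  t_deg b = t_deg (vac_mon lam) + \sum_(m <- t) m /\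
  t_charge b = t_charge (vac_mon lam) + 2 * (size t)%:Z.
Proof.
elim: t b => [|m t IH] b /=.
  rewrite msuppU oner_eq0 inE big_nil => /eqP ->; split; first by rewrite addr0.
  by rewrite mulr0 addr0.
move=> /coprod_e_supp[b' /IH[d1 h1] [d2 h2 _]].
by rewrite d2 h2 d1 h1 big_cons /=; split; [ring | rewrite intS; ring].
Qed.

Lemma mproj_word lam t a c : mproj (bideg a c) (e_word t (tmon R lam)) =
  if ((t_deg (vac_mon lam) + \sum_(m <- t) m)%:~R == a) &&
     ((t_charge (vac_mon lam) + 2 * (size t)%:Z)%:~R == c)
  then e_word t (tmon R lam) else 0.
Proof.
case: ifP => ac; [apply: mproj_id | apply: mproj_0] => b /e_word_supp[d1 h1];
  by rewrite /bideg d1 h1 ac.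
Qed.

Lemma mproj_cyc lam x a c : cyc (tmon R lam) x -> cyc (tmon R lam) (mproj (bideg a c) x).
Proof.
move=> [s [sn ->]]; rewrite (lin_map_sum (mproj_lin _)).
apply: (subspace_sum_seq (cyc_subspace _)) => z zs /=.
rewrite (lin_mapZ (mproj_lin _)) mproj_word.
apply: (subspaceZ _ (cyc_subspace _)); case: ifP => _.
  by apply: cyc_word; apply: sn.
exact: (cyc_subspace _).1.
Qed.

(** The bidegree of a word is that of the cyclic vector plus an amount depending on the word alone.
    An intertwiner that maps one cyclic vector to another is therefore homogeneous on the cyclic
    subspace. *)
Lemma mproj_commute (X : T -> T) lam lam' a c x :
  lin_map X -> (forall m y, X (coprod (e m) y) = coprod (e m) (X y)) ->
  X (tmon R lam) = tmon R lam' ->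
  t_charge (vac_mon lam') = t_charge (vac_mon lam) ->
  cyc (tmon R lam) x ->
  X (mproj (bideg a c) x) =
  mproj (bideg (a + (t_deg (vac_mon lam') - t_deg (vac_mon lam))%:~R) c) (X x).
Proof.
move=> lX Xe Xw ch [s [sn ->]].
apply: (comb_commute s lX (mproj_lin _) lX (mproj_lin _)) => t.
have Xword : X (e_word t (tmon R lam)) = e_word t (tmon R lam').
  by elim: t => [//|m t IH] /=; rewrite Xe IH.
rewrite Xword !mproj_word ch.
have -> : ((t_deg (vac_mon lam') + \sum_(m <- t) m)%:~R ==
    a + (t_deg (vac_mon lam') - t_deg (vac_mon lam))%:~R) =
    ((t_deg (vac_mon lam) + \sum_(m <- t) m)%:~R == a).
  by rewrite -subr_eq -rmorphB /=; congr (_%:~R == _); ring.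
by case: ifP => _; [exact: Xword | exact: lin_map0].
Qed.

Definition Lb (beta : 'I_k -> nat) (x : T) : Prop :=
  exists s : nat, Wn (fun p => beta p + 2 * s)%N x.

Lemma Wn_ext (lam lam' : 'I_k -> nat) (x : T) : lam =1 lam' -> Wn lam x -> Wn lam' x.
Proof. by move=> /funext ->. Qed.

(** After the shift by 2 all lengths are positive, so [lower_all] applies even if lam has empty
    slots. *)
Lemma Wn_succ (lam : 'I_k -> nat) (x : T) : Wn lam x -> Wn (fun p => lam p + 2)%N x.
Proof.
apply: cyc_sub; pose lam' p := (lam p + 2)%N; pose N := (\max_p lam' p)%N.
have lamN p : (lam' p <= N)%N by exact: leq_bigmax.
have lam'0 p : (0 < lam' p)%N by rewrite /lam' addn2.
have := @lower_all R k lam' N lamN lam'0.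
congr (cyc _ (tmon R _)); apply: funext => p; rewrite /intf /lam'; lia.
Qed.

Lemma Wn_leq (beta : 'I_k -> nat) s t (x : T) : (s <= t)%N ->
  Wn (fun p => beta p + 2 * s)%N x -> Wn (fun p => beta p + 2 * t)%N x.
Proof.
move=> st Ws; have H n : Wn (fun p => beta p + 2 * (n + s))%N x.
  elim: n => [|n IH]; first exact: Ws.
  by apply: Wn_ext (Wn_succ IH) => p; lia.
by have := H (t - s)%N; rewrite subnK.
Qed.

Lemma Lb_subspace beta : subspace (Lb beta).
Proof.
split=> [|a x y [s Ws] [t Wt]]; first by exists 0%N; exact: (cyc_subspace _).1.
exists (maxn s t); apply: (cyc_subspace _).2.
- exact: Wn_leq (leq_maxl s t) Ws.
- exact: Wn_leq (leq_maxr s t) Wt.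
Qed.

Lemma piece_subspace A a c : subspace A -> subspace (piece A a c).
Proof.
move=> [A0 AD]; split; first by split=> // b; rewrite msupp0 inE.
move=> z x y [Ax dx] [Ay dy]; split; first exact: AD.
move=> b /(fsubsetP (msuppD_le _ _)); rewrite in_fsetU => /orP[|/dy //].
by move=> /(fsubsetP (msuppZ_le _ _)) /dx.
Qed.

Lemma piece_basis A a c : exists n (v : 'I_n -> T), is_basis (piece A a c : set T) v.
Proof.
have [l lE] := finite_degree a.
apply: (@basis_exists R T _ #|` [fset b in l]%fset|) => n v pv fv.
apply: (free_supp_bound _ fv) => t b bv; apply: lE.
by have [_ /(_ b bv) /andP[/eqP]] := pv t.
Qed.

Lemma piece_Lb_exact (beta beta' beta'' : 'I_k -> nat) (X : T -> T) (delta : int) a c :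
  lin_map X -> (forall m y, X (coprod (e m) y) = coprod (e m) (X y)) ->
  (forall s, X (tmon R (intf (fun p => beta p + 2 * s)%N)) =
             tmon R (intf (fun p => beta'' p + 2 * s)%N)) ->
  (forall s x, Wn (fun p => beta' p + 2 * s)%N x <->
     Wn (fun p => beta p + 2 * s)%N x /\ X x = 0) ->
  (forall s, t_charge (vac_mon (intf (fun p => beta'' p + 2 * s)%N)) =
     t_charge (vac_mon (intf (fun p => beta p + 2 * s)%N))) ->
  (forall s, t_deg (vac_mon (intf (fun p => beta'' p + 2 * s)%N)) -
     t_deg (vac_mon (intf (fun p => beta p + 2 * s)%N)) = delta) ->
  dim (piece (Lb beta) a c : set T) =
  (dim (piece (Lb beta') a c : set T) +
   dim (piece (Lb beta'') (a + delta%:~R) c : set T))%N.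
Proof.
move=> lX Xe Xw Xker chE degE.
have [n' [u bu]] := piece_basis (Lb beta') a c.
have [n'' [v bv]] := piece_basis (Lb beta'') (a + delta%:~R) c.
have commute s x : Wn (fun p => beta p + 2 * s)%N x -> X (mproj (bideg a c) x) =
    mproj (bideg (a + delta%:~R) c) (X x).
  by move=> Wx; rewrite (mproj_commute a c lX Xe (Xw s) (chE s) Wx) degE.
apply: (rank_nullity lX _ _ _ _ bu bv).
- exact/piece_subspace/Lb_subspace.
- move=> x; split.
    move=> [[s /Xker[Ws Xx]] dx]; split=> //; split=> //; by exists s.
  by move=> [[[s Ws] dx] Xx]; split=> //; exists s; apply/Xker.
- move=> x [[s Ws] dx]; split.
    by exists s; exact: (cyc_map lX (fun m y _ => Xe m y) (Xw s)).
  have -> : X x = mproj (bideg (a + delta%:~R) c) (X x).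
    by rewrite -(commute s x Ws) (mproj_id dx).
  by move=> b /mproj_supp.
- move=> y [[s Ws] dy].
  have [x Wx Xx] := cyc_surj lX (fun m y _ => Xe m y) (Xw s) Ws.
  (* A preimage need not be homogeneous; its component of the right bidegree is still a preimage. *)
  exists (mproj (bideg a c) x); last by rewrite (commute s x Wx) Xx (mproj_id dy).
  split; last by move=> b /mproj_supp.
  by exists s; exact: mproj_cyc.
Qed.

Lemma trace_qzE (A : T -> Prop) (a b : rat) :
  trace_qz (A : set T) a b = dim (piece A a (2 * b) : set T).
Proof.
rewrite /trace_qz; congr dim; apply/seteqP.
have ratE (n : int) (q : rat) : (n%:~R = ratr q :> C) <-> (n%:~R == q).
  split=> [H|/eqP <-]; last by rewrite ratr_int.
  apply/eqP; apply: (fmorph_inj (@ratr C : {rmorphism rat -> C})).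
  by rewrite /= ratr_int.
split=> x /=.
  move=> [Ax /coprod_diag_eigen dx /coprod_diag_eigen hx]; split=> // m mx.
  by apply/andP; split; apply/ratE; [exact: dx | exact: hx].
move=> [Ax dx]; split=> //; apply/coprod_diag_eigen => m /dx/andP[/ratE d1 /ratE d2].
- exact: d1.
- exact: d2.
Qed.

End Graded.

Lemma sum_filter0 (V : zmodType) (I : eqType) (r : seq I) (P : pred I) (G : I -> V) :
  {in r, forall z, ~~ P z -> G z = 0} -> \sum_(z <- r) G z = \sum_(z <- filter P r) G z.
Proof.
move=> G0; rewrite big_filter [RHS]big_mkcond; apply: eq_big_seq => z zr.
by case: ifPn => // /(G0 z zr).
Qed.

Lemma shift_rat (delta : int) (P P' n : nat) (a : rat) :
  4 * delta = - 2 * n%:Z - (P'%:Z - P%:Z) ->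
  a - ((P'%:R - P%:R) / 4 + n%:R / 2) = a + delta%:~R.
Proof.
move=> E; have {}E : 4 * delta + 2 * n%:Z + P'%:Z = P%:Z by lia.
have := congr1 (fun z : int => z%:~R : rat) E.
rewrite !intrD !intrM (_ : (4 : int)%:~R = 4) // (_ : (2 : int)%:~R = 2) //.
by rewrite -!pmulrn => E'; lra.
Qed.

(** * Identification of L^D with the unions of cyclic subspaces, and the graded recursion *)

Section Characters.
Variables (R : realType) (k : nat).
Local Notation C := R[i].
Local Notation T := (tensF R k).
Implicit Types (D : k.+1.-tuple nat) (lam beta : 'I_k -> nat).

Definition slots D (p : 'I_k) : nat := Defs.beta D p.+1.

Definition dimLb beta (a c : rat) : nat := dim (piece (Lb beta) a c : set T).

(** All lengths of w_s are at most n + 2 s, so every slot is killed by e_m with m <= - (n + 2 s).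
    The words excluded from [M] contribute 0. *)
Lemma e_word_out D s t : nonpos_word t ->
  ~~ all (fun m => - (size_D D + 2 * s)%:Z + 1 <= m) t ->
  e_word t (tmon R (intf (fun p => slots D p + 2 * s)%N)) = 0.
Proof.
set lam := intf _; elim: t => [//|m t IH] nt.
have nt' : nonpos_word t by move=> n nin; apply: nt; rewrite inE nin orbT.
rewrite /= negb_and => /orP[mN|/(IH nt') ->]; last exact: lin_map0 (@coprod_lin R k (e m)).
rewrite (@coprod_e_above R k lam); last by apply: W_above; apply: cyc_word.
apply: big1 => p _; rewrite ifF //; apply/negbTE.
have : (slots D p <= size_D D)%N.
  rewrite /slots /Defs.beta /size_D [leqRHS](@big_cat_nat _ _ _ p.+2) //=.
    exact: leq_addl.
  by rewrite !ltnS; have := ltn_ord p; lia.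
by move: mN; rewrite /lam /intf; lia.
Qed.

Lemma L_Lb D (x : T) : @L R k D x <-> Lb (slots D) x.
Proof.
have wE s : @w R k D s = tmon R (intf (fun p => slots D p + 2 * s)%N).
  rewrite /w /tmon; congr (<< _ >>); apply/ffunP => p; rewrite !ffunE.
  by congr vmon; rewrite /intf /slots; lia.
have MW s : @M R k D s x <-> Wn (fun p => slots D p + 2 * s)%N x.
  split=> [[c [cn ->]]|[c [cn ->]]].
    exists c; rewrite wE; split=> // z zc m mz.
    by have := cn z zc m mz; lia.
  pose good (z : C * seq int) := all (fun m => - (size_D D + 2 * s)%:Z + 1 <= m) z.2.
  exists [seq z <- c | good z]; split.
    move=> z; rewrite mem_filter => /andP[/allP gz zc] m mz.
    by apply/andP; split; [exact: gz | exact: (cn z zc)].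
  rewrite wE; apply: sum_filter0 => z zc bad.
  by rewrite (e_word_out (cn z zc) bad) scaler0.
split=> [[s _ /MW Ws]|[s Ws]]; first by exists s.
(* The union defining [L] starts at s = 1; since the chain increases, s = 0 adds nothing. *)
by exists s.+1; [exact: ltn0Sn | apply/MW; exact: (Wn_leq (leqnSn s) Ws)].
Qed.

Lemma chE D a b : ch R D a b = dimLb (slots D) a (2 * b).
Proof.
rewrite /ch (_ : @L R k D = (Lb (slots D) : set T)) ?trace_qzE //.
by apply: funext => x; apply: propext; exact: L_Lb.
Qed.

(** This accounts for the reduction of d''_(k+1) modulo 2, which lowers every beta_i by the same
    even number. *)
Lemma Lb_shift_n beta beta' n : (forall p, beta p = beta' p + 2 * n)%N ->
  Lb beta = Lb beta' :> (T -> Prop).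
Proof.
move=> bE; apply: funext => x; apply: propext; split=> -[s Ws].
  by exists (n + s)%N; apply: Wn_ext Ws => p; rewrite bE; lia.
by exists s; apply: Wn_ext (Wn_leq (leq_addl n s) Ws) => p; rewrite bE; lia.
Qed.

Lemma t_charge_vac lam : t_charge (vac_mon (intf lam)) = - (\sum_p lam p)%N%:Z.
Proof.
rewrite /t_charge (big_morph Posz PoszD (erefl 0)) -sumrN; apply: eq_bigr => p _.
by rewrite ffunE h0_deg_vmon.
Qed.

Lemma t_deg_vac lam : 4 * t_deg (vac_mon (intf lam)) =
  \sum_p ((lam p * lam p)%N%:Z - (odd (lam p))%:Z).
Proof.
by rewrite /t_deg mulr_sumr; apply: eq_bigr => p _; rewrite ffunE d_deg_vmon.
Qed.

Lemma splittable_shift lam N i j s : splittable lam N i j ->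
  splittable (fun p => lam p + 2 * s)%N (N + 2 * s) i j.
Proof.
move=> [iN lamN jN jmax]; split=> [|p||p]; rewrite ?iN //; last 1 first.
- by move=> pN; have := jmax p; lia.
- by have := lamN p; lia.
- lia.
Qed.

(** By [d_deg_vmon] only slots i and j matter, and (N - 1)^2 + (b + 1)^2 - N^2 - b^2 = - 2 (N - b -
    1) with b = lam_j. *)
Lemma t_deg_balance lam N i j : splittable lam N i j ->
  4 * (t_deg (vac_mon (intf (balance lam N i j))) - t_deg (vac_mon (intf lam))) =
  - 2 * (N - lam j - 1)%N%:Z - ((odd N.-1)%:Z + (odd (lam j).+1)%:Z - (odd N)%:Z - (odd (lam j))%:Z).
Proof.
move=> [iN lamN jN _]; have ij : j != i by apply: contra_eqN iN => /eqP <-; lia.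
rewrite mulrBr !t_deg_vac (bigD1 i) //= (bigD1 j) //=.
rewrite [X in _ - X](bigD1 i) //= [X in _ - (_ + X)](bigD1 j) //=.
rewrite /balance eqxx (negbTE ij) eqxx iN.
rewrite [X in _ + (_ + X) - _](eq_bigr (fun p => (lam p * lam p)%N%:Z - (odd (lam p))%:Z)); last first.
  by move=> p /andP[/negbTE -> /negbTE ->].
have -> : (N * N = N.-1 * N.-1 + 2 * N.-1 + 1)%N by rewrite -[N in LHS](@prednK N); nia.
have -> : ((lam j).+1 * (lam j).+1 = lam j * lam j + 2 * lam j + 1)%N by nia.
set S := \sum_(_ < _ | _) _; set u := (N.-1 * N.-1)%N; set v := (lam j * lam j)%N.
rewrite !oddS; move: (odd N) (odd N.-1) (odd (lam j)) => o1 o2 o3.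
clearbody S u v; lia.
Qed.

Lemma sum_odd_balance lam N i j : splittable lam N i j ->
  (\sum_p odd (balance lam N i j p) + odd N + odd (lam j) =
   \sum_p odd (lam p) + odd N.-1 + odd (lam j).+1)%N.
Proof.
move=> [iN lamN jN _]; have ij : j != i by apply: contra_eqN iN => /eqP <-; lia.
rewrite [in LHS](bigD1 i) //= [in LHS](bigD1 j) //=.
rewrite [in RHS](bigD1 i) //= [in RHS](bigD1 j) //=.
rewrite /balance eqxx (negbTE ij) eqxx iN.
rewrite (eq_bigr (fun p => nat_of_bool (odd (lam p)))); last first.
  by move=> p /andP[/negbTE -> /negbTE ->].
lia.
Qed.

Lemma dimLb_split beta N i j a c : splittable beta N i j ->
  dimLb beta a c = (dimLb (drop_top beta N) a c + dimLb (balance beta N i j)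
    (a - (((\sum_p odd (balance beta N i j p))%N%:R - (\sum_p odd (beta p))%N%:R) / 4
          + (N - beta j - 1)%N%:R / 2)) c)%N.
Proof.
move=> H; have [iN betaN jN jmax] := H.
have dropE s : (drop_top (fun p => beta p + 2 * s) (N + 2 * s) =1
    (fun p => drop_top beta N p + 2 * s))%N.
  by move=> p; rewrite /drop_top eqn_add2r; case: eqP => //; lia.
have balE s : (balance (fun p => beta p + 2 * s) (N + 2 * s) i j =1
    (fun p => balance beta N i j p + 2 * s))%N.
  by move=> p; rewrite /balance; do 2?[case: eqP => // _]; lia.
have {}balE s := funext (balE s); have {}dropE s := funext (dropE s).
pose delta := t_deg (vac_mon (intf (balance beta N i j))) - t_deg (vac_mon (intf beta)).
have deltaE := t_deg_balance H; rewrite -/delta in deltaE.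
have -> : a - (((\sum_p odd (balance beta N i j p))%N%:R - (\sum_p odd (beta p))%N%:R) / 4
          + (N - beta j - 1)%N%:R / 2) = a + delta%:~R.
  have oddE := sum_odd_balance H.
  apply: shift_rat; rewrite deltaE; lia.
(* The offset depends only on a difference of lengths, so one operator serves for every s, and hence
   on the whole union. *)
pose X : T -> T := exchange i j ((beta j)%:Z + 1 - (beta i)%:Z).
have ij : i != j by apply: contra_eqN iN => /eqP ->; lia.
have XE s : X = exchange i j ((beta j + 2 * s)%N%:Z + 1 - (beta i + 2 * s)%N%:Z).
  by rewrite /X; congr exchange; lia.
apply: (@piece_Lb_exact R k beta _ _ X).
- exact: exchange_lin.
- by move=> m y; exact: exchange_coprod.
- move=> s; rewrite -balE (XE s).
  exact: (exchange_tmon_balance R (splittable_shift s H)).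
- move=> s x; rewrite -dropE; have Hs := splittable_shift s H; split=> [Wx|[Wx Xx]].
    split; first exact: Wn_drop_top_split Hs _ Wx.
    by rewrite (XE s); exact: exchange_drop_top Hs _ Wx.
  by move: Xx; rewrite (XE s); exact: exchange_ker.
- move=> s; rewrite -balE !t_charge_vac.
  by rewrite (sum_balance (splittable_shift s H)).
- move=> s; rewrite -balE.
  have := t_deg_balance (splittable_shift s H).
  rewrite (_ : (N + 2 * s).-1 = N.-1 + 2 * s)%N; last by lia.
  rewrite (_ : (beta j + 2 * s).+1 = (beta j).+1 + 2 * s)%N; last by lia.
  rewrite !oddD (_ : odd 0 = false) // !addbF !addbb !addbF.
  rewrite (_ : N + 2 * s - (beta j + 2 * s) - 1 = N - beta j - 1)%N; last by lia.
  by rewrite -deltaE => /(mulfI (isT : (4 : int) != 0)).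
Qed.

End Characters.

(** * Permuting the slots *)

Section Permute.
Variables (R : realType) (k : nat).
Local Notation C := R[i].
Local Notation T := (tensF R k).
Implicit Types (s : {perm 'I_k}) (beta gamma : 'I_k -> nat).

Lemma along_perm (A : Type) s (b : 'I_k -> A) a0 r : along s b a0 r = b (s^-1%g r).
Proof. by rewrite -[r in LHS](permKV s) along_in //; exact: perm_inj. Qed.

Lemma mon_along_deg s (b : tmonomial k) :
  t_deg (mon_along s b) = t_deg b /\ t_charge (mon_along s b) = t_charge b.
Proof.
rewrite /t_deg /t_charge; split.
- rewrite (reindex_inj (@perm_inj _ s)); apply: eq_bigr => p _.
  by rewrite ffunE along_perm permK.
- rewrite (reindex_inj (@perm_inj _ s)); apply: eq_bigr => p _.
  by rewrite ffunE along_perm permK.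
Qed.

Lemma reindex_permK s (x : T) : reindex s^-1%g (reindex s x) = x.
Proof.
apply: (lin_map_eq (X := fun x => reindex s^-1%g (reindex s x)) (Y := fun x => x)).
- exact: (lin_map_comp (@reindex_lin R _ _ s^-1%g) (@reindex_lin R _ _ s)).
- exact: lin_map_id.
move=> b; rewrite !reindexU; congr (<< _ >>); apply/ffunP => r.
by rewrite ffunE along_perm invgK ffunE along_perm permK.
Qed.

Lemma reindex_piece s beta gamma a c (x : T) :
  (forall p, gamma (s p) = beta p) ->
  piece (Lb beta) a c x -> piece (Lb gamma) a c (reindex s x).
Proof.
move=> gE [[t Wt] dx]; split.
  exists t; have X_tmon : reindex s (tmon R (intf (fun p => beta p + 2 * t)%N)) =
      tmon R (intf (fun p => gamma p + 2 * t)%N).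
    rewrite reindex_tmon; congr (tmon R _); apply: funext => r.
    by rewrite along_perm /intf -gE permKV.
  exact: (cyc_map (reindex_lin s)
    (fun m x => @reindex_e R _ _ s (@perm_inj _ s) m x) X_tmon Wt).
move=> b /msupp_lin_ext[b' b'x]; rewrite -[<< _ >>]scale1r => /msupp_scaleU ->.
have [dE hE] := mon_along_deg s b'.
by rewrite /bideg dE hE; exact: dx.
Qed.

(** Reindexing by s is invertible and preserves the bidegree; the equality of dimensions is
    rank-nullity with zero kernel. *)
Lemma dimLb_perm s beta gamma a c : (forall p, gamma (s p) = beta p) ->
  dimLb R beta a c = dimLb R gamma a c.
Proof.
move=> gE; have [n [v bv]] := piece_basis (Lb (R := R) gamma) a c.
pose Z : set T := fun x => x = 0.
have bZ : is_basis Z (fun _ : 'I_0 => 0 : T).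
  split=> [[]//|_ _ []//|x ->].
  by exists (fun=> 0); rewrite big_ord0.
have dZ : dim Z = 0%N by rewrite (dimE bZ).
rewrite /dimLb -[RHS]add0n -dZ.
apply: (rank_nullity (@reindex_lin R _ _ s) _ _ _ _ bZ bv).
- exact/piece_subspace/Lb_subspace.
- move=> x; split=> [->|[_ sx]].
    split; last exact: lin_map0 (@reindex_lin R _ _ s).
    by have [] := piece_subspace a c (@Lb_subspace R k beta).
  by rewrite /Z /= -(reindex_permK s x) sx; exact: lin_map0 (@reindex_lin R _ _ s^-1%g).
- by move=> x; exact: reindex_piece.
- move=> y py; exists (reindex s^-1%g y).
    by apply: reindex_piece py => p; rewrite -gE permKV.
  by have := reindex_permK s^-1%g y; rewrite invgK.
Qed.

(* If every slot has length N or N - 1, the cyclic vector of the original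
   lengths is in turn obtained by lowering the slots of length N - 1 + 2. *)
Lemma Lb_drop_top_eq beta N : (2 <= N)%N ->
  (forall p, beta p = N \/ beta p = N.-1) ->
  Lb (drop_top beta N) = Lb beta :> (T -> Prop).
Proof.
move=> N2 bN; apply: funext => x; apply: propext; split=> -[s Ws]; last first.
  exists s.+1; apply: (@Wn_drop_top R k _ (N + 2 * s).+1); first lia.
    by move=> p; rewrite /drop_top; case: eqP; case: (bN p) => ->; lia.
  apply: Wn_ext Ws => p; rewrite /drop_top.
  by case: (bN p) => ->; do ?[case: eqP => //]; lia.
exists s; apply: (@Wn_drop_top R k _ (N + 2 * s)); first lia.
  by move=> p; case: (bN p) => ->; lia.
by apply: Wn_ext Ws => p; rewrite /drop_top eqn_add2r; case: eqP => //; lia.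
Qed.

End Permute.

(** * Tail sums of D and their changes *)

Section Arithmetic.
Variables (k : nat).
Implicit Types (D : k.+1.-tuple nat) (i j m : nat).

Lemma ent_mkD f j : (1 <= j <= k.+1)%N -> ent (mkD k f) j = f j.
Proof.
case: j => [//|j] jk; have jk' : (j < k.+1)%N by lia.
by rewrite /ent -[j.+1.-1]/(val (Ordinal jk')) -tnth_nth tnth_mktuple.
Qed.

Lemma sum_count_mem (s : seq nat) i : (\sum_(i.+1 <= j < k.+2) count_mem j s =
  count (fun m => i < m < k.+2) s)%N.
Proof.
elim: s => [|m s IHs]; first exact: big1.
rewrite [RHS]/= -IHs /= big_split /=; congr (_ + _)%N.
have [mi|mi] := boolP (i < m < k.+2)%N.
  rewrite (bigD1_seq m) ?iota_uniq ?mem_index_iota //= eqxx big1 ?addn0 // => j.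
  by rewrite eq_sym => /negbTE ->.
rewrite big1_seq // => j; rewrite mem_index_iota => ij.
by case: eqP => // jm; case/negP: mi; rewrite jm; lia.
Qed.

(** The lists record, with multiplicity, the positions where a unit is removed ([u]) or added ([v]).
    Written additively, the change is free of truncated subtraction, and it alters a tail sum by the
    number of listed positions in the tail. *)
Lemma beta_change D f (u v : seq nat) i :
  (forall j, (1 <= j <= k.+1)%N ->
    f j + count_mem j u = ent D j + count_mem j v)%N ->
  (beta (mkD k f) i + count (fun m => i < m < k.+2) u =
   beta D i + count (fun m => i < m < k.+2) v)%N.
Proof.
move=> fE; rewrite /beta -!sum_count_mem -!big_split /=; apply: eq_big_nat => j ij.
by rewrite ent_mkD ?fE //; lia.
Qed.

Lemma beta_const D i i' : (i <= i')%N -> (i' <= k.+1)%N ->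
  (forall j, (i < j <= i')%N -> ent D j = 0)%N -> beta D i = beta D i'.
Proof.
move=> ii' i'k d0; rewrite /beta (@big_cat_nat _ _ _ i'.+1) //=.
rewrite big1_seq // => j; rewrite mem_index_iota => ij; apply: d0; lia.
Qed.

Lemma beta_step D i : (i <= k)%N -> beta D i = (ent D i.+1 + beta D i.+1)%N.
Proof. by move=> ik; rewrite /beta big_ltn //; lia. Qed.

Lemma beta_leq D i i' : (i <= i')%N -> (i' <= k.+1)%N -> (beta D i' <= beta D i)%N.
Proof.
move=> ii' i'k; rewrite /beta [leqRHS](@big_cat_nat _ _ _ i'.+1) //=.
exact: leq_addl.
Qed.

Lemma p_slots D : p D = (\sum_(t < k) odd (slots D t))%N.
Proof. by rewrite /p big_add1 /= big_mkord. Qed.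

End Arithmetic.

(** * The recursion *)

Section Cases.
Variables (R : realType) (k : nat) (D : k.+1.-tuple nat) (l : nat).
Hypothesis hl : (2 <= l <= k)%N.
Hypothesis hDl : forall t : nat, (1 <= t < l)%N -> ent D t = 0%N.
Let N := beta D l.-1.

Lemma slots_lt_l (q : 'I_k) : (q.+1 < l)%N -> slots D q = N.
Proof.
by move=> ql; apply: beta_const => [||t tl]; [lia | lia | apply: hDl; lia].
Qed.

Lemma beta_l : N = (ent D l + beta D l)%N.
Proof. by rewrite /N beta_step ?prednK //; lia. Qed.

Section Tail.
Variables (l1 : nat).
Hypothesis hl1 : (l < l1 <= k.+1)%N.
Hypothesis dl : ent D l = 1%N.
Hypothesis dl1 : ent D l1 <> 0%N.
Hypothesis gap0 : forall t : nat, (l < t < l1)%N -> ent D t = 0%N.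

Lemma slots_mid (q : 'I_k) : (l <= q.+1 < l1)%N -> slots D q = N.-1.
Proof.
move=> ql; rewrite beta_l dl add1n /=; apply/esym/beta_const => [||t tl]; [lia | lia |].
by apply: gap0; lia.
Qed.

Lemma beta_l1 : N.-1 = (ent D l1 + beta D l1)%N.
Proof.
rewrite beta_l dl add1n /= (@beta_const k D l l1.-1).
- by rewrite beta_step ?prednK //; lia.
- lia.
- lia.
- by move=> t tl; apply: gap0; lia.
Qed.

(** Lowering turns the l - 1 first slots from N into N - 2 and leaves N - 1 in the l_1 - l slots
    that follow. The lengths of D' are decreasing, so these two blocks trade places; the new
    boundary between them is why d_(l_1 - l + 1) is increased. *)
Let swap (q : nat) : nat :=
  if (q < l1 - l)%N then (q + l.-1)%N
  else if (q < l1.-1)%N then (q - (l1 - l))%N else q.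

Let swap_lt (q : 'I_k) : (swap q < k)%N.
Proof. 
rewrite /swap; have := ltn_ord q.
by case E1: (q < l1 - l)%N; case E2: (q < l1.-1)%N; lia.
Qed.

Let swap_ord (q : 'I_k) : 'I_k := Ordinal (swap_lt q).

Let swap_inj : injective swap_ord.
Proof.
move=> q q' /(congr1 val) /= E; apply: val_inj => /=; move: E.
rewrite /swap.
by case E1: (q < l1 - l)%N; case E2: (q < l1.-1)%N;
  case E3: (q' < l1 - l)%N; case E4: (q' < l1.-1)%N; lia.
Qed.

Let D' := mkD k (fun t =>
  (ent D t + (t == l1 - l + 1) - (t == l) - (t == l1))%N).

Lemma dimLb_D' a c : dimLb R (slots D') a c = dimLb R (drop_top (slots D) N) a c.
Proof.
apply: (@dimLb_perm R k (perm swap_inj)) => q; rewrite permE.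
have D'_ent t : ((ent D t + (t == l1 - l + 1) - (t == l) - (t == l1)) +
    count_mem t [:: l; l1] = ent D t + count_mem t [:: l1 - l + 1])%N.
  have [->|tl] := eqVneq t l; first by rewrite dl /=; lia.
  by have [->|tl1] := eqVneq t l1; rewrite /=; lia.
have := @beta_change k D _ [:: l; l1] [:: (l1 - l + 1)%N] q.+1 (fun t _ => D'_ent t).
rewrite -/D' -/(slots D' q) -/(slots D q) /= => E.
have Nb := beta_l1; have qk := ltn_ord q.
rewrite /drop_top; move: E.
have [q1|q1] := ltnP q (l1 - l).
  have -> : slots D (swap_ord q) = N.-1.
    by apply: slots_mid; rewrite /= /swap q1; lia.
  have [ql|ql] := ltnP q.+1 l; first by rewrite slots_lt_l //; case: eqP; lia.
  by rewrite slots_mid; [case: eqP; lia | lia].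
have [q2|q2] := ltnP q l1.-1.
  have -> : slots D (swap_ord q) = N.
    by apply: slots_lt_l; rewrite /= /swap (leq_gtF q1) q2; lia.
  rewrite eqxx; have [ql|ql] := ltnP q.+1 l; first by rewrite slots_lt_l //; lia.
  by rewrite slots_mid; lia.
have -> : swap_ord q = q.
  by apply: val_inj; rewrite /= /swap (leq_gtF q1) (leq_gtF q2).
have : (slots D q <= beta D l1)%N by apply: beta_leq; lia.
by case: eqP; lia.
Qed.

End Tail.

(** Numbered from 1, i is slot l - 1, followed by a drop in length, and j is slot l_1, the first of
    length beta_(l_1). Case a) is l_1 = l, where there are no slots in between; case b_1) has such
    slots of length N - 1. *)
Lemma splittable_slots (l1 : nat) (i j : 'I_k) : (l <= l1)%N ->
  (i : nat) = l.-2 -> (j : nat) = l1.-1 -> (beta D l1 + 2 <= N)%N ->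
  (forall q : 'I_k, (l <= q.+1 < l1)%N -> slots D q = N.-1) ->
  splittable (slots D) N i j.
Proof.
move=> ll1 iE jE bN mid.
have jb : slots D j = beta D l1 by rewrite /slots jE prednK //; lia.
have jk := ltn_ord j; have high (q : 'I_k) : (l1 <= q.+1)%N -> (slots D q <= beta D l1)%N.
  by move=> ql; apply: beta_leq => //; have := ltn_ord q; lia.
split=> [|q||q]; rewrite ?jb //.
- by apply: slots_lt_l; rewrite iE; lia.
- have [/slots_lt_l -> //|ql] := ltnP q.+1 l.
  have [ql1|ql1] := ltnP q.+1 l1; first by rewrite mid; lia.
  by have := high q ql1; lia.
- have [/slots_lt_l ->|ql] := ltnP q.+1 l; first by lia.
  by have [ql1|/high //] := ltnP q.+1 l1; rewrite mid; lia.
Qed.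

Lemma ch_split (D' D'' : k.+1.-tuple nat) i j n (r : rat) :
  splittable (slots D) N i j ->
  (forall a c, dimLb R (slots D') a c = dimLb R (drop_top (slots D) N) a c) ->
  (forall q, balance (slots D) N i j q = slots D'' q + 2 * n)%N ->
  r = (N - slots D j - 1)%N%:R / 2 ->
  ch R D = (ch R D' + 'q^(((p D'')%:R - (p D)%:R) / 4 + r) * ch R D'')%qz.
Proof.
move=> H D'E D''E ->; apply: funext => a; apply: funext => b.
rewrite /qz_add /q_shift !chE (dimLb_split _ _ _ H) D'E !p_slots.
congr (_ + _)%N; have -> : (\sum_t odd (slots D'' t) =
    \sum_t odd (balance (slots D) N i j t))%N.
  by apply: eq_bigr => t _; rewrite D''E oddD oddM addbF.
by rewrite /dimLb (Lb_shift_n R D''E).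
Qed.

End Cases.

Theorem theorem4p1 (R : realType) (k : nat) (D : k.+1.-tuple nat) (l : nat)
    (hk : (1 <= k)%N)
    (hD1 : ent D 1 = 0%N)
    (hDlast : (ent D k.+1 <= 1)%N)
    (hDsum : (2 <= \sum_(2 <= i < k.+2) ent D i)%N)
    (hl : (2 <= l <= k)%N)
    (hDl : forall i : nat, (1 <= i < l)%N -> ent D i = 0%N) :
  ((2 <= ent D l)%N ->
     let D' := mkD k (fun i =>
       if i == l then (ent D i - 2)%N else ent D i) in
     let D'' := mkD k (fun i =>
       if i == l.-1 then (ent D i + 1)%N
       else if i == l then (ent D i - 2)%N
       else if i == l.+1 then
         if l == k then ((ent D i + 1) %% 2)%N else (ent D i + 1)%N
       else ent D i) in
     ch R D =
     (ch R D' +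
      'q^(((p D'')%:R - (p D)%:R) / 4 + ((ent D l)%:R - 1) / 2) * ch R D'')%qz)
  /\
  (ent D l = 1%N ->
   forall l1 : nat,
     (l < l1 <= k.+1)%N -> ent D l1 <> 0%N ->
     (forall i : nat, (l < i < l1)%N -> ent D i = 0%N) ->
     let D' := mkD k (fun i =>
       (ent D i + (i == l1 - l + 1) - (i == l) - (i == l1))%N) in
     (l1 <> k.+1 ->
        let D'' := mkD k (fun i =>
          if i == l.-1 then (ent D i + 1)%N
          else if i == l then 0%N
          else if i == l1 then (ent D i - 1)%N
          else if i == l1.+1 then
            if l1 == k then ((ent D i + 1) %% 2)%N else (ent D i + 1)%N
          else ent D i) in
        ch R D =
        (ch R D' +
         'q^(((p D'')%:R - (p D)%:R) / 4 + (ent D l1)%:R / 2) * ch R D'')%qz)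
     /\ (l1 = k.+1 -> ch R D = ch R D')).
Proof.
set N := beta D l.-1.
have Nl : N = (ent D l + beta D l)%N := @beta_l k D l hl.
have ik : (l.-2 < k)%N by lia.
pose i0 : 'I_k := Ordinal ik.
split=> [dl2 D' D''|dl l1 hl1 dl1 gap0 D'].
  have D'_ent t : ((if t == l then (ent D t - 2)%N else ent D t) +
      count_mem t [:: l; l] = ent D t + count_mem t [::])%N.
    by clear - dl2; have [->|tl] := eqVneq t l; rewrite /=; lia.
  (* For l = k and d_(k+1) = 1 the reduction modulo 2 replaces 2 by 0, that is, removes two further
     units at position k + 1. *)
  have D''_ent t : ((if t == l.-1 then (ent D t + 1)%N
      else if t == l then (ent D t - 2)%N
      else if t == l.+1 then
        if l == k then ((ent D t + 1) %% 2)%N else (ent D t + 1)%N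
      else ent D t) + count_mem t [:: l, l & nseq (2 * ((l == k) * ent D k.+1)) k.+1] =
      ent D t + count_mem t [:: l.-1; l.+1])%N.
    rewrite /= count_nseq /=; clear - hl dl2 hDlast.
    have [->|tl'] := eqVneq t l.-1; first by lia.
    have [->|tl] := eqVneq t l; first by lia.
    have [tl1|tl1] := eqVneq t l.+1; case: (eqVneq l k) => lk.
    - rewrite tl1 lk; case: (ent D k.+1) hDlast => [|[]] //; lia.
    - by lia.
    - have -> : (k.+1 == t) = false by lia.
      by lia.
    - by lia.
  have jk : (l.-1 < k)%N by lia.
  pose j0 : 'I_k := Ordinal jk.
  have jb : slots D j0 = beta D l by rewrite /slots /= prednK //; lia.
  have H : splittable (slots D) N i0 j0.
    by apply: (@splittable_slots _ _ _ hl hDl l) => //; [lia | move=> q; lia].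
  apply: (ch_split (n := (l == k) * ent D k.+1) H) => [a c|q|].
  - apply: (congr1 (fun lam => dimLb R lam a c)); apply: funext => q.
    have := @beta_change k D _ [:: l; l] [::] q.+1 (fun t _ => D'_ent t).
    rewrite -/D' -/(slots D' q) -/(slots D q) /= => E.
    rewrite /drop_top; move: E; have [ql|ql] := ltnP q.+1 l.
      by rewrite (slots_lt_l hl hDl) // eqxx; lia.
    have : (slots D q <= beta D l)%N by apply: beta_leq => //; have := ltn_ord q; lia.
    by case: eqP; lia.
  - have := @beta_change k D _ [:: l, l & nseq (2 * ((l == k) * ent D k.+1)) k.+1]
      [:: l.-1; l.+1] q.+1 (fun t _ => D''_ent t).
    rewrite -/D'' -/(slots D'' q) -/(slots D q) /= count_nseq => E.
    have qk := ltn_ord q; rewrite /balance; move: E.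
    have [->|qi] := eqVneq q i0.
      by rewrite (slots_lt_l hl hDl) /=; lia.
    have {}qi : (q : nat) <> l.-2 by move=> qE; case/eqP: qi; apply: val_inj.
    have [->|qj] := eqVneq q j0; first by rewrite jb /=; lia.
    have {}qj : (q : nat) <> l.-1 by move=> qE; case/eqP: qj; apply: val_inj.
    by lia.
  (* Here N = d_l + beta_l, so N - beta_l - 1 is d_l - 1. *)
  - rewrite jb -/N Nl addnK natrB //; lia.
have mid := @slots_mid k D l hl l1 hl1 dl dl1 gap0.
have Nl1 : N.-1 = (ent D l1 + beta D l1)%N := @beta_l1 k D l hl l1 hl1 dl dl1 gap0.
have D'E a c : dimLb R (slots D') a c = dimLb R (drop_top (slots D) N) a c.
  exact: dimLb_D'.
split=> [l1k D''|l1k]; last first.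
  apply: funext => a; apply: funext => b; rewrite !chE D'E /dimLb.
  (* With l_1 = k + 1 the slots before l have length N and all others have length N - 1; moreover N
     >= 2, because N - 1 is at least d_(l_1) > 0. *)
  rewrite (@Lb_drop_top_eq R k (slots D) N) // => [|q]; first lia.
  have [ql|ql] := ltnP q.+1 l; first by left; exact: (slots_lt_l hl hDl).
  by right; apply: mid; have := ltn_ord q; lia.
have D''_ent t : ((if t == l.-1 then (ent D t + 1)%N
    else if t == l then 0%N
    else if t == l1 then (ent D t - 1)%N
    else if t == l1.+1 then
      if l1 == k then ((ent D t + 1) %% 2)%N else (ent D t + 1)%N
    else ent D t) + count_mem t [:: l, l1 & nseq (2 * ((l1 == k) * ent D k.+1)) k.+1] =
    ent D t + count_mem t [:: l.-1; l1.+1])%N.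
  rewrite /= count_nseq /=; clear - hl hl1 dl dl1 hDlast l1k.
  have [->|tl'] := eqVneq t l.-1; first by lia.
  have [->|tl] := eqVneq t l; first by lia.
  have [->|tl1] := eqVneq t l1; first by lia.
  have [tl1'|tl1'] := eqVneq t l1.+1; case: (eqVneq l1 k) => lk.
  - rewrite tl1' lk; case: (ent D k.+1) hDlast => [|[]] //; lia.
  - by lia.
  - have -> : (k.+1 == t) = false by lia.
    by lia.
  - by lia.
have jk : (l1.-1 < k)%N by lia.
pose j0 : 'I_k := Ordinal jk.
have jb : slots D j0 = beta D l1 by rewrite /slots /= prednK //; lia.
have H : splittable (slots D) N i0 j0.
  by apply: (@splittable_slots _ _ _ hl hDl l1) => //; lia.
apply: (ch_split (n := (l1 == k) * ent D k.+1) H) => [//|q|].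
  have := @beta_change k D _ [:: l, l1 & nseq (2 * ((l1 == k) * ent D k.+1)) k.+1]
    [:: l.-1; l1.+1] q.+1 (fun t _ => D''_ent t).
  rewrite -/D'' -/(slots D'' q) -/(slots D q) /= count_nseq => E.
  have qk := ltn_ord q; rewrite /balance; move: E.
  have [->|qi] := eqVneq q i0.
    by rewrite (slots_lt_l hl hDl) /=; lia.
  have {}qi : (q : nat) <> l.-2 by move=> qE; case/eqP: qi; apply: val_inj.
  have [->|qj] := eqVneq q j0; first by rewrite jb /=; lia.
  have {}qj : (q : nat) <> l1.-1 by move=> qE; case/eqP: qj; apply: val_inj.
  by lia.
(* Here it is N - 1 that equals d_(l_1) + beta_(l_1), so nothing is subtracted from d_(l_1), in
   contrast to case a). *)
by rewrite jb -/N; congr (_%:R / 2); lia.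
Qed.
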